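(* Let $(X,d)$ be a compact metric space and let $f:X\to X$ be a continuous map such that $(X,f)$ has the approximate product property and positive topological entropy. Let $\phi:X\to\mathbb{R}$ be continuous. Suppose that $Z=\bigcup_{i=1}^n Z_i$ is a finite union of subsets of $X$ such that for each $i=1,\dots,n$ one of the following holds: (1) $Z_i$ is a single forward orbit, i.e. $Z_i=O_f(x_i)$ for some $x_i\in X$; (2) for some given $\mu_i\in\mathcal{M}(X,f)$, $Z_i$ consists of all points whose empirical measures accumulate to $\mu_i$, i.e. $Z_i=\{x\in X:\mu_i\in\Omega(x)\}$ (in particular, $Z_i$ may contain all generic points for $\mu_i$, i.e. all $x$ with $\Omega(x)=\{\mu_i\}$); (3) $Z_i$ is a compact $f$-invariant subset of $X$ such that $\mathcal{M}(Z_i,f)\neq\mathcal{M}(X,f)$; (4) $Z_i$ consists of the points with weak $K_i$-behavior, i.e. $Z_i=\{x\in X:\Omega(x)\cap K_i\neq\emptyset\}$, where $K_i$ is a compact subset of a proper weak face of $\mathcal{M}(X,f)$. Then $P(\mathcal{N}(f,Z),f,\phi)=P(f,\phi)$. In particular, $h(\mathcal{N}(f,Z),f)=h(f)$.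
   Context: $O_f(x):=\{f^n(x):n\in\mathbb{N}\}$, with $\mathbb{N}=\{0,1,2,\dots\}$, and $\mathcal{N}(f,Z):=\{x\in X:\overline{O_f(x)}\cap Z=\emptyset\}$. A set $Y\subset X$ is $f$-invariant if $f(Y)\subset Y$. $\mathcal{M}(X)$ is the space of Borel probability measures on $X$ with the weak-$*$ topology, $\mathcal{M}(X,f)$ the subspace of $f$-invariant ones. For compact $f$-invariant $Y$, $\mathcal{M}(Y,f)$ is the set of invariant probability measures of the subsystem $(Y,f)$, regarded as $\{\mu\in\mathcal{M}(X,f):\mu(Y)=1\}$. For $x\in X$ and an integer $n\ge1$, the empirical measure $\mathcal{E}(x,n)$ is defined by $\int\psi\,d\mathcal{E}(x,n)=\frac1n\sum_{k=0}^{n-1}\psi(f^k(x))$ for every $\psi\in C(X)$. $\Omega(x)$ is the set of all weak-$*$ accumulation points (subsequential limits) of the sequence $\{\mathcal{E}(x,n)\}_{n=1}^\infty$. Approximate product property: for every $\varepsilon,\delta_1,\delta_2>0$ there is $N>0$ such that for every $n\ge N$ and every sequence $\{x_k\}_{k=1}^\infty$ in $X$ there exist an increasing sequence of integers $\{s_k\}_{k=1}^\infty$ and $z\in X$ such that $s_1=0$, $n\le s_{k+1}-s_k<n(1+\delta_1)$ for each $k\ge1$, and $|\{0\le j\le n-1: d(f^{s_k+j}(z),f^j(x_k))>\varepsilon\}|<\delta_2 n$ for each $k\ge1$. Weak face: a convex subset $L$ of $\mathcal{M}(X,f)$ such that for every $\mu\in L$, if $\mu=\lambda\nu_1+(1-\lambda)\nu_2$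 with $\lambda\in(0,1)$ and $\nu_1,\nu_2\in\mathcal{M}(X,f)$, then $\nu_1,\nu_2\in L$. It is proper if $L\neq\mathcal{M}(X,f)$. Topological pressure on an arbitrary subset $Y\subset X$ is that of Pesin–Pitskel. For $\varepsilon>0$ let $B_n(x,\varepsilon)=\{y\in X: d(f^k(x),f^k(y))<\varepsilon,\ 0\le k<n\}$. For $s\in\mathbb{R}$ and $N\ge1$ put $M(Y,s,\varepsilon,N)=\inf\sum_i\exp\big(-s n_i+\sup_{y\in B_{n_i}(x_i,\varepsilon)}\sum_{k=0}^{n_i-1}\phi(f^k(y))\big)$, the infimum over all at most countable families $\{B_{n_i}(x_i,\varepsilon)\}$ covering $Y$ with $x_i\in X$, $n_i\ge N$. Let $M(Y,s,\varepsilon)=\lim_{N\to\infty}M(Y,s,\varepsilon,N)$, $P_\varepsilon(Y)=\inf\{s:M(Y,s,\varepsilon)=0\}$ and $P(Y,f,\phi)=\lim_{\varepsilon\to0}P_\varepsilon(Y)$. Then $h(Y,f):=P(Y,f,0)$, $P(f,\phi):=P(X,f,\phi)$, $h(f):=h(X,f)$; for compact $f$-invariant $Y$ these coincide with the usual topological pressure and entropy. *)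

(* Defs.v *)
From HB Require Import structures.
From mathcomp Require Import all_boot all_order all_algebra.
From mathcomp Require Import all_classical all_reals all_analysis.
From mathcomp Require Import lra measurable_realfun.
Import Order.TTheory GRing.Theory Num.Theory.
Import numFieldNormedType.Exports.

Set Implicit Arguments.
Unset Strict Implicit.
Unset Printing Implicit Defensive.

Local Open Scope classical_set_scope.
Local Open Scope ring_scope.

(* The library's measurable types are pointed, so the spaces below carry a
   point. This only excludes the empty space, whose entropy is -oo. *)
#[short(type="pointedMetricType")]
HB.structure Definition PointedMetric (R : numDomainType) :=
  {X of Metric R X & isPointed X}.

Section Dynamics.
Context {R : realType} {X : pointedMetricType R}.
Implicit Types (f : X -> X) (phi : X -> R) (x y z : X) (Y Z : set X).

Definition forward_orbit f x : set X := range (fun n => iter n f x).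

Definition avoiding f Z : set X :=
  [set x | closure (forward_orbit f x) `&` Z = set0].

Definition set_invariant f Y := f @` Y `<=` Y.

Definition approximate_product_property f :=
  forall eps delta1 delta2 : R, 0 < eps -> 0 < delta1 -> 0 < delta2 ->
  exists2 N : nat, (0 < N)%N &
  forall n : nat, (N <= n)%N -> forall x_ : nat -> X,
  exists (s : nat -> nat) (z : X),
    [/\ increasing_seq s, s 0%N = 0%N,
        forall k, (n <= s k.+1 - s k)%N /\
                  (s k.+1 - s k)%N%:R < n%:R * (1 + delta1) &
        forall k,
          #|[pred j : 'I_n |
              eps < mdist (iter (s k + j) f z) (iter j f (x_ k))]|%:R
          < delta2 * n%:R].

Definition birkhoff_sum f phi n x : R := \sum_(0 <= k < n) phi (iter k f x).

Definition bowen_ball f n x (eps : R) : set X :=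
  [set y | forall k, (k < n)%N -> mdist (iter k f x) (iter k f y) < eps].

Local Open Scope ereal_scope.

(* A cover is encoded by the set of its centre/length pairs (x_i, n_i). *)
Definition bowen_cover f Y (eps : R) (N : nat) (C : set (X * nat)) :=
  [/\ countable C, forall p, C p -> (N <= p.2)%N &
      Y `<=` \bigcup_(p in C) bowen_ball f p.2 p.1 eps].

Definition cover_weight f phi (s eps : R) (C : set (X * nat)) : \bar R :=
  \esum_(p in C) expeR (- (s * p.2%:R)%:E +
    ereal_sup [set (birkhoff_sum f phi p.2 y)%:E
              | y in bowen_ball f p.2 p.1 eps]).

Definition pressure_MN f phi Y (s eps : R) (N : nat) : \bar R :=
  ereal_inf [set cover_weight f phi s eps C | C in bowen_cover f Y eps N].

Definition pressure_M f phi Y (s eps : R) : \bar R :=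
  limn (pressure_MN f phi Y s eps).

Definition pressure_eps f phi Y (eps : R) : \bar R :=
  ereal_inf [set s%:E | s in [set s : R | pressure_M f phi Y s eps = 0]].

(* For continuous phi on compact X this limit exists in \bar R, although
   pressure_eps need not be monotone in eps: the suprema over Bowen balls
   change with eps. *)
Definition pressure f phi Y : \bar R :=
  lim (pressure_eps f phi Y eps @[eps --> (0 : R)^'+]).

Definition entropy f Y : \bar R := pressure f (cst 0%R) Y.

End Dynamics.

Notation borel X := (g_sigma_algebraType (@open X)).

Definition borel_probability (R : realType) (X : pointedMetricType R) :=
  probability (borel X) R.

Identity Coercion borel_probability_probability :
  borel_probability >-> Probability.type.

Definition integrate (R : realType) (X : pointedMetricType R)
    (mu : borel_probability X) :
    prod_topology (fun _ : continuousType X R => R) :=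
  fun psi => \int[mu]_x psi x.

HB.instance Definition _ (R : realType) (X : pointedMetricType R) :=
  Topological.copy (borel_probability X) (initial_topology (@integrate R X)).

Lemma wstar_cvgP (R : realType) (X : pointedMetricType R)
    (F : set_system (borel_probability X)) {FF : Filter F}
    (mu : borel_probability X) :
  F --> mu <-> forall psi : continuousType X R,
     integrate nu psi @[nu --> F] --> (integrate mu psi : R).
Proof.
split=> [Fmu psi|H].
  have c : continuous (@integrate R X : borel_probability X -> _).
    exact: initial_continuous.
  have I : @integrate R X nu @[nu --> F] --> integrate mu.
    by apply: (cvg_comp _ _ Fmu); exact: c.
  have J := @proj_continuous _
    (fun _ : continuousType X R => R : topologicalType) psi (integrate mu).
  exact: (cvg_comp _ _ I J).
have I : @integrate R X nu @[nu --> F] --> integrate mu.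
  apply/cvg_sup => psi.
  apply/cvg_image.
    apply/seteqP; split=> // r _ /=; exists (fun=> r) => //.
  move=> A /= /(H psi) FA.
  exists [set g : (forall _ : continuousType X R, R) | A (g psi)] => //.
  apply/seteqP; split=> [r [g ? <-]//|r Ar]. by exists (fun=> r).
move=> A [B [[C oC CB] Bm BA]].
have : nbhs (integrate mu) C by apply: open_nbhs_nbhs; split=> //; move: Bm; rewrite -CB.
move/I; rewrite /nbhs/=; apply: filterS => nu Cnu; apply: BA; rewrite -CB; exact: Cnu.
Qed.

Section Measures.
Context {R : realType} {X : pointedMetricType R}.
Implicit Types (f : X -> X) (x : X) (Y : set X) (mu nu : borel_probability X).

(* mnormalize uses its second argument only when n = 0. *)
Definition empirical f x (n : nat) : borel_probability X :=
  mnormalize (msum (fun k => \d_(iter k f x : borel X)) n)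
             (\d_(x : borel X)).

Definition empirical_limits f x : set (borel_probability X) :=
  [set mu | exists2 u : nat -> nat,
     increasing_seq u & empirical f x (u k) @[k --> \oo] --> mu].

Definition invariant_measures f : set (borel_probability X) :=
  [set mu | forall A : set (borel X), measurable A -> mu (f @^-1` A) = mu A].

Definition invariant_measures_on f Y : set (borel_probability X) :=
  [set mu | invariant_measures f mu /\ mu Y = 1%E].

(* Elements of a library measure type may differ outside the sigma-algebra, so
   mu = t nu1 + (1 - t) nu2 is stated on Borel sets. Consequently a convex set
   of measures contains, with any mu, all measures equal to mu on Borel sets. *)
Definition is_mixture (t : R) mu nu1 nu2 :=
  forall A : set (borel X), measurable A ->
    mu A = (t%:E * nu1 A + (1 - t)%:E * nu2 A)%E.

Definition convex_measures (L : set (borel_probability X)) :=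
  forall (t : R) mu nu1 nu2, 0 <= t <= 1 ->
    L nu1 -> L nu2 -> is_mixture t mu nu1 nu2 -> L mu.

Definition weak_face f (L : set (borel_probability X)) :=
  [/\ L `<=` invariant_measures f, convex_measures L &
      forall (t : R) mu nu1 nu2, L mu -> 0 < t < 1 ->
        invariant_measures f nu1 -> invariant_measures f nu2 ->
        is_mixture t mu nu1 nu2 -> L nu1 /\ L nu2].

Definition proper_weak_face f (L : set (borel_probability X)) :=
  weak_face f L /\ L <> invariant_measures f.

End Measures.

Lemma continuous_borel (R : realType) (X : pointedMetricType R) (psi : X -> R) :
  continuous psi -> measurable_fun [set: borel X] (psi : borel X -> R).
Proof.
move=> /continuousP cpsi.
apply: (measurability _ (RGenOInfty.measurableE R)).
move=> /= _ [_ [a ->]] <-; rewrite setTI; apply: sub_sigma_algebra.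
apply: cpsi; exact: interval_open.
Qed.

Lemma integrate_empirical (R : realType) (X : pointedMetricType R) f (x : X) n
    (psi : continuousType X R) : (0 < n)%N ->
  integrate (empirical f x n) psi = n%:R^-1 * birkhoff_sum f psi n x.
Proof.
move=> n0.
have mpsi : measurable_fun [set: borel X] (psi : borel X -> R).
  by apply: continuous_borel => y; exact: (@cts_fun _ _ psi).
have mE : measurable_fun [set: borel X]
    (EFin \o (psi : borel X -> R)) by exact/measurable_EFinP.
rewrite /integrate /Rintegral.
have n1 : 0 <= n%:R^-1 :> R by rewrite invr_ge0 ler0n.
pose c : {nonneg R} := NngNum n1.
pose m := msum (fun k => \d_(iter k f x : borel X) : measure _ R) n.
have -> : (\int[empirical f x n]_y (psi y)%:E = \int[mscale c m]_y (psi y)%:E)%E.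
  apply: eq_measure_integral => A mA _.
  have E : (\sum_(i < n) (\d_(iter i f x : borel X) : measure _ R) setT = n%:R%:E)%E.
    by under eq_bigr do rewrite /= diracT; rewrite sumEFin sumr_const card_ord.
  change (mnormalize m (\d_(x : borel X)) A = mscale c m A).
  have H : (msum (fun k => \d_(iter k f x : borel X) : measure _ R) n setT
      = n%:R%:E)%E by rewrite /msum E.
  rewrite /mnormalize /m.
  rewrite [X in (X == 0%E)]H [X in (X == +oo)%E]H [X in fine X]H.
  by rewrite eqe pnatr_eq0 eqn0Ngt n0/= muleC.
have P g : measurable_fun [set: borel X] g -> (forall y, 0 <= g y)%E ->
  (\int[mscale c m]_y g y = (n%:R^-1)%:E * \sum_(i < n) g (iter i f x))%E.
  move=> mg g0; rewrite ge0_integral_mscale// ge0_integral_measure_sum//; congr (_ * _)%E.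
  by apply: eq_bigr => i _; rewrite integral_dirac// diracT mul1e.
rewrite integralE !P//=; try exact: measurable_funepos; try exact: measurable_funeneg.
have Ep : (\sum_(i < n) (fun y : borel X => (psi y)%:E)^\+ (iter i f x) =
    (\sum_(i < n) Num.max (psi (iter i f x)) 0)%:E)%E.
  by rewrite -sumEFin; apply: eq_bigr => i _; rewrite funeposE EFin_max.
have En : (\sum_(i < n) (fun y : borel X => (psi y)%:E)^\- (iter i f x) =
    (\sum_(i < n) Num.max (- psi (iter i f x)) 0)%:E)%E.
  by rewrite -sumEFin; apply: eq_bigr => i _; rewrite funenegE EFin_max EFinN.
rewrite [X in (_ * X - _)%E]Ep [X in (_ - _ * X)%E]En.
rewrite -!EFinM -EFinB /= -mulrBr -sumrB /birkhoff_sum big_mkord.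
congr (_ * _); apply: eq_bigr => i _.
by case: leP => ?; case: leP => ?; lra.
Qed.

(* Main.v *)
(* The upper bound is monotonicity of pressure in the set. For the lower bound
   one builds, at every scale, a closed invariant set of nearly full pressure
   that misses Z. Its points trace periodic superblocks: most slots are free and
   carry arbitrary members of a Hamming-separated set of orbit segments of length
   L supporting almost the whole pressure, all with nearly equal averages of one
   test function g; the remaining slots are fixed. Part of the fixed slots follow
   segments whose mean behaviour is that of an invariant measure outside the i-th
   subsystem or weak face, so that every point of the constructed set keeps
   visiting regions which points of Z_i asymptotically neglect. The others follow
   segments with a high or a low average of g, in proportions chosen so that the
   resulting average avoids finitely many forbidden values, one for each orbit or
   prescribed measure. That some g has non-uniform averages follows from positive
   entropy. The pressure bound uses the product measure on words of free choices:
   once the pattern of gaps is known, a Bowen ball determines the word, and there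
   are few patterns as the gaps are short compared with L. *)
From HB Require Import structures.
Require Import Defs.
From mathcomp Require Import all_boot all_order all_algebra.
From mathcomp Require Import all_classical all_reals all_analysis.
From mathcomp Require Import zify ring lra measurable_realfun.
Import Order.TTheory GRing.Theory Num.Theory.
Import numFieldNormedType.Exports.

Set Implicit Arguments.
Unset Strict Implicit.
Unset Printing Implicit Defensive.

Local Open Scope classical_set_scope.
Local Open Scope ring_scope.

(** * Combinatorics *)

Section Counting.
Context {R : realType}.

(** Tracing tolerates errors at a small share of times and gaps that depend on the traced sequence.
    Only Hamming-type information about segments survives, so points of Z must be excluded by
    frequencies of visits or by averages. The segments imitating an outside measure [nu] fill only a
    share [tau] of the slots, since most slots must stay free for pressure; a constructed orbit thus
    sees [nu] with weight about [tau] inside an otherwise unknown mixture. That [nu] differs from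
    the measures of a compact set K would not exclude such mixtures. What does is that no measure of
    a weak face dominates [t * nu] for an invariant [nu] outside the face, however small t > 0 is.
    Orbits and prescribed measures offer no region to visit, so for them a number is avoided: n + 1
    equally spaced values of the average of g are available, and each of the n sets can spoil at
    most one. Their spacing shrinks with the share of fixed slots, so all tracing errors are chosen
    after it. *)

Lemma sumr_const_seq (I : Type) (l : seq I) (K : R) :
  \sum_(i <- l) K = (size l)%:R * K.
Proof. by rewrite big_const_seq count_predT iter_addr_0 mulr_natl. Qed.

Lemma seq_lower_bound (T : eqType) (s : seq T) (r : T -> R) :
  (forall x, x \in s -> 0 < r x) ->
  exists2 e : R, 0 < e & forall x, x \in s -> e <= r x.
Proof.
elim: s => [_|a s IH rs]; first by exists 1.
have [x xs|e e0 He] := IH; first by apply: rs; rewrite in_cons xs orbT.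
exists (Num.min e (r a)).
  by rewrite lt_min e0 rs ?mem_head.
move=> x; rewrite in_cons => /predU1P[->|xs]; first by rewrite ge_min lexx orbT.
by rewrite ge_min He.
Qed.

(* Weighting each nonzero letter by [expR (- tau)] makes the generating
   function [(1 + K expR (- tau)) ^+ L]. *)
Lemma few_nonzero_letters (K : nat) (kappa : R) : 0 < kappa ->
  exists2 delta : R, 0 < delta & forall L : nat,
    #|[pred w : {ffun 'I_L -> 'I_K.+1} |
        #|[pred j | w j != ord0]|%:R <= delta * L%:R]|%:R <= expR (kappa * L%:R).
Proof.
move=> kappa0.
(* As [expR tau >= tau], this gives [K * expR (- tau) <= kappa / 2]. With [delta * tau = kappa / 2]
   below, the two halves add up to [kappa]. *)
pose tau : R := 1 + K%:R * 2 / kappa.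
have K0 : 0 <= K%:R :> R by rewrite ler0n.
have tau0 : 0 < tau by rewrite ltr_pwDl// divr_ge0 ?mulr_ge0// ltW.
have Ktau : K%:R * expR (- tau) <= kappa / 2.
  rewrite expRN ler_pdivrMr ?expR_gt0//.
  apply: (@le_trans _ _ (kappa / 2 * tau)).
    by rewrite /tau mulrDr mulr1 [X in _ + X](_ : _ = K%:R) ?lerDr; [lra|field; lra].
  by rewrite ler_wpM2l//; [lra|rewrite (le_trans _ (expR_ge1Dx _))// lerDr].
exists (kappa / 2 / tau); first by rewrite !divr_gt0.
move=> L; set P := [pred w : {ffun _ -> _} | _].
pose nz (w : {ffun 'I_L -> 'I_K.+1}) := #|[pred j | w j != ord0]|.
have total : \sum_(w : {ffun 'I_L -> 'I_K.+1}) expR (- tau * (nz w)%:R) =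
    (1 + K%:R * expR (- tau)) ^+ L.
  transitivity (\prod_(j < L) \sum_(a < K.+1) expR (- tau * (a != ord0)%:R)).
    rewrite bigA_distr_bigA; apply: eq_bigr => w _.
    by rewrite -expR_sum -mulr_sumr -natr_sum /nz -sum1_card -big_mkcond.
  rewrite prodr_const card_ord; congr (_ ^+ _).
  rewrite big_ord_recl eqxx mulr0 expR0; congr (_ + _).
  under eq_bigr do rewrite mulr1.
  by rewrite sumr_const card_ord mulr_natl.
have : \sum_(w in P) expR (- (kappa / 2 * L%:R)) <=
    \sum_(w : {ffun 'I_L -> 'I_K.+1}) expR (- tau * (nz w)%:R).
  rewrite [leRHS](bigID (mem P))/= -[leLHS]addr0.
  apply: lerD; last by apply: sumr_ge0 => *; exact: expR_ge0.
  apply: ler_sum => w; rewrite inE => Pw.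
  rewrite ler_expR mulNr lerN2 mulrC -ler_pdivlMr//.
  by rewrite mulrAC.
rewrite sumr_const total -(mulr_natl (expR _)) expRN.
rewrite ler_pdivrMr ?expR_gt0// => /le_trans; apply.
have -> : kappa * L%:R = kappa / 2 * L%:R + kappa / 2 * L%:R by field.
rewrite expRD ler_wpM2r ?expR_ge0// expRM_natr.
rewrite lerXn2r ?nnegrE ?expR_ge0// ?addr_ge0// ?mulr_ge0 ?expR_ge0//.
by rewrite (le_trans (expR_ge1Dx _))// ler_expR.
Qed.

(** One point is kept in each attained fibre of [code]. The points kept lie in [P] itself, so that
    properties defining [P] stay available along the list. *)
Lemma code_representatives (X : pointedType) (T : finType) (code : X -> T)
    (P : set X) (A : pred T) :
  (forall x, P x -> A (code x)) ->
  exists D : seq X, [/\ (size D <= #|A|)%N, forall d, d \in D -> P d &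
    forall x, P x -> exists2 d, d \in D & code d = code x].
Proof.
move=> PA; pose S t := [set x | P x /\ code x = t].
pose B := [pred t in A | `[<S t !=set0>]].
exists [seq xget point (S t) | t <- enum B]; split.
- rewrite size_map -cardE; apply: subset_leq_card.
  by apply/fintype.subsetP => t /andP[].
- move=> d /mapP[t]; rewrite mem_enum => /andP[_ /asboolP[y Sy]] ->.
  by have [] := xgetPex point (ex_intro _ y Sy).
- move=> x Px; exists (xget point (S (code x))); last first.
    by have [|] := @xgetPex _ point (S (code x)); first by exists x.
  apply/mapP; exists (code x) => //; rewrite mem_enum; apply/andP; split.
    exact: PA.
  by apply/asboolP; exists x.
Qed.

(** A point is kept only if no point kept so far is close to it. Reflexivity of [close] is not
    assumed, whence the alternative [x = y] in the covering clause. *)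
Lemma greedy_separated (T : eqType) (close : rel T) (s : seq T) :
  symmetric close ->
  exists E : seq T, [/\ uniq E, {subset E <= s},
    forall x y, x \in E -> y \in E -> close x y -> x = y &
    forall x, x \in s -> exists2 y, y \in E & x = y \/ close x y].
Proof.
move=> sym; elim: s => [|a s [E [uE Es sep cov]]]; first by exists [::].
have [/hasP[b bE ab]|/hasPn far] := boolP (has (close a) E).
  exists E; split => //; first by move=> x /Es xs; rewrite in_cons xs orbT.
  move=> x; rewrite in_cons => /predU1P[->|/cov//]; first by exists b => //; right.
have [aE|aE] := boolP (a \in E).
  exists E; split => //; first by move=> x /Es xs; rewrite in_cons xs orbT.
  by move=> x; rewrite in_cons => /predU1P[->|/cov//]; exists a => //; left.
exists (a :: E); split => /=.
- by rewrite aE.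
- move=> x; rewrite !in_cons => /predU1P[->|/Es ->]; first by rewrite eqxx.
  by rewrite orbT.
- move=> x y; rewrite !in_cons => /predU1P[->|xE] /predU1P[->|yE]//.
  + by rewrite (negbTE (far _ yE)).
  + by rewrite sym (negbTE (far _ xE)).
  + exact: sep.
- move=> x; rewrite in_cons => /predU1P[->|/cov[y yE xy]].
    by exists a; [rewrite mem_head|left].
  by exists y; rewrite // in_cons yE orbT.
Qed.

End Counting.

(** * Orbit segments and tracing *)

Section MetricDynamics.
Context {R : realType} {X : pointedMetricType R}.

Lemma open_mdist_lt (x : X) (e : R) : open [set y | mdist x y < e].
Proof.
rewrite openE => y /= xy; apply/nbhs_ballP; exists (e - mdist x y) => /=.
  by rewrite subr_gt0.
move=> z; rewrite ballEmdist /= ltrBrDl; apply: le_lt_trans.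
exact: metric_triangle.
Qed.

Lemma continuous_iter (f : X -> X) n : continuous f -> continuous (iter n f).
Proof.
move=> cf; elim: n => [|n IH] x; first exact: cvg_id.
by apply: (@continuous_comp _ _ _ (iter n f) f); [exact: IH|exact: cf].
Qed.

Lemma open_bowen_ball (f : X -> X) : continuous f ->
  forall n x (e : R), open (bowen_ball f n x e).
Proof.
move=> cf n x e; elim: n => [|n IH].
  by rewrite (_ : bowen_ball _ _ _ _ = setT); [exact: openT|apply/seteqP].
have -> : bowen_ball f n.+1 x e = bowen_ball f n x e `&`
    (iter n f @^-1` [set y | mdist (iter n f x) y < e]).
  apply/seteqP; split => y /=.
    by move=> H; split=> [k kn|]; apply: H => //; exact: ltnW.
  by move=> [H Hn] k; rewrite ltnS leq_eqVlt => /predU1P[->//|]; exact: H.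
apply: openI => //; apply: open_comp; last exact: open_mdist_lt.
by move=> y _; exact: continuous_iter.
Qed.

(** The subcover comes as a duplicate-free list so that a sum over it is bounded by the [\esum] over
    the whole cover. *)
Lemma compact_seq_cover (T : ptopologicalType) (A : set T) (I : choiceType)
    (D : set I) (B : I -> set T) : compact A ->
  (forall i, D i -> open (B i)) -> A `<=` \bigcup_(i in D) B i ->
  exists s : seq I, [/\ uniq s, forall i, i \in s -> D i &
    forall x, A x -> exists2 i, i \in s & B i x].
Proof.
rewrite compact_cover => cA oB AB; have [D' D'D AD'] := cA _ _ _ oB AB.
exists (finmap.enum_fset D'); split; first exact: finmap.fset_uniq.
  by move=> i iD'; have := D'D i iD'; rewrite inE.
by move=> x /AD'[i iD' Bi]; exists i.
Qed.

Lemma bowen_net (f : X -> X) (n : nat) (e : R) :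
  compact [set: X] -> continuous f -> 0 < e ->
  exists s : seq X, forall x, exists2 y, y \in s & bowen_ball f n y e x.
Proof.
move=> cX cf e0.
have [||s [_ _ Hs]] := @compact_seq_cover X setT X setT
  (fun y => bowen_ball f n y e) cX.
- by move=> y _; exact: open_bowen_ball.
- by move=> x _; exists x => // k _; rewrite mdistxx.
- by exists s => x; exact: Hs.
Qed.

Lemma compact_unif_continuous (g : X -> R) (eta : R) :
  compact [set: X] -> continuous g -> 0 < eta ->
  exists2 e : R, 0 < e & forall x y, mdist x y <= e -> `|g x - g y| <= eta.
Proof.
move=> cX cg eta0.
have rP x : exists r : R, 0 < r /\
    forall y, mdist x y < r + r -> `|g x - g y| < eta / 2.
  have /cvgr_dist_lt/(_ (eta / 2)) := cg x.
  rewrite divr_gt0// => /(_ isT)/nbhs_ballP[r /= r0 Hr].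
  exists (r / 2); split; first by rewrite divr_gt0.
  by move=> y; rewrite -splitr => xy; apply: Hr; rewrite ballEmdist.
have {rP}[r rP] := choice rP.
have [||s [_ _ Hs]] := @compact_seq_cover X setT X setT
  (fun y => [set z | mdist y z < r y]) cX.
- by move=> y _; exact: open_mdist_lt.
- by move=> x _; exists x => //=; rewrite mdistxx; have [] := rP x.
have [x xs|e e0 He] := @seq_lower_bound R X s r; first by have [] := rP x.
exists e => // x y xy; have [z zs /= zx] := Hs x I.
have [_ Hz] := rP z; have rz := He _ zs.
have /Hz zx2 : mdist z x < r z + r z by have [] := rP z; lra.
have /Hz zy2 : mdist z y < r z + r z.
  by have := metric_triangle z x y; lra.
have -> : g x - g y = (g z - g y) - (g z - g x) by ring.
by rewrite (le_trans (ler_normB _ _))//; lra.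
Qed.

Lemma compact_bounded (g : X -> R) : compact [set: X] -> continuous g ->
  exists2 C : R, 1 <= C & forall x, `|g x| <= C.
Proof.
move=> cX cg; have [|e e0 He] := @compact_unif_continuous g 1 cX cg; first by [].
have [s Hs] := @bowen_net id 1 e cX (fun x => cvg_id) e0.
exists (1 + \sum_(y <- s) `|g y|); first by rewrite lerDl sumr_ge0.
move=> x; have [y ys xy] := Hs x; have {}xy : mdist y x <= e by exact/ltW/(xy 0%N).
rewrite (le_trans (_ : _ <= 1 + `|g y|))//.
  have := He _ _ xy; rewrite distrC => gxy.
  by rewrite -[g x](subrK (g y)) (le_trans (ler_normD _ _))// lerD2r.
by rewrite lerD2l (big_rem y)//= lerDl sumr_ge0.
Qed.

Lemma urysohn_closed (A B : set X) : compact [set: X] ->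
  closed A -> closed B -> A `&` B = set0 ->
  exists g : X -> R, [/\ continuous g, forall y, 0 <= g y <= 1,
    forall y, A y -> g y = 0 & forall y, B y -> g y = 1].
Proof.
move=> cX cA cB AB0.
have nX : normal_space X by apply: compact_normal => //; exact: metric_hausdorff.
have AB : uniform_separator A B by move/normal_separatorP : nX; apply.
exists (Urysohn A B); split.
- exact: Urysohn_continuous.
- move=> y; have := @Urysohn_range X R A B (Urysohn A B y) (ex_intro2 _ _ y I erefl).
  by rewrite /= in_itv.
- by move=> y Ay; apply: (Urysohn_sub0 AB); exists y.
- by move=> y By; apply: (Urysohn_sub1 AB); exists y.
Qed.

End MetricDynamics.

Section OrbitSegments.
Context {R : realType} {X : pointedMetricType R} (f : X -> X).

(** An unnormalised Hamming distance at resolution [e]. The reference [c] is an arbitrary sequence,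
    so that concatenated pieces of orbits can serve as reference too. *)
Definition mismatch (n : nat) (e : R) (y : X) (c : nat -> X) : nat :=
  #|[pred j : 'I_n | e < mdist (iter j f y) (c j)]|.

Lemma mismatch_sum n e y c :
  mismatch n e y c = (\sum_(0 <= j < n) (e < mdist (iter j f y) (c j))%R)%N.
Proof. by rewrite /mismatch -sum1_card big_mkcond big_mkord. Qed.

Lemma mismatch_sym n e x y :
  mismatch n e x (fun j => iter j f y) = mismatch n e y (fun j => iter j f x).
Proof. by rewrite !mismatch_sum; apply: eq_bigr => j _; rewrite metric_sym. Qed.

(** At a time where the distance exceeds [e1 + e2], one of the two partial distances exceeds its own
    bound: scales and counts both add. *)
Lemma mismatch_triangle n e1 e2 y z c :
  (mismatch n (e1 + e2) y c <=
   mismatch n e1 y (fun j => iter j f z) + mismatch n e2 z c)%N.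
Proof.
rewrite !mismatch_sum -big_split/=; apply: leq_sum => j _.
case: (ltP e1 _) => H1; case: (ltP e2 _) => H2; case: ltP => //.
by have := metric_triangle (iter j f y) (iter j f z) (c j); lra.
Qed.

Lemma mismatch_eq0 n e y c :
  (forall j, (j < n)%N -> mdist (iter j f y) (c j) <= e) -> mismatch n e y c = 0%N.
Proof.
move=> H; rewrite mismatch_sum big_nat_cond big1// => j /andP[/andP[_ jn] _].
by rewrite ltNge H.
Qed.

Lemma birkhoff_sumD (g : X -> R) m n x :
  birkhoff_sum f g (m + n) x = birkhoff_sum f g m x + birkhoff_sum f g n (iter m f x).
Proof.
rewrite /birkhoff_sum (@big_cat_nat _ _ _ m)//= ?leq_addr//; congr (_ + _).
rewrite -{1}[m]add0n big_addn addKn.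
by apply: eq_bigr => k _; rewrite iterD.
Qed.

Lemma birkhoff_sum_ge (g : X -> R) (c : R) n x :
  (forall y, c <= g y) -> n%:R * c <= birkhoff_sum f g n x.
Proof.
move=> cg; rewrite /birkhoff_sum big_mkord.
rewrite (le_trans _ (ler_sum _ (fun k _ => cg _)))//.
by rewrite sumr_const card_ord mulr_natl.
Qed.

Lemma birkhoff_sum_le (g : X -> R) (c : R) n x :
  (forall y, g y <= c) -> birkhoff_sum f g n x <= n%:R * c.
Proof.
move=> cg; rewrite /birkhoff_sum big_mkord.
rewrite (le_trans (ler_sum _ (fun k _ => cg _)))//.
by rewrite sumr_const card_ord mulr_natl.
Qed.

Lemma birkhoff_sumN (g : X -> R) n x :
  birkhoff_sum f (fun y => - g y) n x = - birkhoff_sum f g n x.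
Proof. by rewrite /birkhoff_sum sumrN. Qed.

Lemma continuous_birkhoff_sum (g : X -> R) n : continuous f -> continuous g ->
  continuous (birkhoff_sum f g n).
Proof.
move=> cf cg x; rewrite /birkhoff_sum.
elim: n => [|n IH].
  under [X in continuous_at _ X]funext do rewrite big_nil.
  exact: cvg_cst.
under [X in continuous_at _ X]funext do rewrite big_nat_recr//=.
apply: cvgD; first exact: IH.
by apply: (@continuous_comp _ _ _ (iter n f) g); [exact: continuous_iter|exact: cg].
Qed.

Lemma birkhoff_sum_mismatch (g : X -> R) (C eta e : R) n y x :
  (forall y, `|g y| <= C) ->
  (forall x y, mdist x y <= e -> `|g x - g y| <= eta) -> 0 <= eta ->
  `|birkhoff_sum f g n y - birkhoff_sum f g n x| <=
    n%:R * eta + 2 * C * (mismatch n e y (fun j => iter j f x))%:R.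
Proof.
move=> gC ge eta0; rewrite /birkhoff_sum -sumrB mismatch_sum natr_sum mulr_sumr.
rewrite (le_trans (ler_norm_sum _ _ _))//.
have -> : n%:R * eta = \sum_(0 <= i < n) eta.
  by rewrite sumr_const_nat subn0 mulr_natl.
rewrite -big_split/=; apply: ler_sum => k _.
have C0 : 0 <= C by rewrite (le_trans _ (gC x)).
case: ltP => d; rewrite ?mulr0 ?addr0; last exact: ge.
rewrite mulr1 (le_trans (ler_normB _ _))//.
by have := gC (iter k f y); have := gC (iter k f x); lra.
Qed.

End OrbitSegments.

(** * Hamming tubes around a sequence contain few orbit segments *)

Section Tubes.
Context {R : realType} {X : pointedMetricType R} (f : X -> X).

(** A segment in the tube is coded by the letter 0 at times where it is [e]-close to [c], and
    otherwise by one plus the index of a nearby net point. Few letters are nonzero, so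
    [few_nonzero_letters] counts the codes; equal codes force distance at most 2e at all times,
    through [c] or through the net point. *)
Lemma tube_cover (e kappa : R) : compact [set: X] -> 0 < e -> 0 < kappa ->
  exists2 delta0 : R, 0 < delta0 &
  forall (delta : R) (n : nat) (c : nat -> X), delta <= delta0 ->
  exists D : seq X, [/\ (size D)%:R <= expR (kappa * n%:R),
    forall d, d \in D -> (mismatch f n e d c)%:R <= delta * n%:R &
    forall y, (mismatch f n e y c)%:R <= delta * n%:R ->
      exists2 d, d \in D & forall j, (j < n)%N ->
        mdist (iter j f d) (iter j f y) < 3 * e].
Proof.
move=> cX e0 kappa0.
have [s Hs] := @bowen_net R X id 1 e cX (fun x => cvg_id) e0.
have [delta0 delta0_gt0 Hd] := @few_nonzero_letters R (size s) kappa kappa0.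
exists delta0 => // delta n c delta_le.
pose near x := find (fun y => mdist y x < e) s.
have near_lt x : (near x < size s)%N.
  rewrite -has_find; apply/hasP; have [y ys /(_ 0%N)] := Hs x.
  by move=> yx; exists y => //; exact: yx.
have nearP x : mdist (nth point s (near x)) x < e.
  by have := near_lt x; rewrite -has_find => /(nth_find point).
pose code y : {ffun 'I_n -> 'I_(size s).+1} := [ffun j : 'I_n =>
  if e < mdist (iter j f y) (c j) then inord (near (iter j f y)).+1 else ord0].
pose P := [set y | (mismatch f n e y c)%:R <= delta * n%:R].
have codeN0 y (j : 'I_n) : (code y j != ord0) = (e < mdist (iter j f y) (c j)).
  rewrite ffunE; case: ifP => _; last by rewrite eqxx.
  by apply/eqP => /(congr1 val); rewrite /= inordK// ltnS.
have [y Py|D [sD DP cD]] := @code_representatives _ _ code P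
    [pred w : {ffun 'I_n -> 'I_(size s).+1} |
        #|[pred j | w j != ord0]|%:R <= delta0 * n%:R].
  apply: (le_trans _ (ler_wpM2r (ler0n _ n) delta_le)).
  rewrite (_ : #|_| = mismatch f n e y c)//.
  by apply: eq_card => j; rewrite !inE codeN0.
exists D; split => //; first by rewrite (le_trans _ (Hd n))// ler_nat.
move=> y /cD[d dD dy]; exists d => // j jn.
have := congr1 (fun w : {ffun _ -> _} => w (Ordinal jn)) dy.
have := codeN0 d (Ordinal jn); have := codeN0 y (Ordinal jn).
move=> yj dj dyj; move: dj; rewrite dyj yj /= => edy.
have tri := metric_triangle (iter j f d) (c j) (iter j f y).
have sy := metric_sym (c j) (iter j f y).
move: edy; case: (ltP e) => ey; case: (ltP e) => ed // _; last lra.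
move: dyj; rewrite !ffunE /= ey ed => /(congr1 val)/=.
rewrite !inordK ?ltnS// => -[nn].
have := nearP (iter j f d); have := nearP (iter j f y); rewrite nn.
set p := nth _ _ _ => py pd.
have := metric_triangle (iter j f d) p (iter j f y).
have := metric_sym p (iter j f d); lra.
Qed.

End Tubes.

(** * Birkhoff averages of points that trace a sequence of segments *)

Section Tracing.
Context {R : realType} {X : pointedMetricType R} (f : X -> X).

(** The gap after a block is strictly below [G], so it takes at most [G] values and fits in ['I_G]
    when gap patterns are counted. *)
Definition traces (L G : nat) (e d : R) (s : nat -> nat) (z : X) (x : nat -> X) :=
  [/\ s 0%N = 0%N, forall k, (s k + L <= s k.+1 < s k + (L + G))%N &
    forall k, (mismatch f L e (iter (s k) f z) (fun j => iter j f (x k)))%:R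
      <= d * L%:R].

Section Bounds.
Context (L G : nat) (e d : R) (s : nat -> nat) (z : X) (x : nat -> X).
Context (tr : traces L G e d s z x).

Lemma traces_mono a b : (a <= b)%N -> (s a + (b - a) * L <= s b)%N.
Proof.
case: tr => _ gap _ /subnKC <-; rewrite addKn.
elim: (b - a)%N => [|q IH]; first by rewrite addn0 mul0n addn0.
by rewrite addnS mulSn; have /andP[+ _] := gap (a + q)%N; lia.
Qed.

Lemma traces_le_mul a b : (a <= b)%N -> (s b <= s a + (b - a) * (L + G))%N.
Proof.
case: tr => _ gap _ /subnKC <-; rewrite addKn.
elim: (b - a)%N => [|q IH]; first by rewrite addn0 mul0n addn0.
by rewrite addnS mulSn; have /andP[_ +] := gap (a + q)%N; lia.
Qed.

Lemma traces_block m : (0 < L)%N -> exists a, (s a <= m < s a.+1)%N.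
Proof.
case: tr => s0 gap _ L0; elim: m => [|m [a am]].
  by exists 0%N; rewrite s0/=; have := gap 0%N; lia.
have [?|?] := ltnP m.+1 (s a.+1); first by exists a; lia.
by exists a.+1; have := gap a.+1; lia.
Qed.

Context (g : X -> R) (C eta : R).
Context (gC : forall y, `|g y| <= C).
Context (ge : forall x y, mdist x y <= e -> `|g x - g y| <= eta).
Context (eta0 : 0 <= eta).

Let C0 : 0 <= C.
Proof. by rewrite (le_trans _ (gC z)). Qed.

(** The loss per block: oscillation at good times, [2 * C] at each of at most [d * L] bad times, and
    [C] for each step of the gap. *)
Definition tracing_error : R := L%:R * (eta + 2 * C * d) + C * G%:R.

Lemma birkhoff_sum_ge_norm n y : - (n%:R * C) <= birkhoff_sum f g n y.
Proof.
rewrite -mulrN; apply: birkhoff_sum_ge => w.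
by have := gC w; rewrite ler_norml => /andP[].
Qed.

Lemma birkhoff_sum_le_norm n y : birkhoff_sum f g n y <= n%:R * C.
Proof.
by apply: birkhoff_sum_le => w; have := gC w; rewrite ler_norml => /andP[].
Qed.

Lemma birkhoff_sum_blocks a b : (a <= b)%N ->
  \sum_(a <= k < b) birkhoff_sum f g L (x k) - (b - a)%:R * tracing_error <=
  birkhoff_sum f g (s b - s a) (iter (s a) f z).
Proof.
move=> /subnKC <-; rewrite addKn; elim: (b - a)%N => [|q IH].
  by rewrite addn0 subnn big_geq// /birkhoff_sum big_geq// mul0r subr0.
rewrite addnS big_nat_recr ?leq_addr//=.
have [s0 gap mis] := tr; set k := (a + q)%N in IH *.
have sak : (s a <= s k)%N by have := @traces_mono a k (leq_addr _ _); lia.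
have skS := gap k.
have -> : (s k.+1 - s a = (s k - s a) + (L + (s k.+1 - s k - L)))%N by lia.
rewrite birkhoff_sumD -iterD subnK// birkhoff_sumD.
have /(_ (s k.+1 - s k - L)%N (iter L f (iter (s k) f z))) := birkhoff_sum_ge_norm.
have rest : (s k.+1 - s k - L)%:R * C <= C * G%:R.
  by rewrite mulrC ler_wpM2l// ler_nat; lia.
have := @birkhoff_sum_mismatch R X f g C eta e L (iter (s k) f z) (x k) gC ge eta0.
rewrite ler_norml => /andP[+ _].
have : 2 * C * (mismatch f L e (iter (s k) f z) (fun j => iter j f (x k)))%:R <=
   2 * C * (d * L%:R) by rewrite ler_wpM2l ?mulr_ge0.
move: IH; rewrite -natr1 mulrDl mul1r /tracing_error; lra.
Qed.

(** The window from [m] to [m + N] is replaced by the full blocks between [s a] and [s b], at a cost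
    independent of [N]. One [tracing_error] is lost inside the blocks; the other two pay for
    replacing the number of blocks by [N / L], which ignores the gaps. Upper bounds are later
    obtained by applying this to the opposite function. *)
Lemma traces_average (U c0 : R) (u : nat -> R) m N : (0 < L)%N -> (G <= L)%N ->
  0 <= d ->
  (forall k, u k <= birkhoff_sum f g L (x k)) ->
  (forall b, `|\sum_(0 <= k < b) u k - b%:R * U| <= c0) ->
  `|U| <= L%:R * C ->
  N%:R * ((U - 3 * tracing_error) / L%:R) -
    2 * (c0 + C * (L + G)%:R + (L%:R * C + tracing_error)) <=
  birkhoff_sum f g N (iter m f z).
Proof.
move=> L0 GL d0 ux avg UC.
have [a am] := @traces_block m L0; have [b bm] := @traces_block (m + N) L0.
have ab : (a <= b)%N.
  rewrite leqNgt; apply/negP => /traces_mono.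
  by move=> /(leq_trans (leq_addr _ _)); lia.
have s0 := traces_mono ab; have s1 := traces_le_mul ab.
have [_ gap _] := tr; have gapa := gap a; have gapb := gap b.
set q := (b - a)%N in s0 s1; set E := tracing_error.
have [qLn NLn] : (q * L <= N + 2 * L)%N /\ (N <= q.+1 * (L + G))%N.
  by clearbody q; clear - s0 s1 am bm gapa gapb GL; lia.
have E0 : C * G%:R <= E.
  by rewrite /E /tracing_error lerDr mulr_ge0// addr_ge0// !mulr_ge0.
have {}E0 : 0 <= E by rewrite (le_trans _ E0)// mulr_ge0.
have blocks := birkhoff_sum_blocks ab.
have uavg : q%:R * U - 2 * c0 <= \sum_(a <= k < b) birkhoff_sum f g L (x k).
  apply: (@le_trans _ _ (\sum_(a <= k < b) u k)); last exact: ler_sum.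
  have := avg a; have := avg b.
  rewrite (big_cat_nat (leq0n _) ab)/= !ler_norml.
  rewrite /q natrB//; lra.
have dec : birkhoff_sum f g (m - s a) (iter (s a) f z) +
    birkhoff_sum f g N (iter m f z) =
    birkhoff_sum f g (s b - s a) (iter (s a) f z) +
    birkhoff_sum f g (m + N - s b) (iter (s b) f z).
  have -> : iter m f z = iter (m - s a) f (iter (s a) f z).
    by rewrite -iterD subnK//; lia.
  have -> : iter (s b) f z = iter (s b - s a) f (iter (s a) f z).
    by rewrite -iterD subnK//; lia.
  by rewrite -!birkhoff_sumD; congr birkhoff_sum; lia.
have [ma mNb] : (m - s a <= L + G)%N /\ (m + N - s b <= L + G)%N by lia.
have LG : (m - s a)%:R * C <= C * (L + G)%:R by rewrite mulrC ler_wpM2l// ler_nat.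
have LG' : (m + N - s b)%:R * C <= C * (L + G)%:R.
  by rewrite mulrC ler_wpM2l// ler_nat.
have := birkhoff_sum_le_norm (m - s a) (iter (s a) f z).
have := birkhoff_sum_ge_norm (m + N - s b) (iter (s b) f z).
suff : N%:R * ((U - 3 * E) / L%:R) - 2 * (L%:R * C + E) <= q%:R * (U - E).
  move: blocks uavg dec LG LG'; rewrite -/q -/E mulrBr; lra.
have Lp : 0 < L%:R :> R by rewrite ltr0n.
have qL : q%:R * L%:R <= N%:R + 2 * L%:R :> R.
  by rewrite -!natrM -natrD ler_nat.
have NL : N%:R <= (q%:R + 1) * (L%:R + G%:R) :> R.
  by rewrite natr1 -natrD -natrM ler_nat.
set M := L%:R * C + E.
have DM : `|U - E| <= M.
  by rewrite (le_trans (ler_normB _ _))// lerD// ger0_norm.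
(* The number [q] of blocks differs from [t] by at most [t * gam + 2]. The term [gam * M] is at most
   [2 * E], because [gam * (L * C) = C * G] is already part of the tracing error. *)
pose t : R := N%:R / L%:R; pose gam : R := G%:R / L%:R.
have t0 : 0 <= t by rewrite divr_ge0.
have gam0 : 0 <= gam by rewrite divr_ge0.
have gam1 : gam <= 1 by rewrite ler_pdivrMr// mul1r ler_nat.
have Nt : N%:R = t * L%:R by rewrite divfK ?gt_eqF.
have Gg : G%:R = gam * L%:R by rewrite divfK ?gt_eqF.
have qt : q%:R <= t + 2.
  by rewrite -(ler_pM2r Lp) mulrDl -Nt.
have tq : t * (1 - gam) <= q%:R + 1.
  have : t <= (q%:R + 1) * (1 + gam).
    by rewrite -(ler_pM2r Lp) -Nt (le_trans NL)// Gg; lra.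
  move=> /(ler_wpM2r (_ : 0 <= 1 - gam)) -/(_ ltac:(lra)) /le_trans; apply.
  rewrite -mulrA -[leRHS]mulr1 ler_wpM2l//.
  by have := sqr_ge0 gam; rewrite expr2; lra.
have qtabs : `|q%:R - t| <= t * gam + 2.
  rewrite ler_norml; have : 0 <= t * gam by rewrite mulr_ge0.
  by move: qt tq; rewrite mulrBr; lra.
have prod : - ((t * gam + 2) * M) <= (q%:R - t) * (U - E).
  have : `|(q%:R - t) * (U - E)| <= (t * gam + 2) * M by rewrite normrM ler_pM.
  by rewrite ler_norml => /andP[].
have gM : gam * M <= 2 * E.
  rewrite /M mulrDr mulrCA.
  have : gam * E <= E by rewrite -[leRHS]mul1r ler_wpM2r.
  have : gam * (L%:R * C) <= E.
    rewrite mulrA -Gg mulrC.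
    by rewrite /E /tracing_error lerDr mulr_ge0// addr_ge0// !mulr_ge0.
  rewrite mulrCA; lra.
have : t * (gam * M) <= t * (2 * E) by rewrite ler_wpM2l.
have -> : N%:R * ((U - 3 * E) / L%:R) = t * (U - E) - t * (2 * E).
  by rewrite Nt /t; field; rewrite gt_eqF.
move: prod; rewrite mulrDl -[t * gam * M]mulrA mulrBl -/M; lra.
Qed.

End Bounds.
End Tracing.

(** * Pesin-Pitskel pressure *)

Section PressureLemmas.
Context {R : realType} {X : pointedMetricType R} (f : X -> X) (phi : X -> R).
Implicit Types (Y : set X) (e s : R).

Definition ball_weight s e (q : X * nat) : \bar R :=
  (expeR (- (s * q.2%:R)%:E +
    ereal_sup [set (birkhoff_sum f phi q.2 y)%:E | y in bowen_ball f q.2 q.1 e]))%E.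

Lemma ball_weight_ge0 s e q : (0 <= ball_weight s e q)%E.
Proof. exact: expeR_ge0. Qed.

Lemma ball_weight_ge s e q y : bowen_ball f q.2 q.1 e y ->
  ((expR (- (s * q.2%:R) + birkhoff_sum f phi q.2 y))%:E <= ball_weight s e q)%E.
Proof.
move=> By; rewrite /ball_weight.
have : ((birkhoff_sum f phi q.2 y)%:E <=
    ereal_sup [set (birkhoff_sum f phi q.2 y)%:E | y in bowen_ball f q.2 q.1 e])%E.
  by apply: ereal_sup_ubound; exists y.
move: (ereal_sup _ : \bar R) => S.
case: S => [r| |] //=; rewrite ?leey// !lee_fin => Sr.
by rewrite ler_expR lerD2l.
Qed.

Lemma ball_weight_le s e q (c : R) :
  (forall y, bowen_ball f q.2 q.1 e y -> birkhoff_sum f phi q.2 y <= c) ->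
  (ball_weight s e q <= (expR (- (s * q.2%:R) + c))%:E)%E.
Proof.
move=> Bc; rewrite /ball_weight.
have : (ereal_sup [set (birkhoff_sum f phi q.2 y)%:E
    | y in bowen_ball f q.2 q.1 e] <= c%:E)%E.
  by apply: ge_ereal_sup => _ [y By <-]; rewrite lee_fin; exact: Bc.
move: (ereal_sup _ : \bar R) => [r| |]//=; rewrite ?lee_fin ?expR_ge0// => rc.
by rewrite ler_expR lerD2l.
Qed.

Lemma cover_weight_ge0 s e (C : set (X * nat)) : (0 <= cover_weight f phi s e C)%E.
Proof. by apply: esum_ge0 => q _; exact: ball_weight_ge0. Qed.

Lemma cover_weight_ge_seq s e (C : set (X * nat)) (l : seq (X * nat)) : uniq l ->
  (forall q, q \in l -> C q) ->
  (\sum_(q <- l) ball_weight s e q <= cover_weight f phi s e C)%E.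
Proof.
move=> ul lC; apply: esum_ge; exists [set` l].
  by split=> [|q]; [exact: finite_seq|exact: lC].
by rewrite -fsbig_seq.
Qed.

Lemma cover_weight_seq s e (l : seq (X * nat)) : uniq l ->
  cover_weight f phi s e [set` l] = (\sum_(q <- l) ball_weight s e q)%E.
Proof.
move=> ul; rewrite /cover_weight esum_fset; first by rewrite -fsbig_seq.
  exact: finite_seq.
by move=> q _; exact: ball_weight_ge0.
Qed.

Lemma pressure_MN_ge0 Y s e N : (0 <= pressure_MN f phi Y s e N)%E.
Proof. by apply: le_ereal_inf_tmp => _ [C _ <-]; exact: cover_weight_ge0. Qed.

Lemma pressure_MN_homo Y s e :
  {homo pressure_MN f phi Y s e : n m / (n <= m)%N >-> (n <= m)%E}.
Proof.
move=> n m nm; apply: ereal_inf_le_tmp => _ [C [cC Cm YC] <-].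
by exists C => //; split => // q Cq; rewrite (leq_trans nm)// Cm.
Qed.

Lemma pressure_MN_le_M Y s e N : (pressure_MN f phi Y s e N <= pressure_M f phi Y s e)%E.
Proof.
apply: lime_ge; first exact: (ereal_nondecreasing_is_cvgn (@pressure_MN_homo Y s e)).
by exists N => // m /= Nm; exact: pressure_MN_homo.
Qed.

Lemma pressure_M_le Y s e (c : \bar R) :
  (forall N, (pressure_MN f phi Y s e N <= c)%E) -> (pressure_M f phi Y s e <= c)%E.
Proof.
move=> H; apply: lime_le; last by exists 0%N => // m _ /=; exact: H.
exact: (ereal_nondecreasing_is_cvgn (@pressure_MN_homo Y s e)).
Qed.

Lemma pressure_M_ge0 Y s e : (0 <= pressure_M f phi Y s e)%E.
Proof. exact: le_trans (pressure_MN_ge0 _ _ _ 0%N) (pressure_MN_le_M _ _ _ _). Qed.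

Lemma pressure_M_sub Y Y' s e : Y `<=` Y' ->
  (pressure_M f phi Y s e <= pressure_M f phi Y' s e)%E.
Proof.
move=> YY'; apply: pressure_M_le => N.
apply: le_trans (pressure_MN_le_M _ _ _ N).
apply: ereal_inf_le_tmp => _ [C [cC CN Y'C] <-].
by exists C => //; split => //; exact: subset_trans Y'C.
Qed.

Lemma pressure_eps_sub Y Y' e : Y `<=` Y' ->
  (pressure_eps f phi Y e <= pressure_eps f phi Y' e)%E.
Proof.
move=> YY'; apply: ereal_inf_le_tmp => _ [s /= Ms <-]; exists s => //=.
apply/eqP; rewrite eq_le pressure_M_ge0 andbT -Ms; exact: pressure_M_sub.
Qed.

(** Covers of order 0 suffice because [pressure_MN] grows with the order; a positive bound on all
    weights rules [s] out of the infimum. *)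
Lemma pressure_eps_ge Y e (c : R) :
  (forall s, s < c -> exists2 K : R, 0 < K & forall C,
     bowen_cover f Y e 0 C -> (K%:E <= cover_weight f phi s e C)%E) ->
  (c%:E <= pressure_eps f phi Y e)%E.
Proof.
move=> H; apply: le_ereal_inf_tmp => _ [s /= Ms <-]; rewrite lee_fin leNgt.
apply/negP => /H[K K0 HK]; have : (K%:E <= 0)%E.
  rewrite -Ms; apply: le_trans (pressure_MN_le_M _ _ _ 0%N).
  by apply: le_ereal_inf_tmp => _ [C HC <-]; exact: HK.
by rewrite lee_fin leNgt K0.
Qed.

(** Below the critical exponent some [pressure_MN] is positive; that is [theta], and it applies to
    covers by balls of one length [n]. The loss [eta] per step pays for the supremum over a ball
    being replaced by the value at its centre. *)
Lemma pressure_eps_spanning (e eta a : R) : 0 < e ->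
  (forall x y, mdist x y <= e -> `|phi x - phi y| <= eta) -> 0 <= eta ->
  (a%:E < pressure_eps f phi setT e)%E ->
  exists2 theta : R, 0 < theta & exists N : nat, forall n (l : seq X), (N <= n)%N ->
    (forall x, exists2 y, y \in l & bowen_ball f n y e x) ->
    theta * expR ((a - eta) * n%:R) <= \sum_(y <- l) expR (birkhoff_sum f phi n y).
Proof.
move=> e0 osc eta0 aP.
have M0 : (0 < pressure_M f phi setT a e)%E.
  rewrite lt_neqAle pressure_M_ge0 andbT eq_sym; apply/eqP => Ma.
  move: aP; rewrite ltNge => /negP; apply; apply: ereal_inf_lbound.
  by exists a.
have [N MN] : exists N, (0 < pressure_MN f phi setT a e N)%E.
  apply: contrapT => /forallNP H; move: M0; rewrite ltNge => /negP; apply.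
  by apply: pressure_M_le => N; rewrite leNgt; exact/negP/H.
have [theta theta0 thetaM] : exists2 theta : R, 0 < theta &
    (theta%:E <= pressure_MN f phi setT a e N)%E.
  move: MN; move: (pressure_MN f phi setT a e N : \bar R) => -[r| |]//.
    by rewrite lte_fin => r0; exists r.
  by exists 1; rewrite // leey.
exists theta => //; exists N => n l Nn lX.
(* A cover is a set, so repetitions in [l] are removed first and put back in the final comparison of
   sums. *)
pose lu := [seq (y, n) | y <- undup l].
have ulu : uniq lu by rewrite map_inj_uniq ?undup_uniq// => x y [].
have cov : bowen_cover f setT e N [set` lu].
  split; first exact: finite_set_countable.
    by move=> q /= /mapP[y _ ->].
  move=> x _; have [y yl xy] := lX x; exists (y, n) => //=.
  by apply/mapP; exists y; rewrite ?mem_undup.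
have : (theta%:E <= cover_weight f phi a e [set` lu])%E.
  by apply: (le_trans thetaM); apply: ereal_inf_lbound; exists [set` lu].
rewrite cover_weight_seq// big_map => thetal.
have {}thetal : (theta%:E <= (\sum_(y <- undup l)
    expR (- (a * n%:R) + (birkhoff_sum f phi n y + n%:R * eta)))%:E)%E.
  apply: (le_trans thetal); rewrite -sumEFin; apply: lee_sum => y _.
  apply: ball_weight_le => /= w Bw.
  rewrite -lerBlDl /birkhoff_sum -sumrB.
  rewrite (le_trans (ler_norm _))// (le_trans (ler_norm_sum _ _ _))//.
  rewrite mulr_natl -[n in leRHS]subn0 -sumr_const_nat big_nat [leRHS]big_nat.
  by apply: ler_sum => k /andP[_ kn]; apply: osc; rewrite metric_sym; exact/ltW/Bw.
move: thetal; rewrite lee_fin => thetal.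
have -> : (a - eta) * n%:R = - (- (a * n%:R) + n%:R * eta) by ring.
rewrite expRN ler_pdivrMr ?expR_gt0// mulr_suml.
apply: (le_trans thetal).
under eq_bigr do rewrite addrCA expRD.
elim: l {thetal lX lu ulu cov} => [|y l IH] /=; first by rewrite !big_nil.
rewrite [leRHS]big_cons; case: ifP => _.
  by rewrite (le_trans IH)// lerDr mulr_ge0// expR_ge0.
by rewrite big_cons lerD2l.
Qed.

End PressureLemmas.

(** * Mass distribution principle on words of free choices *)

Section PressureBound.
Context {R : realType} {X : pointedMetricType R} (f : X -> X) (phi : X -> R).
Context (L G : nat) (e d : R) (A : finType) (a0 : A) (supp : nat -> pred A).
Context (pt : nat -> A -> X) (z : (nat -> A) -> X) (s : (nat -> A) -> nat -> nat).
Context (L0 : (0 < L)%N) (G0 : (0 < G)%N) (d0 : 0 <= d).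
Context (tr : forall w, traces f L G e d (s w) (z w) (fun k => pt k (w k))).
Context (sep : forall k a b, supp k a -> supp k b ->
  (mismatch f L (4 * e) (pt k a) (fun j => iter j f (pt k b)))%:R <= 2 * d * L%:R ->
  a = b).
Context (C eta : R) (phiC : forall y, `|phi y| <= C).
Context (phie : forall x y, mdist x y <= e -> `|phi x - phi y| <= eta).
Context (eta0 : 0 <= eta).
Context (u : nat -> R).
Context (mass : forall k,
  expR (u k) <= \sum_(a | supp k a) expR (birkhoff_sum f phi L (pt k a))).

Let S k a := birkhoff_sum f phi L (pt k a).

Let Z k := \sum_(a | supp k a) expR (S k a).

(** Gibbs weights on the letters allowed in slot [k]. Since other letters get probability 0, free
    and fixed slots can share one alphabet. *)
Let p k a := if supp k a then expR (S k a) / Z k else 0.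

Let Z_gt0 k : 0 < Z k.
Proof. exact: lt_le_trans (expR_gt0 _) (mass k). Qed.

Let p_ge0 k a : 0 <= p k a.
Proof. by rewrite /p; case: ifP => // _; rewrite divr_ge0 ?expR_ge0// ltW. Qed.

Let p_sum1 k : \sum_a p k a = 1.
Proof. by rewrite /p -big_mkcond/= -mulr_suml -/(Z k) divff ?gt_eqF. Qed.

Let p_le k a : p k a <= expR (S k a - u k).
Proof.
rewrite /p; case: ifP => _; last exact: expR_ge0.
by rewrite expRD expRN ler_wpM2l ?expR_ge0// lef_pV2 ?posrE ?expR_gt0.
Qed.

Section Words.
Context (W : nat).

Let word := {ffun 'I_W -> A}.

(** Tracing points are indexed by infinite words while the probability lives on finite ones; [a0]
    fills the tail. *)
Let ext (w : word) : nat -> A := fun k => oapp w a0 (insub k).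

Let extE (w : word) (j : 'I_W) : ext w j = w j.
Proof. by rewrite /ext valK. Qed.

Let prob (w : word) := \prod_(j < W) p j (w j).

Let prob_ge0 w : 0 <= prob w.
Proof. exact: prodr_ge0. Qed.

Lemma word_prob_total : \sum_(w : word) prob w = 1.
Proof.
rewrite -(bigA_distr_bigA (fun j : 'I_W => p j)) big1// => j _; exact: p_sum1.
Qed.

(** Equal gaps give equal block times, and the first [n %/ (L + G)] blocks end before time [n]. Two
    tracing points of one ball are then 2e-close along block [j], each errs from its letter at scale
    [e] at most [d * L] times, and the sum of scales e + 2e + e and of counts is what [sep] forbids
    for distinct letters. *)
Lemma gaps_determine_letters (n : nat) (x : X) (e' : R) (w w' : word) :
  e' <= e -> bowen_ball f n x e' (z (ext w)) -> bowen_ball f n x e' (z (ext w')) ->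
  (forall j : 'I_W, supp j (w j)) -> (forall j : 'I_W, supp j (w' j)) ->
  (forall j, (j < n %/ (L + G))%N ->
     s (ext w) j.+1 - s (ext w) j = s (ext w') j.+1 - s (ext w') j)%N ->
  forall j : 'I_W, (j < n %/ (L + G))%N -> w j = w' j.
Proof.
move=> e'e Bw Bw' sw sw' gaps j jn.
have [t0 gap mis] := tr (ext w); have [t0' gap' mis'] := tr (ext w').
have times i : (i <= n %/ (L + G))%N -> s (ext w) i = s (ext w') i.
  elim: i => [_|i IH iN]; first by rewrite t0 t0'.
  have := IH (ltnW iN); have := gaps i iN; have := gap i; have := gap' i.
  by clear; lia.
have tj := times j (ltnW jn).
have tjn : (s (ext w) j + L <= n)%N.
  have /andP[+ _] := gap j; move=> /leq_trans; apply.
  have := @traces_le_mul _ _ _ _ _ _ _ _ _ _ (tr (ext w)) 0 j.+1 (leq0n _).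
  rewrite t0 add0n subn0 => /leq_trans; apply.
  by rewrite (leq_trans _ (leq_trunc_div n (L + G)))// leq_mul2r jn orbT.
apply: (@sep j) => //.
have := mis j; rewrite extE mismatch_sym => m1.
have := mis' j; rewrite extE -tj => m2.
set y := iter _ f (z (ext w)) in m1; set y' := iter _ f (z (ext w')) in m2.
have m0 : mismatch f L (2 * e) y (fun i => iter i f y') = 0%N.
  apply: mismatch_eq0 => i iL; rewrite /y /y' -!iterD.
  have iN : (i + s (ext w) j < n)%N by move: iL tjn; clear; lia.
  have := Bw _ iN; have := Bw' _ iN.
  have := metric_triangle (iter (i + s (ext w) j) f (z (ext w)))
    (iter (i + s (ext w) j) f x) (iter (i + s (ext w) j) f (z (ext w'))).
  have := metric_sym (iter (i + s (ext w) j) f (z (ext w)))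
    (iter (i + s (ext w) j) f x); lra.
have -> : 4 * e = e + (2 * e + e) by ring.
have := mismatch_triangle f L e (2 * e + e) (pt j (w j)) y
  (fun i => iter i f (pt j (w' j))).
have := mismatch_triangle f L (2 * e) e y y' (fun i => iter i f (pt j (w' j))).
rewrite m0 add0n => t1 t2.
have := leq_trans t2 (leq_add (leqnn _) t1).
rewrite -(ler_nat R) natrD => /le_trans; apply.
have -> : 2 * d * L%:R = d * L%:R + d * L%:R by ring.
exact: lerD.
Qed.

(* The ball determines the first n / (L + G) letters of a word up to the choice of
   the gap pattern, for which there are at most G ^ (n / (L + G)) possibilities. *)
Lemma bowen_ball_mass (n : nat) (x : X) (e' M : R) : e' <= e ->
  (n %/ (L + G) <= W)%N ->
  (forall w, bowen_ball f n x e' (z (ext w)) ->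
    expR (\sum_(0 <= j < n %/ (L + G)) (S j (ext w j) - u j)) <= M) -> 0 <= M ->
  \sum_(w : word | `[< bowen_ball f n x e' (z (ext w)) >]) prob w <=
  (G ^ (n %/ (L + G)))%:R * M.
Proof.
move=> e'e; set k := (n %/ (L + G))%N => kW BM M0.
(* Words with a letter outside its [supp] have probability 0 and drop out, so that [sep] applies to
   all remaining words. *)
pose good (w : word) := `[< bowen_ball f n x e' (z (ext w)) >] &&
  [forall j : 'I_W, supp j (w j)].
have -> : \sum_(w : word | `[< bowen_ball f n x e' (z (ext w)) >]) prob w =
    \sum_(w | good w) prob w.
  rewrite [LHS](bigID (fun w : word => [forall j : 'I_W, supp j (w j)]))/=.
  rewrite [X in _ + X]big1 ?addr0// => w /andP[_]; rewrite negb_forall.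
  by move=> /existsP[j /negbTE nj]; rewrite /prob (bigD1 j)//= /p nj mul0r.
pose pat (w : word) : {ffun 'I_k -> 'I_G} :=
  [ffun j : 'I_k => insubd (Ordinal G0) (s (ext w) j.+1 - s (ext w) j - L)%N].
rewrite (partition_big pat xpredT)//=.
have -> : (G ^ k)%:R * M = \sum_(q : {ffun 'I_k -> 'I_G}) M.
  by rewrite sumr_const card_ffun !card_ord mulr_natl.
apply: ler_sum => q _.
case: (pickP (fun w => good w && (pat w == q))) => [w0 /andP[gw0 /eqP pw0]|none]; last first.
  by rewrite big_pred0.
have [/asboolP Bw0 /forallP sw0] := andP gw0.
(* Words of one gap pattern lie in the cylinder of those agreeing with [w0] on the first [k]
   letters. Its probability is a product over these letters, the other factors being 1. *)
pose F (j : 'I_W) : pred A := if (j < k)%N then pred1 (w0 j) else predT.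
apply: (@le_trans _ _ (\sum_(w in family F) prob w)).
  rewrite [leRHS](bigID (fun w => good w && (pat w == q)))/= -[leLHS]addr0.
  apply: lerD; last by apply: sumr_ge0 => w _; exact: prob_ge0.
  rewrite le_eqVlt; apply/orP; left; apply/eqP; apply: eq_bigl => w.
  have [/andP[gw /eqP pw]|] := boolP (good w && (pat w == q)); last by rewrite andbF.
  rewrite andbT; apply/esym/familyP => j; rewrite /F; case: ifP => // jk.
  have [/asboolP Bw /forallP sw] := andP gw.
  rewrite !inE; apply/eqP; apply: (@gaps_determine_letters n x e' w w0) => //.
  move=> i ik; have := congr1 (fun q : {ffun _ -> _} => val (q (Ordinal ik))) (etrans pw (esym pw0)).
  rewrite !ffunE !val_insubd /=.
  have [_ gap _] := tr (ext w); have [_ gap' _] := tr (ext w0).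
  have := gap i; have := gap' i.
  by clear; case: ifP; case: ifP; lia.
rewrite -(bigA_distr_big_dep (fun j : 'I_W => F j) (fun j a => p j a)).
apply: (@le_trans _ _ (\prod_(j < W | (j < k)%N) expR (S j (w0 j) - u j))).
  rewrite [leRHS]big_mkcond/=; apply: ler_prod => j _.
  apply/andP; split; first by apply: sumr_ge0 => a _; exact: p_ge0.
  rewrite /F; case: ifP => jk; last first.
    by rewrite -[leRHS](p_sum1 j) le_eqVlt; apply/orP; left; apply/eqP; apply: eq_bigl.
  by rewrite big_pred1_eq; exact: p_le.
rewrite -expR_sum; apply: le_trans (BM w0 Bw0).
rewrite ler_expR big_mkord (big_ord_widen_cond W xpredT (fun j => S j (ext w0 j) - u j)) //=.
by under eq_bigr do rewrite -extE.
Qed.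

End Words.

Context (b B c0 : R) (bB : `|b| <= B).
Context (u_avg : forall k, k%:R * (L%:R * b) - c0 <= \sum_(0 <= j < k) u j).

(** Per unit of time: the tracing error, the gaps, and the [G] possible gaps per block. A gap counts
    with [C] for the values of the potential there and with [B] for the reference rate [b], which
    runs on during the gap. *)
Definition pressure_loss : R :=
  (tracing_error L G d C eta + (C + B) * G%:R + ln G%:R) / L%:R.

Let C0 : 0 <= C.
Proof. by rewrite (le_trans _ (phiC point)). Qed.

Let B0 : 0 <= B.
Proof. by rewrite (le_trans _ bB). Qed.

Let Lp : 0 < L%:R :> R.
Proof. by rewrite ltr0n. Qed.

Let lnG0 : 0 <= ln G%:R :> R.
Proof. by rewrite ln_ge0// ler1n. Qed.

Let E0 : 0 <= tracing_error L G d C eta.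
Proof. by rewrite /tracing_error addr_ge0// mulr_ge0// ?addr_ge0// ?mulr_ge0. Qed.

Let loss_ge0 : 0 <= pressure_loss.
Proof.
apply: divr_ge0 => //; apply: addr_ge0 => //; apply: addr_ge0 => //.
by apply: mulr_ge0 => //; exact: addr_ge0.
Qed.

Let K0 : R := (C + B) * (L + G)%:R + c0.

(** This is the local mass estimate: the bound on a cylinder, multiplied by the number of gap
    patterns, stays below the weight of the ball up to the constant [expR K0]. That constant absorbs
    the last incomplete block and [c0]. *)
Lemma letters_le_birkhoff_sum n (w : nat -> A) (sg : R) : sg <= b - pressure_loss ->
  expR (\sum_(0 <= j < n %/ (L + G)) (S j (w j) - u j)) <=
  expR K0 * expR (- (sg * n%:R) + birkhoff_sum f phi n (z w)) /
    (G ^ (n %/ (L + G)))%:R.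
Proof.
move=> sgb; set k := (n %/ (L + G))%N.
have Gk : ((G ^ k)%:R : R) = expR (k%:R * ln G%:R).
  by rewrite natrX mulrC expRM_natr lnK// posrE ltr0n.
rewrite Gk -expRN -!expRD ler_expR.
have kn : (k * (L + G) <= n)%N by exact: leq_trunc_div.
have nk : (n < k * (L + G) + (L + G))%N.
  by rewrite {1}(divn_eq n (L + G)) ltn_add2l ltn_pmod// addn_gt0 L0.
have sk : (s w k <= n)%N.
  have := @traces_le_mul _ _ _ _ _ _ _ _ _ _ (tr w) 0 k (leq0n _).
  by have [-> _ _] := tr w; rewrite add0n subn0 => /leq_trans; apply.
have ks : (k * L <= s w k)%N.
  have := @traces_mono _ _ _ _ _ _ _ _ _ _ (tr w) 0 k (leq0n _).
  by have [-> _ _] := tr w; rewrite add0n subn0.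
have := @birkhoff_sum_blocks _ _ _ _ _ _ _ _ _ _ (tr w) phi C eta phiC phie eta0 0 k
  (leq0n _).
have [-> _ _] := tr w; rewrite !subn0 /=; set E := tracing_error _ _ _ _ _ => blocks.
have split : birkhoff_sum f phi n (z w) = birkhoff_sum f phi (s w k) (z w) +
    birkhoff_sum f phi (n - s w k) (iter (s w k) f (z w)).
  by rewrite -birkhoff_sumD subnKC.
have := @birkhoff_sum_ge_norm _ _ f phi C phiC (n - s w k) (iter (s w k) f (z w)).
rewrite sumrB; have uk := u_avg k.
have rest : (n - s w k)%:R * C <= (k%:R * G%:R + (L + G)%:R) * C.
  rewrite ler_wpM2r// -natrM -natrD ler_nat.
  by move: ks nk sk; clear; lia.
have bk : - (k%:R * (L%:R * b)) <= - (n%:R * b) + B * (k%:R * G%:R + (L + G)%:R).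
  have : (n%:R - k%:R * L%:R) * b <= (k%:R * G%:R + (L + G)%:R) * B.
    rewrite -natrM -natrB; last by move: kn; clear; lia.
    apply: (@le_trans _ _ ((n - k * L)%:R * B)).
      by rewrite ler_wpM2l// (le_trans (ler_norm _)).
    rewrite ler_wpM2r// -natrM -natrD ler_nat.
    by move: nk; clear; lia.
  lra.
have kL : k%:R * L%:R <= n%:R :> R.
  by rewrite -natrM ler_nat; move: kn; clear; lia.
have kloss : k%:R * (E + (C + B) * G%:R + ln G%:R) <= n%:R * pressure_loss.
  have -> : E + (C + B) * G%:R + ln G%:R = L%:R * pressure_loss.
    by rewrite [RHS]mulrC /pressure_loss divfK ?gt_eqF.
  by rewrite mulrA ler_wpM2r.
have sgn : n%:R * pressure_loss <= n%:R * (b - sg) by rewrite ler_wpM2l//; lra.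
move: blocks rest bk kloss sgn uk; rewrite split /K0 /S; lra.
Qed.

Lemma ball_weights_ge (e' sg : R) (l : seq (X * nat)) (V : X * nat -> R) :
  e' <= e -> sg <= b - pressure_loss ->
  (forall w, exists2 q, q \in l & bowen_ball f q.2 q.1 e' (z w)) ->
  (forall q y, q \in l -> bowen_ball f q.2 q.1 e' y ->
     expR (- (sg * q.2%:R) + birkhoff_sum f phi q.2 y) <= V q) ->
  (forall q, 0 <= V q) ->
  expR (- K0) <= \sum_(q <- l) V q.
Proof.
(* The sum of all lengths in the finite cover, hence enough letters for every ball at once. *)
move=> e'e sgb cov HV V0; pose W := (\sum_(q <- l) q.2)%N.
pose ext (w : {ffun 'I_W -> A}) : nat -> A := fun k => oapp w a0 (insub k).
pose prob (w : {ffun 'I_W -> A}) := \prod_(j < W) p j (w j).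
have prob0 w : 0 <= prob w by exact: prodr_ge0.
rewrite -[leLHS]mulr1 -(word_prob_total W) mulr_sumr.
apply: (@le_trans _ _ (\sum_(w : {ffun 'I_W -> A}) \sum_(q <- l)
    (if `[< bowen_ball f q.2 q.1 e' (z (ext w)) >] then expR (- K0) * prob w else 0))).
  apply: ler_sum => w _; have [q ql /asboolP qw] := cov (ext w).
  rewrite (big_rem q)//= qw lerDl sumr_ge0// => q' _.
  by case: ifP => // _; rewrite mulr_ge0// expR_ge0.
rewrite exchange_big/= big_seq [leRHS]big_seq; apply: ler_sum => q ql.
rewrite -big_mkcond/= -mulr_sumr expRN ler_pdivrMl ?expR_gt0//.
have Gk : 0 < (G ^ (q.2 %/ (L + G)))%:R :> R by rewrite ltr0n expn_gt0 G0.
rewrite (le_trans (@bowen_ball_mass W q.2 q.1 e' (expR K0 * V q / (G ^ (q.2 %/ (L + G)))%:R)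
  e'e _ _ _))//.
- rewrite (leq_trans (leq_div _ _))//.
  by rewrite /W (big_rem q)//= leq_addr.
- move=> w Bw; apply: (le_trans (letters_le_birkhoff_sum _ _ sgb)).
  apply: ler_wpM2r; first by rewrite invr_ge0 ltW.
  by apply: ler_wpM2l; [exact: expR_ge0|exact: HV].
- by rewrite mulr_ge0 ?invr_ge0 ?(ltW Gk)// mulr_ge0// expR_ge0.
- by rewrite mulrC divfK ?gt_eqF.
Qed.

(** Compactness makes the cover finite, so finite words suffice. The bound holds at every scale
    [e' <= e]: it rests on separation at scale [e] and not on monotonicity in the scale. *)
Lemma pressure_eps_lower_bound (Lam : set X) (e' : R) :
  compact Lam -> continuous f -> (forall w, Lam (z w)) -> e' <= e ->
  ((b - pressure_loss)%:E <= pressure_eps f phi Lam e')%E.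
Proof.
move=> cLam cf Lamz e'e; apply: pressure_eps_ge => sg sgb.
exists (expR (- K0)); first exact: expR_gt0.
move=> D [_ _ cov].
have [||l [ul lD Hl]] := @compact_seq_cover _ Lam _ D
  (fun q => bowen_ball f q.2 q.1 e') cLam.
- by move=> q _; exact: open_bowen_ball.
- exact: cov.
have := @cover_weight_ge_seq _ _ f phi sg e' D l ul lD; apply: le_trans.
have fin q : ball_weight f phi sg e' q \is a fin_num.
  rewrite fin_real// (lt_le_trans _ (ball_weight_ge0 _ _ _ _ _)) ?ltNyr//=.
  apply: (@le_lt_trans _ _ (expR (- (sg * q.2%:R) + q.2%:R * C))%:E); last exact: ltry.
  by apply: ball_weight_le => y _; exact: birkhoff_sum_le_norm.
rewrite -(eq_bigr _ (fun q _ => fineK (fin q))) sumEFin lee_fin.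
apply: (@ball_weights_ge e' sg l (fun q => fine (ball_weight f phi sg e' q))) => //.
- exact: ltW.
- by move=> w; have [q ql Bq] := Hl _ (Lamz w); exists q.
- by move=> q y _ By; rewrite -lee_fin fineK//; exact: ball_weight_ge.
- by move=> q; rewrite fine_ge0// ball_weight_ge0.
Qed.

End PressureBound.

(** * Hamming-separated sets carrying almost the whole pressure *)

Section SeparatedSets.
Context {R : realType} {X : pointedMetricType R} (f : X -> X) (phi : X -> R).
Context (cX : compact [set: X]) (cf : continuous f).

Lemma heavy_class (I : eqType) (J : nat) (l : seq I) (w : I -> R) (cls : I -> 'I_J) :
  (0 < J)%N ->
  exists j, \sum_(i <- l) w i <= J%:R * \sum_(i <- l | cls i == j) w i.
Proof.
move=> J0; apply: contrapT => /forallNP H.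
have : \sum_(j < J) (J%:R * \sum_(i <- l | cls i == j) w i) <
    \sum_(j < J) \sum_(i <- l) w i.
  apply: ltr_sum; first by apply/hasP; exists (Ordinal J0); rewrite ?mem_index_enum.
  by move=> j _; rewrite ltNge; exact/negP/H.
rewrite -mulr_sumr sumr_const card_ord -[X in _ < X]mulr_natl.
have <- : \sum_(i <- l) w i = \sum_j \sum_(i <- l | cls i == j) w i.
  by rewrite (partition_big cls xpredT).
by rewrite ltxx.
Qed.

(** A maximal separated part of a Bowen net is taken. Tubes of scale 5e = e + 4e around it contain
    all segments, and each is covered by few balls of radius 15e, hence at most [e0]. The five [eta]
    are: one for [pressure_eps_spanning], one for the number of balls per tube, two for Birkhoff
    sums inside a tube, and one for [theta] and for keeping only the heaviest class of averages of
    [g]. *)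
Lemma separated_heavy_set (g : X -> R) (C e0 e eta a zeta : R) :
  (forall y, `|phi y| <= C) ->
  (forall x y, mdist x y <= e0 -> `|phi x - phi y| <= eta) ->
  (forall y, 0 <= g y <= 1) -> 0 < e -> 15 * e <= e0 -> 0 < eta -> 0 < zeta ->
  (a%:E < pressure_eps f phi setT e0)%E ->
  exists2 d0 : R, 0 < d0 & forall d, 0 < d -> d <= d0 ->
  exists N : nat, forall L, (N <= L)%N -> exists (E : seq X) (alpha : R),
    [/\ uniq E, 0 <= alpha <= 1, forall x y, x \in E -> y \in E ->
        (mismatch f L (4 * e) x (fun j => iter j f y))%:R <= 2 * d * L%:R -> x = y,
      forall x, x \in E ->
        L%:R * alpha <= birkhoff_sum f g L x <= L%:R * (alpha + zeta) &
      expR ((a - 5 * eta) * L%:R) <= \sum_(x <- E) expR (birkhoff_sum f phi L x)].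
Proof.
move=> phiC osc g01 e_gt0 ee0 eta0 zeta0 aP.
have e00 : 0 < e0 by lra.
have C0 : 0 <= C by rewrite (le_trans _ (phiC point)).
have [delta0 delta0_gt0 tube] := @tube_cover _ _ f (5 * e) eta cX
  (mulr_gt0 (ltr0Sn _ _) e_gt0) eta0.
have [theta theta0 [N0 HN0]] := pressure_eps_spanning e00 osc (ltW eta0) aP.
pose J := (Num.truncn zeta^-1).+1.
have J0 : (0 < J)%N by [].
have JR : 0 < J%:R :> R by rewrite ltr0n.
pose N1 := (Num.truncn (ln (J%:R / theta) / eta)).+1.
(* Closeness allows [2 * d * L] errors, whence the half; the second bound makes their effect
   [4 * C * d] on Birkhoff sums at most [eta]. *)
exists (Num.min (delta0 / 2) (eta / (4 * C + 1))).
  by rewrite lt_min !divr_gt0//; lra.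
move=> d d_gt0; rewrite le_min => /andP[dd0 dC].
have {}dd0 : 2 * d <= delta0 by lra.
have {}dC : 4 * C * d <= eta.
  have : d * (4 * C + 1) <= eta by rewrite -ler_pdivlMr//; lra.
  lra.
exists (maxn N0 (maxn N1 1)) => L; rewrite !geq_max => /andP[N0L /andP[N1L L0]].
have Lp : 0 < L%:R :> R by rewrite ltr0n.
have [D HD] := @bowen_net _ _ f L e cX cf e_gt0.
pose close x y := (mismatch f L (4 * e) x (fun j => iter j f y))%:R <= 2 * d * L%:R.
have close_sym : symmetric close by move=> x y; rewrite /close mismatch_sym.
have [E [uE ED sepE covE]] := greedy_separated D close_sym.
have near y : exists2 x, x \in E &
    (mismatch f L (5 * e) y (fun j => iter j f x))%:R <= 2 * d * L%:R.
  have [y' y'D yy'] := HD y; have [x xE xy'] := covE _ y'D.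
  exists x => //.
  have m0 : mismatch f L e y (fun j => iter j f y') = 0%N.
    by apply: mismatch_eq0 => j jL; rewrite metric_sym; exact/ltW/yy'.
  have -> : 5 * e = e + 4 * e by ring.
  have := mismatch_triangle f L e (4 * e) y y' (fun j => iter j f x).
  rewrite m0 add0n -(ler_nat R) => /le_trans; apply.
  case: xy' => [<-|//]; rewrite mismatch_eq0 ?mulr_ge0//; first lra.
  by move=> j _; rewrite mdistxx; lra.
have /choice[T HT] : forall x, exists D' : seq X,
    [/\ (size D')%:R <= expR (eta * L%:R),
    forall y, y \in D' ->
      (mismatch f L (5 * e) y (fun j => iter j f x))%:R <= 2 * d * L%:R &
    forall y, (mismatch f L (5 * e) y (fun j => iter j f x))%:R <= 2 * d * L%:R ->
      exists2 y', y' \in D' & forall j, (j < L)%N ->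
        mdist (iter j f y') (iter j f y) < 3 * (5 * e)].
  by move=> x; exact: tube.
have total : theta * expR ((a - eta) * L%:R) <=
    \sum_(x <- E) \sum_(y <- T x) expR (birkhoff_sum f phi L y).
  have := HN0 L (flatten [seq T x | x <- E]) N0L.
  rewrite big_flatten big_map; apply=> y.
  have [x xE xy] := near y; have [_ _ Tx] := HT x.
  have [y' y'T Hy'] := Tx y xy; exists y'; last by move=> k /Hy'; lra.
  by apply/flattenP; exists (T x) => //; apply/mapP; exists x.
have each x : \sum_(y <- T x) expR (birkhoff_sum f phi L y) <=
    expR (3 * eta * L%:R) * expR (birkhoff_sum f phi L x).
  have [sT mT _] := HT x.
  apply: (@le_trans _ _ (\sum_(y <- T x)
      (expR (2 * eta * L%:R) * expR (birkhoff_sum f phi L x)))).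
    rewrite big_seq [leRHS]big_seq; apply: ler_sum => y yT.
    rewrite -expRD ler_expR.
    have := @birkhoff_sum_mismatch _ _ f phi C eta (5 * e) L y x phiC _ (ltW eta0).
    have osc5 : forall x y, mdist x y <= 5 * e -> `|phi x - phi y| <= eta.
      by move=> x' y' d5; apply: osc; lra.
    move=> /(_ osc5); rewrite ler_norml => /andP[_].
    have : 2 * C * (mismatch f L (5 * e) y (fun j => iter j f x))%:R <=
        2 * C * (2 * d * L%:R).
      by apply: ler_wpM2l; [exact: mulr_ge0|exact: mT].
    have : 4 * C * d * L%:R <= eta * L%:R by rewrite ler_wpM2r.
    lra.
  rewrite sumr_const_seq mulrA.
  apply: ler_wpM2r; first exact: expR_ge0.
  have -> : 3 * eta * L%:R = eta * L%:R + 2 * eta * L%:R by ring.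
  by rewrite expRD ler_wpM2r// expR_ge0.
have {each}totalE : theta * expR ((a - 4 * eta) * L%:R) <=
    \sum_(x <- E) expR (birkhoff_sum f phi L x).
  have {each} := le_trans total (ler_sum _ (fun x _ => each x)).
  rewrite -mulr_sumr -ler_pdivrMl ?expR_gt0// => /(le_trans _); apply.
  rewrite -expRN mulrCA -expRD ler_wpM2l ?(ltW theta0)// ler_expR.
  by rewrite le_eqVlt; apply/orP; left; apply/eqP; ring.
pose cls x : 'I_J := inord (Num.truncn (birkhoff_sum f g L x / (L%:R * zeta))).
have [j Hj] := heavy_class E (fun x => expR (birkhoff_sum f phi L x)) cls J0.
have Lz : 0 < L%:R * zeta by rewrite mulr_gt0.
have birk0 x : 0 <= birkhoff_sum f g L x.
  rewrite -(mulr0 L%:R); apply: birkhoff_sum_ge => y.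
  by have /andP[] := g01 y.
have birk1 x : birkhoff_sum f g L x <= L%:R.
  rewrite -[leRHS]mulr1; apply: birkhoff_sum_le => y.
  by have /andP[] := g01 y.
have clsE x : cls x = Num.truncn (birkhoff_sum f g L x / (L%:R * zeta)) :> nat.
  rewrite inordK// truncn_lt_nat; last exact/divr_ge0/ltW/Lz/birk0.
  apply: le_lt_trans (truncnS_gt _); rewrite ler_pdivrMr// mulrCA mulVf ?gt_eqF//.
  by rewrite mulr1 birk1.
exists [seq x <- E | cls x == j], (j%:R * zeta).
have mem x : x \in [seq x <- E | cls x == j] ->
    L%:R * (j%:R * zeta) <= birkhoff_sum f g L x <= L%:R * (j%:R * zeta + zeta).
  rewrite mem_filter => /andP[/eqP <- _].
  have q0 : 0 <= birkhoff_sum f g L x / (L%:R * zeta).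
    exact/divr_ge0/ltW/Lz/birk0.
  have /andP[q1 q2] := truncn_itv q0.
  rewrite clsE mulrCA -ler_pdivlMr// q1/= -[X in _ * (_ + X)]mul1r -mulrDl mulrCA natr1.
  by rewrite -ler_pdivrMr// ltW.
have sumE : expR ((a - 5 * eta) * L%:R) <=
    \sum_(x <- [seq x <- E | cls x == j]) expR (birkhoff_sum f phi L x).
  rewrite big_filter.
  have N1eta : ln (J%:R / theta) <= eta * L%:R.
    rewrite [leRHS]mulrC -ler_pdivrMr// (le_trans (ltW (truncnS_gt _)))// ler_nat.
    exact: N1L.
  rewrite -(ler_pM2l JR); apply: le_trans Hj; apply: le_trans totalE.
  rewrite -ler_pdivrMl// mulrA (mulrC theta^-1) -ler_pdivlMr ?expR_gt0//.
  rewrite -expRN -expRD -(@lnK _ (J%:R / theta)) ?posrE ?divr_gt0// ler_expR.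
  by rewrite (le_trans N1eta)// le_eqVlt; apply/orP; left; apply/eqP; ring.
have [x xE'] : exists x, x \in [seq x <- E | cls x == j].
  case: [seq x <- E | cls x == j] sumE => [|x l' _]; last first.
    by exists x; rewrite mem_head.
  by rewrite big_nil leNgt expR_gt0.
split => //.
- by rewrite filter_uniq.
- rewrite mulr_ge0 ?(ltW zeta0)//= -(ler_pM2l Lp) mulr1.
  by have /andP[+ _] := mem _ xE' => /le_trans; apply; exact: birk1.
- move=> y y'; rewrite !mem_filter => /andP[_ yE] /andP[_ y'E].
  exact: sepE.
Qed.

End SeparatedSets.

(** * Non-uniform Birkhoff averages *)

Section NonUniformAverages.
Context {R : realType} {X : pointedMetricType R} (f : X -> X).

Lemma app_traces (e d gam : R) : approximate_product_property f ->
  0 < e -> 0 < d -> 0 < gam ->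
  exists N : nat, forall L, (N <= L)%N -> exists G,
    [/\ (0 < L)%N, (0 < G)%N, G%:R <= gam * L%:R &
      forall x : nat -> X, exists s z, traces f L G e d s z x].
Proof.
move=> app e0 d0 gam0.
have gam2 : 0 < gam / 2 by rewrite divr_gt0.
have [N N0 HN] := app _ _ _ e0 gam2 d0.
exists (maxn N (Num.truncn (2 / gam)).+1) => L; rewrite geq_max => /andP[NL gL].
(* The property with [delta1 = gam / 2] bounds gaps by [gam / 2 * L]; the successor makes the bound
   strict, and [L >= 2 / gam] keeps [G] below [gam * L]. *)
exists (Num.truncn (gam / 2 * L%:R)).+1; split => //.
- exact: leq_trans NL.
- rewrite -natr1 (le_trans (lerD (_ : _ <= gam / 2 * L%:R) (_ : 1 <= gam / 2 * L%:R)))//.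
  + by rewrite truncn_le mulr_ge0// ltW.
  + rewrite -ler_pdivrMl// invf_div mulr1 (le_trans (ltW (truncnS_gt _)))//.
    by rewrite ler_nat.
  + by rewrite -mulrDl -splitr.
- move=> x; have [s [z [inc s0 gap mis]]] := HN L NL x.
  exists s, z; split => //; last first.
    move=> k; apply/ltW/(le_lt_trans _ (mis k)).
    rewrite ler_nat; apply: subset_leq_card; apply/fintype.subsetP => j.
    by rewrite !inE addnC iterD.
  move=> k; have [g1 g2] := gap k.
  have sk : (s k + L <= s k.+1)%N.
    by move: (leq_trans N0 NL) g1; clear; lia.
  rewrite sk/= addnA.
  have : ((s k.+1 - s k - L)%:R : R) < (Num.truncn (gam / 2 * L%:R)).+1%:R.
    apply: le_lt_trans (truncnS_gt _).
    by rewrite natrB// lerBlDr; move: g2; rewrite mulrDr mulr1; lra.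
  by rewrite ltr_nat; move: sk; clear; lia.
Qed.

Lemma tubes_cover (e kappa : R) : compact [set: X] ->
  0 < e -> 0 < kappa ->
  exists2 delta : R, 0 < delta & forall (I : finType) n (c : I -> nat -> X),
    exists2 D : seq X, (size D)%:R <= #|I|%:R * expR (kappa * n%:R) &
      forall i y, (mismatch f n e y (c i))%:R <= delta * n%:R ->
        exists2 t, t \in D & forall j, (j < n)%N ->
          mdist (iter j f t) (iter j f y) < 3 * e.
Proof.
move=> cX e0 k0; have [delta delta0 H] := @tube_cover _ _ f e kappa cX e0 k0.
exists delta => // I n c.
have /choice[D HD] : forall i, exists D : seq X, (size D)%:R <= expR (kappa * n%:R) /\
    forall y, (mismatch f n e y (c i))%:R <= delta * n%:R ->
        exists2 t, t \in D & forall j, (j < n)%N ->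
          mdist (iter j f t) (iter j f y) < 3 * e.
  by move=> i; have [D [D1 _ D3]] := H delta n (c i) (lexx _); exists D.
exists (flatten [seq D i | i <- enum I]).
  rewrite size_flatten /shape -map_comp sumnE big_map natr_sum big_enum/=.
  rewrite mulr_natl -sumr_const; apply: ler_sum => i _; exact: (HD i).1.
move=> i y /(HD i).2[t tD Ht]; exists t => //.
by apply/flattenP; exists (D i) => //; apply/mapP; exists i; rewrite ?mem_enum.
Qed.

(** The condition is conditional on [0 < q] since a window may begin inside a gap: then the shift
    can exceed [n] while the range is empty. *)
Lemma leq_sum_shift (F : nat -> nat) a q n : (0 < q -> a + q <= n)%N ->
  (\sum_(0 <= j < q) F (j + a) <= \sum_(0 <= j < n) F j)%N.
Proof.
case: q => [|q /(_ isT) aqn]; first by rewrite big_geq.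
rewrite (@big_cat_nat _ _ _ a 0%N n)//=; last exact: leq_trans (leq_addr _ _) aqn.
rewrite (@big_cat_nat _ _ _ (a + q.+1)%N a n)//= ?leq_addr//.
by rewrite -[X in (_ <= _ + (\sum_(X <= _ < _) _ + _))%N]add0n big_addn addKn addnCA leq_addr.
Qed.

(* A window of length L meets at most two tracing blocks, so up to few errors
   it is determined by its position relative to the next block start. *)
Lemma window_mismatch L G (e d : R) s z x m : (0 < L)%N -> (G <= L)%N ->
  traces f L G e d s z (fun=> x) ->
  exists (a b : 'I_(2 * L).+1),
    (mismatch f L e (iter m f z)
      (fun j => if (j < b)%N then iter (a + j) f x else iter (j - b) f x))%:R <=
    2 * d * L%:R + G%:R.
Proof.
move=> L0 GL tr; have [k km] := traces_block tr m L0.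
have [s0 gap mis] := tr; have gk := gap k.
have aL : (m - s k < (2 * L).+1)%N by move: km gk GL; clear; lia.
have bL : (s k.+1 - m < (2 * L).+1)%N by move: km gk GL; clear; lia.
exists (Ordinal aL), (Ordinal bL); rewrite /=.
set a := (m - s k)%N in aL *; set b := (s k.+1 - m)%N in bL *.
rewrite mismatch_sum.
have m1 := mis k; have m2 := mis k.+1; move: m1 m2; rewrite !mismatch_sum => m1 m2.
(* The window splits at [q] and [b'] into the rest of block [k], the gap (all counted as errors, at
   most [G]), and the beginning of block [k.+1]. *)
pose b' := minn b L; pose q := minn b' (L - a).
rewrite (@big_cat_nat _ _ _ b')//=; last exact: geq_minr.
rewrite (@big_cat_nat _ _ _ q _ b')//=; last exact: geq_minl.
set S1 := (\sum_(0 <= i < q) _)%N; set S2 := (\sum_(q <= i < b') _)%N.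
set S3 := (\sum_(b' <= i < L) _)%N.
have S1d : (S1 <= \sum_(0 <= j < L)
    (e < mdist (iter j f (iter (s k) f z)) (iter j f x))%R)%N.
  apply: leq_trans (@leq_sum_shift _ a q L _); last first.
    by rewrite /q /b'; move: km gk; rewrite /a /b; clear; lia.
  rewrite /S1 big_nat [in X in (_ <= X)%N]big_nat; apply: leq_sum => j /andP[_ jq].
  have jb : (j < b)%N by move: jq; rewrite /q /b'; clear; lia.
  rewrite jb -!iterD (addnC a).
  by rewrite (_ : j + m = j + a + s k)%N// /a; move: km; clear; lia.
have S2G : (S2 <= G)%N.
  apply: (@leq_trans (\sum_(q <= i < b') 1)); first by apply: leq_sum => j _; case: (_ < _).
  by rewrite sum_nat_const_nat muln1 /q /b' /a /b; move: km gk; clear; lia.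
have S3d : (S3 <= \sum_(0 <= j < L)
    (e < mdist (iter j f (iter (s k.+1) f z)) (iter j f x))%R)%N.
  rewrite /S3 -{1}[b']add0n big_addn.
  apply: (@leq_trans (\sum_(0 <= j < L - b')
    (e < mdist (iter j f (iter (s k.+1) f z)) (iter j f x))%R)%N); last first.
    by rewrite [leqRHS](@big_cat_nat _ _ _ (L - b')%N)//= ?leq_subr// leq_addr.
  rewrite big_nat [in X in (_ <= X)%N]big_nat; apply: leq_sum => j /andP[_ jL].
  have -> : b' = b by move: jL; rewrite /b'; clear; lia.
  rewrite ltnNge leq_addl /= addnK -!iterD.
  by rewrite (_ : j + b + m = j + s k.+1)%N// /b; move: km; clear; lia.
have S : (S1 + S2 + S3)%:R <= (\sum_(0 <= j < L)
    (e < mdist (iter j f (iter (s k) f z)) (iter j f x))%R +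
    \sum_(0 <= j < L)
    (e < mdist (iter j f (iter (s k.+1) f z)) (iter j f x))%R)%:R + G%:R :> R.
  by rewrite -natrD ler_nat; move: S1d S2G S3d; clear; lia.
by apply: (le_trans S); move: m1 m2; rewrite natrD; lra.
Qed.

(** The [r] times before the first block and all times of bad blocks are given up as errors. The
    last block may overrun [B * L]; only its part inside is counted. *)
Lemma phase_mismatch (e : R) B L r y (bad : nat -> bool) (tau : nat -> X) :
  (0 < L)%N -> (r <= B * L)%N ->
  (forall i, (i < B)%N -> ~~ bad i -> forall o, (o < L)%N ->
    mdist (iter (o + (i * L + r)) f y) (iter o f (tau i)) <= e) ->
  (mismatch f (B * L) e y (fun j =>
    iter ((j - r) %% L) f (tau ((j - r) %/ L))) <=
   r + L * \sum_(0 <= i < B) bad i)%N.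
Proof.
move=> L0 rM good; rewrite mismatch_sum (@big_cat_nat _ _ _ r)//=.
apply: leq_add.
  apply: (@leq_trans (\sum_(0 <= j < r) 1)); first by apply: leq_sum => j _; case: (_ < _).
  by rewrite sum_nat_const_nat muln1 subn0.
rewrite -{1}[r]add0n big_addn.
apply: (@leq_trans (\sum_(0 <= j < B * L) bad (j %/ L))).
  apply: (@leq_trans (\sum_(0 <= j < B * L - r) bad (j %/ L))); last first.
    by rewrite [leqRHS](@big_cat_nat _ _ _ (B * L - r)%N)//= ?leq_subr// leq_addr.
  rewrite big_nat [in X in (_ <= X)%N]big_nat; apply: leq_sum => j /andP[_ jM].
  rewrite addnK; case Ebad: (bad _); first by case: (_ < _).
  have jB : (j %/ L < B)%N by rewrite ltn_divLR// (leq_trans jM)// leq_subr.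
  have := good _ jB (negbT Ebad) (j %% L)%N; rewrite ltn_pmod// => /(_ isT).
  by rewrite addnA (addnC (j %% L)%N) -divn_eq leNgt => /negbTE ->.
rewrite big_nat_mul big_distrr/=; apply: leq_sum => i _.
rewrite big_nat (eq_bigr (fun=> bad i : nat)).
  by rewrite -big_nat sum_nat_const_nat mulSn addnK.
move=> j /andP[ij jS]; congr (nat_of_bool (bad _)).
by apply/eqP; rewrite eqn_leq -ltnS ltn_divLR// jS leq_divRL.
Qed.

(** The square bounds the number of pairs of positions in [window_mismatch]. The proof compares with
    the fourth power of [k / 4 * L], and 10 = 4 + 4 + 2 is the sum of the coefficients on the
    left. *)
Lemma quadratic_le_expR (k : R) : 0 < k ->
  exists N : nat, forall L, (N <= L)%N ->
    (2 * L%:R + 1) ^+ 2 + 1 <= expR (k * L%:R).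
Proof.
move=> k0; pose c := (k / 4) ^+ 4; have c0 : 0 < c by rewrite exprn_gt0// divr_gt0.
exists (Num.truncn (10 / c)).+1 => L NL.
have L1 : 1 <= L%:R :> R by rewrite ler1n (leq_trans _ NL).
have cL : 10 <= c * L%:R.
  rewrite mulrC -ler_pdivrMr// (le_trans (ltW (truncnS_gt _)))// ler_nat//.
have -> : k * L%:R = k / 4 * L%:R * 4%:R by field.
rewrite expRM_natr (le_trans (_ : _ <= (k / 4 * L%:R) ^+ 4))//; last first.
  rewrite lerXn2r ?nnegrE ?expR_ge0//.
    by rewrite mulr_ge0// ltW// divr_gt0.
  by rewrite (le_trans _ (expR_ge1Dx _))// lerDr.
rewrite exprMn -/c (_ : L%:R ^+ 4 = L%:R * L%:R ^+ 3); last by ring.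
rewrite mulrA (le_trans (_ : _ <= 10 * L%:R ^+ 3))//; last first.
  by rewrite ler_wpM2r// exprn_ge0.
have L2 : 1 <= L%:R ^+ 2 :> R by rewrite exprn_ege1.
have : L%:R ^+ 2 <= L%:R ^+ 3 :> R by rewrite ler_weXn2l.
have : L%:R <= L%:R ^+ 2 :> R by rewrite expr2 ler_peMr.
by rewrite sqrrD mulr1 exprMn; lra.
Qed.

(** A point of the orbit closure shadows some orbit point within [e] for [L] steps, hence an element
    of [T] within 4e, so the closure misses the complement of these balls and Urysohn applies. Where
    [g] is nonzero, the next [L] steps follow an element of [T]. *)
Lemma bowen_neighborhood_of_orbit (T : seq X) L (e : R) z : 0 < e ->
  compact [set: X] -> continuous f ->
  (forall m, exists2 t, t \in T & forall j, (j < L)%N ->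
    mdist (iter j f t) (iter (j + m) f z) < 3 * e) ->
  exists g : X -> R, [/\ continuous g, forall y, 0 <= g y <= 1,
    forall m, g (iter m f z) = 1 &
    forall y, (forall t, t \in T -> ~ bowen_ball f L t (4 * e) y) -> g y = 0].
Proof.
move=> e0 cX cf orbT.
pose U := \bigcup_(t in [set` T]) bowen_ball f L t (4 * e).
have oU : open U by apply: bigcup_open => t _; exact: open_bowen_ball.
have [|||g [cg g01 gU gz]] := @urysohn_closed _ _ (~` U) (closure (forward_orbit f z)) cX.
- exact: open_closedC.
- exact: closed_closure.
- rewrite -subset0 => y /= [yU].
  have nb : nbhs y (bowen_ball f L y e).
    apply: open_nbhs_nbhs; split; first exact: open_bowen_ball.
    by move=> k _; rewrite mdistxx.
  move=> /(_ _ nb)[_ [[m _ <-] ym]]; apply: yU.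
  have [t tT Ht] := orbT m; exists t => //= k kL.
  have := Ht k kL; have := ym k kL; rewrite iterD.
  have := metric_triangle (iter k f t) (iter k f (iter m f z)) (iter k f y).
  have := metric_sym (iter k f y) (iter k f (iter m f z)).
  rewrite -iterD; lra.
exists g; split => //.
- by move=> m; apply: gz; apply: subset_closure; exists m.
- by move=> y yT; apply: gU => -[t /= tT]; exact: yT.
Qed.

(* If all averages were asymptotically uniform, every orbit would spend most of
   its time near the orbit of a point [z] tracing the constant sequence
   [x, x, ...]; as the latter has few orbit segments, the entropy would vanish. *)
Lemma nonuniform_averages (e0 h : R) : compact [set: X] -> continuous f ->
  approximate_product_property f -> 0 < e0 -> 0 < h ->
  (h%:E < pressure_eps f (cst 0%R) setT e0)%E ->
  exists g : X -> R, [/\ continuous g, forall y, 0 <= g y <= 1 &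
    exists2 gam, 0 < gam & forall N, exists n x x',
      (N <= n)%N /\ n%:R * gam <= birkhoff_sum f g n x' - birkhoff_sum f g n x].
Proof.
move=> cX cf app e00 h0 hP; apply: contrapT => Hno.
have unif (g : X -> R) : continuous g -> (forall y, 0 <= g y <= 1) -> forall gam, 0 < gam ->
    exists N, forall n x x', (N <= n)%N ->
      birkhoff_sum f g n x' - birkhoff_sum f g n x < n%:R * gam.
  move=> cg g01 gam gam0; apply: contrapT => /forallNP H; apply: Hno.
  exists g; split => //; exists gam => // N; have := H N.
  move=> /existsNP[n /existsNP[x /existsNP[x' /not_implyP[Nn /negP]]]].
  by rewrite -leNgt => ?; exists n, x, x'.
have [|theta theta0 [N0 HN0]] := @pressure_eps_spanning _ _ f (cst 0%R) e0 0 h e00 _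
  (lexx _) hP; first by move=> x y _; rewrite subrr normr0.
pose e := e0 / 12; have e_gt0 : 0 < e by rewrite divr_gt0.
(* Exponents per unit of time: 2k for words over [T] and k for the tubes around them. The remaining
   5k beats [L / theta] once [B] exceeds [q]. The scale is [e0 / 12] because tubes of radius 4e are
   covered at scale 12e. *)
pose k := h / 8; have k0 : 0 < k by rewrite divr_gt0.
have [d1 d10 tube1] := tubes_cover cX e_gt0 k0.
have [d2 d20 tube2] := tubes_cover cX (mulr_gt0 (ltr0Sn R 3) e_gt0) k0.
pose gam := Num.min (d1 / 3) 1.
have gam0 : 0 < gam by rewrite lt_min divr_gt0/=.
have [N1 HN1] := app_traces app e_gt0 gam0 gam0.
have [N2 HN2] := quadratic_le_expR k0.
pose L := maxn N1 N2.
have [G [L0 G0 GL Htr]] := HN1 L (leq_maxl _ _).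
have Lp : 0 < L%:R :> R by rewrite ltr0n.
have quad := HN2 L (leq_maxr _ _).
have {}GL' : (G <= L)%N.
  rewrite -(ler_nat R) (le_trans GL)// -[leRHS]mul1r ler_wpM2r//.
  by rewrite ge_min lexx orbT.
have [s [z tr]] := Htr (fun=> point).
have [T sT HT] := tube1 ('I_(2 * L).+1 * 'I_(2 * L).+1)%type L
  (fun ab j => if (j < ab.2)%N then iter (ab.1 + j) f point
               else iter (j - ab.2) f point).
have {}HT m : exists2 t, t \in T & forall j, (j < L)%N ->
    mdist (iter j f t) (iter (j + m) f z) < 3 * e.
  have [a [b ab]] := window_mismatch m L0 GL' tr.
  have [|t tT Ht] := HT (a, b) (iter m f z).
    apply: (le_trans ab).
    have : gam * L%:R <= d1 / 3 * L%:R by rewrite ler_wpM2r// ge_min lexx.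
    by move: GL; lra.
  by exists t => // j /Ht; rewrite iterD.
have [g [cg g01 g1 g0]] := bowen_neighborhood_of_orbit e_gt0 cX cf HT.
pose eta := Num.min (d2 / 2) 1.
have eta0 : 0 < eta by rewrite lt_min divr_gt0/=.
have [N3 HN3] := unif g cg g01 eta eta0.
pose q := L%:R / theta / (5 * k).
have [Nq qN] : exists Nq : nat, q < Nq%:R.
  by exists (Num.truncn q).+1; exact: truncnS_gt.
pose B := maxn (maxn N0 N3) (maxn (Num.truncn eta^-1).+1 Nq).
have NqB : (Nq <= B)%N by rewrite /B !leq_max leqnn !orbT.
pose M := (B * L)%N.
have BM : (B <= M)%N by rewrite leq_pmulr.
have B0 : (0 < B)%N by rewrite /B !leq_max orbT.
have LM : L%:R <= eta * M%:R.
  rewrite /M natrM mulrA -[leLHS]mul1r ler_wpM2r// -ler_pdivrMl// mulr1.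
  rewrite (le_trans (ltW (truncnS_gt _)))// ler_nat.
  by rewrite /B !leq_max leqnn !orbT.
pose bad y i := `[< forall t, t \in T -> ~ bowen_ball f L t (4 * e) (iter i f y) >].
have badM y : (\sum_(0 <= i < M) bad y i)%:R <= eta * M%:R.
  have := HN3 M y z; rewrite (leq_trans _ BM) ?[(N3 <= _)%N]leq_max ?leq_max ?leqnn ?orbT//.
  have -> : birkhoff_sum f g M z = M%:R.
    rewrite /birkhoff_sum (eq_bigr (fun=> 1)); first by rewrite sumr_const_nat subn0.
    by move=> i _; exact: g1.
  move=> /(_ isT) /ltW; rewrite lerBlDl -lerBlDr mulrC.
  have : birkhoff_sum f g M y <= M%:R - (\sum_(0 <= i < M) bad y i)%:R.
    rewrite natr_sum -[M in M%:R]subn0 -sumr_const_nat -sumrB; apply: ler_sum => i _.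
    rewrite /bad; case: asboolP => [H|_].
      by rewrite g0// subrr.
    by rewrite subr0; have /andP[] := g01 (iter i f y).
  by clear; lra.
(* Pigeonhole over the residues modulo [L]: along some residue the bad times are no more frequent
   than on average. *)
have phase y : exists r : 'I_L,
    L%:R * (\sum_(0 <= i < B) bad y (i * L + r))%:R <= eta * M%:R :> R.
  apply: contrapT => H.
  have {}H (r : 'I_L) : eta * M%:R / L%:R < (\sum_(0 <= i < B) bad y (i * L + r))%:R.
    rewrite ltr_pdivrMr// [ltRHS]mulrC ltNge.
    by apply/negP => H'; apply: H; exists r.
  have := badM y; rewrite leNgt => /negP; apply.
  rewrite big_nat_mul.
  under eq_bigr => i _ do rewrite -[X in \sum_(X <= _ < _) _]add0n big_addn mulSn addnK big_mkord.
  rewrite exchange_big/= natr_sum.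
  apply: (@le_lt_trans _ _ (\sum_(r < L) eta * M%:R / L%:R)).
    by rewrite sumr_const card_ord -[leRHS]mulr_natr divfK ?gt_eqF.
  apply: ltr_sum => [|r _]; first by apply/hasP; exists (Ordinal L0); rewrite ?mem_index_enum.
  by under eq_bigr do rewrite addnC.
(* The reference sequences are indexed by a phase and one letter per block. The extra letter
   [size T] is the value of [find] on bad blocks. *)
have [D sD HD] := tube2 ('I_L * {ffun 'I_B -> 'I_(size T).+1})%type M
  (fun rt j => iter ((j - rt.1) %% L) f
    (nth point T (oapp (fun i => nat_of_ord (rt.2 i)) 0%N (insub ((j - rt.1) %/ L)%N)))).
have cov y : exists2 t, t \in D & bowen_ball f M t e0 y.
  have [r Hr] := phase y.
  pose tau : {ffun 'I_B -> 'I_(size T).+1} := [ffun i : 'I_B =>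
    inord (find (fun t => `[< bowen_ball f L t (4 * e) (iter (i * L + r) f y) >]) T)].
  have [|t tD Ht] := HD (r, tau) y; last first.
    by exists t => // j /Ht; rewrite /e; lra.
  have := @phase_mismatch (4 * e) B L r y (fun i => bad y (i * L + r)%N)
    (fun i => nth point T (oapp (fun i => nat_of_ord (tau i)) 0%N (insub i))) L0.
  rewrite (leq_trans (ltnW (ltn_ord r)))// ?leq_pmull// => /(_ isT).
  move=> H; apply: (le_trans (_ : _ <= (r + L * \sum_(0 <= i < B) bad y (i * L + r))%:R)).
    rewrite ler_nat; apply: H => i iB; rewrite insubT/= => /asboolP nb o oL.
    have hasT : has (fun t => `[< bowen_ball f L t (4 * e) (iter (i * L + r) f y) >]) T.
      apply/hasP; move/existsNP: nb => [t /not_implyP[tT /contrapT Bt]].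
      by exists t => //; apply/asboolP.
    rewrite ffunE inordK ?ltnS ?find_size//.
    have /asboolP/(_ o oL) := nth_find point hasT.
    by rewrite -iterD metric_sym => /ltW.
  rewrite natrD natrM (le_trans (lerD (_ : _ <= eta * M%:R) Hr))//.
    by rewrite (le_trans _ LM)// ler_nat ltnW.
  rewrite -mulrDl ler_wpM2r//.
  have : eta <= d2 / 2 by rewrite ge_min lexx.
  by lra.
have := HN0 M D; rewrite (leq_trans _ BM) ?leq_max ?leqnn// => /(_ isT cov).
under eq_bigr do rewrite /birkhoff_sum big1_eq expR0.
rewrite sumr_const_seq mulr1 subr0 => /le_trans /(_ sD).
rewrite card_prod card_ord card_ffun !card_ord natrM natrX.
have T2 : (size T).+1%:R <= expR (2 * k * L%:R) :> R.
  rewrite -natr1 (le_trans (lerD sT (lexx 1)))// card_prod !card_ord.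
  have -> : 2 * k * L%:R = k * L%:R + k * L%:R by ring.
  have E1 : 1 <= expR (k * L%:R) by rewrite (le_trans _ (expR_ge1Dx _))// lerDl mulr_ge0// ltW.
  rewrite natrM -natr1 natrM expRD.
  apply: le_trans (ler_wpM2r (expR_ge0 _) quad).
  by rewrite [leRHS]mulrDl mul1r -expr2 lerD.
have TB : (size T).+1%:R ^+ B <= expR (2 * k * M%:R) :> R.
  have -> : 2 * k * M%:R = 2 * k * L%:R * B%:R by rewrite /M natrM; ring.
  by rewrite expRM_natr lerXn2r ?nnegrE ?expR_ge0.
have kM : 0 <= k * M%:R by rewrite mulr_ge0// ltW.
apply/negP; rewrite -ltNge.
apply: (@le_lt_trans _ _ (L%:R * expR (3 * k * M%:R))).
  rewrite -mulrA ler_wpM2l//.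
  have -> : 3 * k * M%:R = 2 * k * M%:R + k * M%:R by ring.
  by rewrite expRD ler_wpM2r// expR_ge0.
have -> : h * M%:R = 5 * k * M%:R + 3 * k * M%:R by rewrite /k; field.
rewrite expRD mulrA ltr_pM2r ?expR_gt0// -ltr_pdivrMl//.
apply: lt_le_trans (expR_ge1Dx _).
rewrite (lt_le_trans (_ : _ < 5 * k * M%:R))//; last by rewrite lerDr.
have -> : theta^-1 * L%:R = q * (5 * k) by rewrite /q mulrC divfK// gt_eqF ?mulr_gt0.
rewrite mulrC ltr_pM2l ?mulr_gt0// (lt_le_trans qN)// ler_nat.
exact: leq_trans BM.
Qed.

End NonUniformAverages.

(** * Invariant measures and weak faces *)

Section BorelRegularity.
Context {R : realType} {X : pointedMetricType R}.
Implicit Types (mu nu : borel_probability X) (A F U : set X).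

Lemma open_measurable_borel U : open U -> measurable (U : set (borel X)).
Proof. exact: sub_sigma_algebra. Qed.

Lemma closed_measurable_borel F : closed F -> measurable (F : set (borel X)).
Proof.
move=> cF; rewrite -[F]setCK; apply: measurableC.
by apply: open_measurable_borel; exact: closed_openC.
Qed.

Lemma open_inner_regular mu U (e : R) : open U -> 0 < e ->
  exists F, [/\ closed F, F `<=` U & (mu (U `\` F) < e%:E)%E].
Proof.
move=> oU e0.
pose F k : set X := [set x | forall y, ~ U y -> k.+1%:R^-1 <= mdist y x].
have cF k : closed (F k).
  rewrite (_ : F k = \bigcap_(y in ~` U) ~` [set x | mdist y x < k.+1%:R^-1]).
    by apply: closed_bigI => y _; apply: open_closedC; exact: open_mdist_lt.
  apply/seteqP; split => x /= H y Uy; first by apply/negP; rewrite -leNgt; exact: H.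
  by rewrite leNgt; apply/negP; exact: H.
have FU k : F k `<=` U.
  by move=> x Fx; apply: contrapT => /Fx; rewrite mdistxx leNgt invr_gt0 ltr0n.
have mF k : measurable (U `\` F k : set (borel X)).
  apply: measurableD; first exact: open_measurable_borel.
  exact: closed_measurable_borel.
have cap0 : \bigcap_k (U `\` F k) = set0.
  rewrite -subset0 => x Hx; have [Ux _] := Hx 0%N I.
  move: (oU); rewrite openE => /(_ _ Ux) /nbhs_ballP[r /= r0 rU].
  have [_] := Hx (Num.truncn r^-1) I; apply.
  move=> y Uy; rewrite leNgt; apply/negP => yx; apply: Uy; apply: rU.
  rewrite ballEmdist/= metric_sym (lt_trans yx)// invf_plt ?posrE ?ltr0n//.
  exact: truncnS_gt.
have cvg0 : (mu \o (fun k => U `\` F k)) x @[x --> \oo] --> mu (\bigcap_k (U `\` F k)).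
  apply: nonincreasing_cvg_mu => //.
  - by rewrite (le_lt_trans (probability_le1 _ (mF 0%N)))// ltry.
  - by apply: bigcap_measurable => // k _; exact: mF.
  - move=> n m nm; apply/subsetPset => x [Ux Fx]; split => // Fnx; apply: Fx => y Uy.
    by rewrite (le_trans _ (Fnx y Uy))// lef_pV2 ?posrE ?ltr0n// ler_nat ltnS.
rewrite cap0 measure0 in cvg0.
have : nbhs (0%E : \bar R) [set x | (x < e%:E)%E].
  by apply: open_nbhs_nbhs; split; [exact: open_ereal_lt_ereal|rewrite /= lte_fin].
move=> /cvg0[N _ HN]; exists (F N); split; [exact: cF|exact: FU|].
by apply: (HN N) => /=.
Qed.

Lemma borel_regular mu A (e : R) : measurable (A : set (borel X)) -> 0 < e ->
  exists F U, [/\ closed F, open U, F `<=` A, A `<=` U & (mu (U `\` F) < e%:E)%E].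
Proof.
pose S := [set A : set X | forall e : R, 0 < e -> exists F U,
  [/\ closed F, open U, F `<=` A, A `<=` U & (mu (U `\` F) < e%:E)%E]].
suff : <<s @open X >> `<=` S by move=> H mA; exact: H.
apply: smallest_sub; last first.
  move=> U oU d d0; have [F [cF FU UF]] := open_inner_regular mu oU d0.
  by exists F, U; split.
split.
- move=> d d0; exists set0, set0; split => //; first exact: closed0.
    exact: open0.
  by rewrite setD0 measure0 lte_fin.
- move=> B SB d d0; have [F [U [cF oU FB BU UF]]] := SB d d0.
  exists (~` U), (~` F); rewrite setTD; split.
  + exact: open_closedC.
  + exact: closed_openC.
  + exact: subsetC.
  + exact: subsetC.
  + by rewrite setDE setCK setIC -setDE.
- move=> B SB d d0.
  have d2 : 0 < d / 2 by rewrite divr_gt0.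
  have /choice[FU HFU] : forall n, exists FU : set X * set X,
      [/\ closed FU.1, open FU.2, FU.1 `<=` B n, B n `<=` FU.2 &
        (mu (FU.2 `\` FU.1) < (d / 2 / (2 ^ n.+1)%:R)%:E)%E].
    move=> n; have [|F [U H]] := SB n (d / 2 / (2 ^ n.+1)%:R).
      by rewrite divr_gt0// ltr0n expn_gt0.
    by exists (F, U).
  (* Only finite unions of closed sets are closed, so the inner approximation is cut at [N], chosen
     by continuity from above. *)
  pose F N := \bigcup_(n in `I_N) (FU n).1; pose U := \bigcup_n (FU n).2.
  have cF N : closed (F N).
    apply: closed_bigcup; first exact: finite_II.
    by move=> n _; have [] := HFU n.
  have oU : open U by apply: bigcup_open => n _; have [] := HFU n.
  have mU : measurable (U : set (borel X)) by exact: open_measurable_borel.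
  have mF n : measurable ((FU n).1 : set (borel X)).
    by apply: closed_measurable_borel; have [] := HFU n.
  have mUF n : measurable ((FU n).2 `\` (FU n).1 : set (borel X)).
    by apply: measurableD => //; apply: open_measurable_borel; have [] := HFU n.
  have mUFN N : measurable (U `\` F N : set (borel X)).
    by apply: measurableD => //; exact: closed_measurable_borel.
  have cvgF : (mu \o (fun N => U `\` F N)) x @[x --> \oo] -->
      mu (\bigcap_N (U `\` F N)).
    apply: nonincreasing_cvg_mu => //.
    - by rewrite (le_lt_trans (probability_le1 _ (mUFN 0%N)))// ltry.
    - by apply: bigcap_measurable => // k _; exact: mUFN.
    - move=> n m nm; apply/subsetPset => x [Ux Fx]; split => // -[k /= kn Fk].
      by apply: Fx; exists k => //=; exact: leq_trans nm.
  have lim_lt : (mu (\bigcap_N (U `\` F N)) < d%:E)%E.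
    apply: (@le_lt_trans _ _ (d / 2)%:E); last by rewrite lte_fin; lra.
    have mUFU : measurable (\bigcup_n ((FU n).2 `\` (FU n).1) : set (borel X)).
      exact: bigcup_measurable.
    apply: (@le_trans _ _ (mu (\bigcup_n ((FU n).2 `\` (FU n).1)))).
      apply: le_measure; rewrite ?inE//.
        by apply: bigcap_measurable => // k _; exact: mUFN.
      move=> x Hx; have [[n _ Unx] _] := Hx 0%N I; exists n => //; split => // Fnx.
      by have [_] := Hx n.+1 I; apply; exists n => /=.
    apply: (le_trans (generalized_Boole_inequality mu mUF mUFU)).
    apply: le_trans (epsilon_trick0 xpredT (ltW d2)).
    by apply: lee_nneseries => // n _; apply/ltW; have [] := HFU n.
  have : nbhs (mu (\bigcap_N (U `\` F N))) [set x | (x < d%:E)%E].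
    by apply: open_nbhs_nbhs; split; [exact: open_ereal_lt_ereal|].
  move=> /cvgF[N _ HN]; exists (F N), U; split => //.
  + move=> x [n _ Fnx]; exists n => //; have [_ _ FB _ _] := HFU n; exact: FB.
  + by move=> x [n _ Bnx]; exists n => //; have [_ _ _ BU _] := HFU n; exact: BU.
  + by apply: (HN N) => /=.
Qed.

End BorelRegularity.

Section WeakFaces.
Context {R : realType} {X : pointedMetricType R} (f : X -> X).
Implicit Types (mu nu kappa : borel_probability X) (A F U : set X) (g : X -> R).

Lemma borel_probability_lty mu A : measurable (A : set (borel X)) -> (mu A < +oo)%E.
Proof. by move=> mA; rewrite (le_lt_trans (probability_le1 mu mA))// ltry. Qed.

Lemma continuous_integrable mu g (C : R) : continuous g -> (forall x, `|g x| <= C) ->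
  mu.-integrable setT (EFin \o (g : borel X -> R)).
Proof.
move=> cg gC; apply: measurable_bounded_integrable => //.
- exact: borel_probability_lty.
- exact: continuous_borel.
- exists C; split; first exact: num_real.
  by move=> M CM x _ /=; rewrite (le_trans (gC x))// ltW.
Qed.

Lemma unit_integrable mu g : continuous g -> (forall x, 0 <= g x <= 1) ->
  mu.-integrable setT (EFin \o (g : borel X -> R)).
Proof.
move=> cg g01; apply: (@continuous_integrable _ _ 1) => // x.
by rewrite ger0_norm; have /andP[] := g01 x.
Qed.

Lemma indic_integrable mu A : measurable (A : set (borel X)) ->
  mu.-integrable setT (EFin \o (\1_A : borel X -> R)).
Proof.
move=> mA; apply: measurable_bounded_integrable => //.
- exact: borel_probability_lty.
- exists 1; split; first exact: num_real.
  by move=> M M1 x _ /=; rewrite (le_trans _ (ltW M1))// indicE; case: (_ \in _); rewrite ?normr1 ?normr0.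
Qed.

Lemma Rintegral_indic mu A : measurable (A : set (borel X)) ->
  \int[mu]_x (\1_A x : R) = fine (mu A).
Proof. by move=> mA; rewrite /Rintegral integral_indic// setIT. Qed.

Lemma measure_le_Rintegral mu g F : continuous g -> (forall x, 0 <= g x <= 1) ->
  closed F -> (forall x, F x -> g x = 1) -> fine (mu F) <= \int[mu]_x g x.
Proof.
move=> cg g01 cF gF; have mF := closed_measurable_borel cF.
rewrite -Rintegral_indic//; apply: le_Rintegral => //.
- exact: indic_integrable.
- exact: unit_integrable.
- move=> x _; rewrite indicE; have [/set_mem Fx|_] := boolP (x \in F).
    by rewrite gF.
  by have /andP[] := g01 x.
Qed.

Lemma Rintegral_le_measure mu g U : continuous g -> (forall x, 0 <= g x <= 1) ->
  open U -> (forall x, ~ U x -> g x = 0) -> \int[mu]_x g x <= fine (mu U).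
Proof.
move=> cg g01 oU gU; have mU := open_measurable_borel oU.
rewrite -Rintegral_indic//; apply: le_Rintegral => //.
- exact: unit_integrable.
- exact: indic_integrable.
- move=> x _; rewrite indicE; have [/set_mem Ux|] := boolP (x \in U).
    by have /andP[] := g01 x.
  by move/negP => nU; rewrite gU// => Ux; apply: nU; exact/mem_set.
Qed.

Lemma continuous_preimage_measurable A : continuous f ->
  measurable (A : set (borel X)) -> measurable (f @^-1` A : set (borel X)).
Proof.
move=> /continuousP cf; move: A.
have : <<s @open X >> `<=` [set A | measurable (f @^-1` A : set (borel X))].
  apply: smallest_sub; last by move=> U oU; apply: open_measurable_borel; exact: cf.
  split => /=.
  - by rewrite preimage_set0.
  - by move=> A mA; rewrite setTD preimage_setC; exact: measurableC.
  - by move=> A mA; rewrite preimage_bigcup; exact: bigcup_measurable.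
by [].
Qed.

Lemma fine_measureD mu A B : measurable (A : set (borel X)) ->
  measurable (B : set (borel X)) -> A `<=` B ->
  fine (mu (B `\` A)) = fine (mu B) - fine (mu A).
Proof.
move=> mA mB AB; rewrite measureD//; last exact: borel_probability_lty.
by rewrite (setIidr AB) fineB// fin_num_measure.
Qed.

Lemma fine_measure_le mu A B : measurable (A : set (borel X)) ->
  measurable (B : set (borel X)) -> A `<=` B -> fine (mu A) <= fine (mu B).
Proof.
move=> mA mB AB; apply: fine_le; try exact: fin_num_measure.
by apply: le_measure; rewrite ?inE.
Qed.

Lemma borel_approx mu A (e : R) : measurable (A : set (borel X)) -> 0 < e ->
  exists F U, [/\ closed F, open U, F `<=` A & A `<=` U] /\
    fine (mu U) <= fine (mu F) + e.
Proof.
move=> mA e0; have [F [U [cF oU FA AU UF]]] := borel_regular mu mA e0.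
exists F, U; split => //.
have mF := closed_measurable_borel cF; have mU := open_measurable_borel oU.
rewrite addrC -lerBlDr -fine_measureD//; last exact: subset_trans AU.
have mUF : measurable (U `\` F : set (borel X)) by exact: measurableD.
by rewrite -lee_fin fineK ?ltW//; exact: fin_num_measure.
Qed.

(** A Urysohn function is squeezed between a closed set inside [A], almost full for [nu], and an
    open set around [A], almost tight for [kappa]. The two errors [e / (1 + t)] and
    [t * (e / (1 + t))] add up to [e]. *)
Lemma domination_on_borel kappa nu (t : R) : compact [set: X] -> 0 <= t ->
  (forall g, continuous g -> (forall x, 0 <= g x <= 1) ->
    t * \int[nu]_x g x <= \int[kappa]_x g x) ->
  forall A, measurable (A : set (borel X)) -> t * fine (nu A) <= fine (kappa A).
Proof.
move=> cX t0 dom A mA; apply/ler_addgt0Pl => e e0.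
have e1 : 0 < e / (1 + t) by rewrite divr_gt0//; lra.
have [F [V [[cF oV FA AV] nuF]]] := borel_approx nu mA e1.
have [G [U [[cG oU GA AU] kaU]]] := borel_approx kappa mA e1.
have mF := closed_measurable_borel cF; have mU := open_measurable_borel oU.
have mG := closed_measurable_borel cG; have mV := open_measurable_borel oV.
have F0 : closed (~` U) by exact: open_closedC.
have [|g [cg g01 gU gF]] := urysohn_closed cX F0 cF.
  by rewrite -subset0 => x [nUx Fx]; apply: nUx; exact/AU/FA.
have d1 := measure_le_Rintegral nu cg g01 cF gF.
have d2 := Rintegral_le_measure kappa cg g01 oU gU.
have d3 := dom g cg g01.
have d4 := fine_measure_le nu mA mV AV.
have d5 := fine_measure_le kappa mG mA GA.
have d6 : t * fine (nu A) <= t * fine (nu F) + t * (e / (1 + t)).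
  by rewrite -mulrDr ler_wpM2l//; lra.
have d7 : t * fine (nu F) <= t * \int[nu]_x g x by rewrite ler_wpM2l.
have d8 : e / (1 + t) + t * (e / (1 + t)) = e by field; lra.
lra.
Qed.

(* Otherwise [t * nu <= kappa] on Borel sets, so that [kappa] is a mixture of [nu]
   and the normalised remainder, and the face property puts [nu] in [L]. *)
Lemma weak_face_obstruction (L : set (borel_probability X)) kappa nu (t : R) :
  compact [set: X] -> continuous f -> weak_face f L -> L kappa ->
  invariant_measures f nu -> ~ L nu -> 0 < t < 1 ->
  exists g, [/\ continuous g, forall x, 0 <= g x <= 1 &
    \int[kappa]_x g x < t * \int[nu]_x g x].
Proof.
move=> cX cf [LI _ face] Lk Inu nLnu t01; have /andP[t0 t1] := t01.
apply: contrapT => H; apply: nLnu.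
have dom : forall A, measurable (A : set (borel X)) -> t * fine (nu A) <= fine (kappa A).
  apply: domination_on_borel => //; first exact: ltW.
  move=> g cg g01; rewrite leNgt; apply/negP => lt_g; apply: H; exists g; split => //.
(* The signed measure [kappa - t * nu], then set to 0 off the Borel sets: nonnegativity is required
   on every set, and domination gives it on Borel sets. *)
pose c := cadd (charge_of_finite_measure kappa)
  (cscale (- t) (charge_of_finite_measure nu)).
pose c0 := crestr0 c (@measurableT _ (borel X)).
have c0E A : measurable (A : set (borel X)) ->
    c0 A = (fine (kappa A) - t * fine (nu A))%:E.
  move=> mA; rewrite /c0 /crestr0 mem_set// /crestr setIT /c /cadd /cscale/=.
  have k_fin : kappa A \is a fin_num by exact: fin_num_measure.
  have n_fin : nu A \is a fin_num by exact: fin_num_measure.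
  transitivity (kappa A + (- t)%:E * nu A)%E; first by [].
  by rewrite -[in LHS](fineK k_fin) -[in LHS](fineK n_fin) -EFinM -EFinD mulNr.
have c0_ge0 A : (0 <= c0 A)%E.
  have [mA|nmA] := pselect (measurable (A : set (borel X))).
    by rewrite c0E// lee_fin subr_ge0 dom.
  by rewrite /c0 /crestr0 memNset.
pose m := measure_of_charge c0 c0_ge0.
pose nu2 : borel_probability X := mnormalize m nu.
have t10 : 1 - t != 0 by rewrite subr_eq0 gt_eqF.
have nu2E A : measurable (A : set (borel X)) ->
    nu2 A = ((fine (kappa A) - t * fine (nu A)) / (1 - t))%:E.
  move=> mA; rewrite -[LHS]/(mnormalize m nu A).
  have mT : m setT = (1 - t)%:E.
    rewrite [LHS]c0E//; congr EFin.
    have -> : kappa setT = 1%E by exact: probability_setT.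
    have -> : nu setT = 1%E by exact: probability_setT.
    by rewrite /= mulr1.
  rewrite /mnormalize [X in (X == 0%E)]mT [X in (X == +oo)%E]mT [X in fine X]mT.
  rewrite ifF; last by rewrite eqe (negbTE t10).
  by rewrite -[X in (X * _)%E]/(c0 A) c0E.
have Inu2 : invariant_measures f nu2.
  move=> A mA; have mfA : measurable (f @^-1` A : set (borel X)).
    exact: continuous_preimage_measurable.
  by rewrite !nu2E// Inu// (LI _ Lk).
have mix : is_mixture t kappa nu nu2.
  move=> A mA; rewrite nu2E// -EFinM.
  have k_fin : kappa A \is a fin_num by exact: fin_num_measure.
  have n_fin : nu A \is a fin_num by exact: fin_num_measure.
  rewrite -[in LHS](fineK k_fin) -[in RHS](fineK n_fin) -EFinM -EFinD.
  by congr EFin; rewrite /=; field.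
by have [] := face t kappa nu nu2 Lk t01 Inu Inu2 mix.
Qed.

End WeakFaces.

Section EmpiricalLists.
Context {R : realType} {X : pointedMetricType R} (f : X -> X).
Implicit Types (nu : borel_probability X) (g : X -> R).

Lemma Rintegral_sum_continuous (I : Type) (s : seq I) nu (F : I -> X -> R) (C : I -> R) :
  (forall i, continuous (F i)) -> (forall i x, `|F i x| <= C i) ->
  \int[nu]_x (\sum_(i <- s) F i x) = \sum_(i <- s) \int[nu]_x F i x.
Proof.
move=> cF FC; suff : nu.-integrable setT (EFin \o ((fun x => \sum_(i <- s) F i x) : borel X -> R))
    /\ \int[nu]_x (\sum_(i <- s) F i x) = \sum_(i <- s) \int[nu]_x F i x by case.
elim: s => [|i s [int_s IH]].
  under [X in integrable _ _ (_ \o X)]funext do rewrite big_nil.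
  under [X in Rintegral _ _ X]funext do rewrite big_nil.
  rewrite big_nil Rintegral_cst// mul0r; split => //.
  by apply: (@continuous_integrable _ _ nu (cst 0) 0) => [x|x]; [exact: cvg_cst|rewrite normr0].
under [X in integrable _ _ (_ \o X)]funext do rewrite big_cons.
under [X in Rintegral _ _ X]funext do rewrite big_cons.
have int_i := continuous_integrable nu (cF i) (FC i).
rewrite big_cons RintegralD// IH; split => //.
exact: (integrableD measurableT int_i int_s).
Qed.

Lemma invariant_Rintegral nu g (C : R) : continuous f -> invariant_measures f nu ->
  continuous g -> (forall x, `|g x| <= C) ->
  \int[nu]_x g (f x) = \int[nu]_x g x.
Proof.
move=> cf Inu cg gC.
have mf : measurable_fun [set: borel X] (f : borel X -> borel X).
  by move=> _ A mA; rewrite setTI; exact: continuous_preimage_measurable.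
have mg : measurable_fun [set: borel X] (EFin \o (g : borel X -> R)).
  by apply/measurable_EFinP; exact: continuous_borel.
have cgf : continuous (g \o f).
  by move=> x; apply: continuous_comp; [exact: cf|exact: cg].
have int_gf : nu.-integrable (f @^-1` setT) ((EFin \o (g : borel X -> R)) \o f).
  rewrite preimage_setT.
  exact: (continuous_integrable nu cgf (fun x => gC (f x))).
rewrite /Rintegral; congr fine.
have := integral_pushforward mf mg int_gf measurableT.
rewrite preimage_setT /= => <-.
by apply: eq_measure_integral => A mA _; exact: Inu.
Qed.

Lemma birkhoff_sum_norm g (C : R) n x : (forall y, `|g y| <= C) ->
  `|birkhoff_sum f g n x| <= n%:R * C.
Proof.
move=> gC; rewrite ler_norml birkhoff_sum_ge_norm// birkhoff_sum_le_norm//.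
Qed.

Lemma Rintegral_birkhoff_sum nu g (C : R) n : continuous f -> invariant_measures f nu ->
  continuous g -> (forall x, `|g x| <= C) ->
  \int[nu]_x birkhoff_sum f g n x = n%:R * \int[nu]_x g x.
Proof.
move=> cf Inu cg gC; rewrite /birkhoff_sum.
rewrite (@Rintegral_sum_continuous _ _ _ (fun k x => g (iter k f x)) (fun=> C))//.
  rewrite (eq_bigr (fun=> \int[nu]_x g x)).
    by rewrite sumr_const_nat subn0 mulr_natl.
  move=> k _; elim: k => [//|k IH].
  under [X in Rintegral _ _ X]funext do rewrite iterSr.
  rewrite -IH; apply: (@invariant_Rintegral nu (fun x => g (iter k f x)) C) => //.
  by move=> x; apply: (@continuous_comp _ _ _ (iter k f) g); [exact: continuous_iter|exact: cg].
by move=> k x; apply: (@continuous_comp _ _ _ (iter k f) g); [exact: continuous_iter|exact: cg].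
Qed.

Lemma Rintegral_const nu (c : R) : \int[nu]_x c = c.
Proof.
rewrite Rintegral_cst// [X in _ * fine X](_ : _ = 1%E) ?mulr1//.
exact: probability_setT.
Qed.

(** The combination has integral 0, so it cannot exceed 1 everywhere. The slack 1 lets plain
    monotonicity of the integral conclude, and costs only the 2 in the bound of
    [approachability]. *)
Lemma below_mean nu (r : nat) (G : 'I_r -> X -> R) (D : 'I_r -> R) (C : R) :
  (forall i, continuous (G i)) -> (forall i x, `|G i x| <= C) ->
  exists y, \sum_(i < r) D i * (G i y - \int[nu]_x G i x) <= 1.
Proof.
move=> cG GC; apply: contrapT => /forallNP H.
pose F i x := D i * (G i x - \int[nu]_x G i x).
pose B i := `|D i| * (C + `|\int[nu]_x G i x|).
have cF i : continuous (F i).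
  by move=> x; apply: cvgMr; apply: cvgB; [exact: cG|exact: cvg_cst].
have FB i x : `|F i x| <= B i.
  rewrite /F /B normrM ler_wpM2l// (le_trans (ler_normB _ _))// lerD2r; exact: GC.
have intF : \int[nu]_x (\sum_(i < r) F i x) = 0.
  rewrite (Rintegral_sum_continuous _ _ cF FB) big1// => i _.
  have intG := continuous_integrable nu (cG i) (GC i).
  have intC : nu.-integrable setT (EFin \o (cst (\int[nu]_x G i x) : borel X -> R)).
    apply: (@continuous_integrable _ _ nu _ `|\int[nu]_x G i x|) => //.
    by move=> x; exact: cvg_cst.
  rewrite /F RintegralZl//; last exact: (integrableB measurableT intG intC).
  by rewrite RintegralB// Rintegral_const subrr mulr0.
have : \int[nu]_x (1 : R) <= \int[nu]_x (\sum_(i < r) F i x).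
  apply: le_Rintegral => //.
  - by apply: (@continuous_integrable _ _ nu (cst 1) 1) => x; [exact: cvg_cst|rewrite normr1].
  - apply: (@continuous_integrable _ _ nu _ (\sum_(i < r) B i)).
      move=> x; elim: (index_enum _) => [|i s IH].
        under [X in continuous_at _ X]funext do rewrite big_nil.
        exact: cvg_cst.
      under [X in continuous_at _ X]funext do rewrite big_cons.
      by apply: cvgD; [exact: cF|exact: IH].
    by move=> x; rewrite (le_trans (ler_norm_sum _ _ _))// ler_sum.
  - by move=> x _; rewrite leNgt; apply/negP => /ltW; exact: H.
by rewrite intF Rintegral_const ler10.
Qed.

(* Blackwell approachability: choosing each point below the mean against the
   current deficit [D] keeps [|D|^2] linear in the number of points. *)
Lemma approachability (T : Type) (r : nat) (G : 'I_r -> T -> R) m :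
  (forall i y, `|G i y| <= 1) ->
  (forall D : 'I_r -> R, exists y, \sum_(i < r) D i * G i y <= 1) ->
  exists2 s : seq T, size s = m &
    \sum_(i < r) (\sum_(y <- s) G i y) ^+ 2 <= m%:R * (r%:R + 2).
Proof.
move=> G1 GD; elim: m => [|m [s sm IH]].
  by exists [::] => //; rewrite big1 ?mul0r// => i _; rewrite big_nil expr0n.
have [y yD] := GD (fun i => \sum_(y <- s) G i y).
exists (y :: s); first by rewrite /= sm.
rewrite (eq_bigr (fun i => (\sum_(y <- s) G i y) ^+ 2 +
    (2 * ((\sum_(y <- s) G i y) * G i y) + G i y ^+ 2))); last first.
  by move=> i _; rewrite big_cons; ring.
have -> : m.+1%:R * (r%:R + 2) = m%:R * (r%:R + 2) + (2 + r%:R) :> R.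
  by rewrite -[m.+1%:R]natr1; ring.
rewrite !big_split/= -mulr_sumr lerD// lerD//; first by rewrite -[leRHS]mulr1 ler_wpM2l.
rewrite -[r in r%:R]card_ord -sumr_const; apply: ler_sum => i _.
by rewrite -real_normK ?num_real// exprn_ile1.
Qed.

(** By invariance the normalised Birkhoff sums of length [L] have the same integrals as the [g j],
    so approachability yields the list, with no ergodicity involved. The threshold on [m] makes
    [r + 2] at most [m * zeta ^+ 2]; as every larger [m] works, several measures can share one
    [m]. *)
Lemma empirical_list nu (r : nat) (g : nat -> X -> R) (zeta : R) : continuous f ->
  invariant_measures f nu -> 0 < zeta ->
  (forall j, (j < r)%N -> continuous (g j) /\ forall y, 0 <= g j y <= 1) ->
  exists m0 : nat, forall m L, (m0 <= m)%N -> (0 < L)%N ->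
    exists2 s : seq X, size s = m & forall j, (j < r)%N ->
      m%:R * (L%:R * (\int[nu]_x g j x - zeta)) <=
      \sum_(y <- s) birkhoff_sum f (g j) L y.
Proof.
move=> cf Inu zeta0 gP.
exists (Num.truncn ((r%:R + 2) / zeta ^+ 2)).+1 => m L m0m L0.
have Lp : 0 < L%:R :> R by rewrite ltr0n.
have gc (i : 'I_r) : continuous (g i) by have [] := gP i (ltn_ord i).
have g01 (i : 'I_r) y : 0 <= g i y <= 1 by have [_] := gP i (ltn_ord i).
have gn (i : 'I_r) y : `|g i y| <= 1 by rewrite ger0_norm; have /andP[] := g01 i y.
pose c (i : 'I_r) := \int[nu]_x g i x.
have c01 i : 0 <= c i <= 1.
  have int_g := unit_integrable nu (gc i) (g01 i).
  apply/andP; split; first by apply: Rintegral_ge0 => x _; have /andP[] := g01 i x.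
  rewrite -(Rintegral_const nu 1).
  apply: le_Rintegral => //; last by move=> x _; have /andP[] := g01 i x.
  by apply: (@continuous_integrable _ _ nu (cst 1) 1) => x; [exact: cvg_cst|rewrite normr1].
pose G (i : 'I_r) y := L%:R^-1 * birkhoff_sum f (g i) L y - c i.
have S01 (i : 'I_r) y : 0 <= L%:R^-1 * birkhoff_sum f (g i) L y <= 1.
  rewrite mulr_ge0 ?invr_ge0//=.
    rewrite ler_pdivrMl//; apply: birkhoff_sum_le => w; by have /andP[] := g01 i w.
  by rewrite -(mulr0 L%:R); apply: birkhoff_sum_ge => w; have /andP[] := g01 i w.
have [|D|s sm Hs] := @approachability X r G m.
- move=> i y; rewrite /G ler_norml; have := S01 i y; have := c01 i; lra.
- have [||y Hy] := @below_mean nu r (fun i => birkhoff_sum f (g i) L) (fun i => L%:R^-1 * D i) L%:R.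
  + by move=> i; apply: continuous_birkhoff_sum => //; exact: gc.
  + by move=> i x; rewrite -[leRHS]mulr1; exact: birkhoff_sum_norm.
  exists y; apply: le_trans Hy; rewrite le_eqVlt; apply/orP; left; apply/eqP.
  apply: eq_bigr => i _; rewrite (Rintegral_birkhoff_sum _ cf Inu (gc i) (gn i)).
  by rewrite /G -/(c i); field; rewrite gt_eqF.
exists s => // j jr; pose i := Ordinal jr.
have {}Hs : (\sum_(y <- s) G i y) ^+ 2 <= (m%:R * zeta) ^+ 2.
  apply: (@le_trans _ _ (\sum_(i < r) (\sum_(y <- s) G i y) ^+ 2)).
    by rewrite (bigD1 i)//= lerDl sumr_ge0// => k _; exact: sqr_ge0.
  apply: (le_trans Hs); rewrite exprMn expr2 -mulrA ler_wpM2l//.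
  rewrite -ler_pdivrMr ?exprn_gt0// (le_trans (ltW (truncnS_gt _)))// ler_nat//.
have mz : 0 <= m%:R * zeta by rewrite mulr_ge0// ltW.
have : - (m%:R * zeta) <= \sum_(y <- s) G i y.
  have : `|\sum_(y <- s) G i y| <= m%:R * zeta.
    by rewrite -(@ler_pXn2r _ 2) ?nnegrE// real_normK// num_real.
  by rewrite ler_norml => /andP[].
rewrite /G sumrB sumr_const_seq sm -mulr_sumr.
rewrite -(ler_pM2l Lp) mulrBr mulVKf ?gt_eqF//.
rewrite /c /=; set I := \int[nu]_x g j x.
have -> : m%:R * (L%:R * (I - zeta)) = L%:R * - (m%:R * zeta) + L%:R * (m%:R * I) by ring.
by rewrite lerBrDr.
Qed.

End EmpiricalLists.

(** A point makes [compact_seq_cover] available for sets of measures. *)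
HB.instance Definition _ (R : realType) (X : pointedMetricType R) :=
  isPointed.Build (borel_probability X) (\d_(point : borel X)).

(** * Obstructions for the four kinds of forbidden sets *)

Section Obstructions.
Context {R : realType} {X : pointedMetricType R} (f : X -> X) (g0 : X -> R).
Implicit Types (mu nu : borel_probability X) (Z : set X).

(* Every point of [Z] either has averages of [g0] accumulating at [v], or
   infinitely often spends too little time, as measured by one of the [g j],
   near lists of orbit segments realising the means [b j]. *)
Definition obstructed (t : R) Z := exists (v : R) (r : nat) (g : nat -> X -> R) (b : nat -> R),
  [/\ forall j, (j < r)%N -> [/\ continuous (g j), forall y, 0 <= g j y <= 1 & 0 < b j],
    forall zeta : R, 0 < zeta -> exists m0 : nat, forall m L, (m0 <= m)%N -> (0 < L)%N ->
      exists2 s : seq X, size s = m & forall j, (j < r)%N ->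
        m%:R * (L%:R * (b j - zeta)) <= \sum_(y <- s) birkhoff_sum f (g j) L y &
    forall x, Z x ->
      (forall tol, 0 < tol -> forall N, exists2 n, (N <= n)%N &
        `|birkhoff_sum f g0 n x - n%:R * v| <= n%:R * tol) \/
      exists2 j, (j < r)%N & forall N, exists2 n, (N <= n)%N &
        (0 < n)%N /\ birkhoff_sum f (g j) n x < n%:R * (t * b j)].

Lemma obstructed_by_value t Z (v : R) :
  (forall x, Z x -> forall tol, 0 < tol -> forall N, exists2 n, (N <= n)%N &
    `|birkhoff_sum f g0 n x - n%:R * v| <= n%:R * tol) -> obstructed t Z.
Proof.
move=> H; exists v, 0%N, (fun _ _ => 0), (fun=> 0); split => //.
  by move=> zeta _; exists 0%N => m L _ _; exists (nseq m point); rewrite ?size_nseq.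
by move=> x Zx; left; exact: H.
Qed.

(** The value is a cluster point of the averages along [x1]. Starting [k] steps later changes a
    Birkhoff sum of [g0] by at most [k], so all points of the orbit share it. *)
Lemma obstructed_orbit t x1 : (forall y, 0 <= g0 y <= 1) ->
  obstructed t (forward_orbit f x1).
Proof.
move=> g01; have S01 n x : 0 <= birkhoff_sum f g0 n x <= n%:R.
  apply/andP; split.
    by rewrite -(mulr0 n%:R); apply: birkhoff_sum_ge => w; have /andP[] := g01 w.
  by rewrite -[leRHS]mulr1; apply: birkhoff_sum_le => w; have /andP[] := g01 w.
pose a n := birkhoff_sum f g0 n.+1 x1 / n.+1%:R.
have [v [_ cv]] : `[0, 1]%classic `&` cluster (a @ \oo) !=set0.
  apply: (@segment_compact R 0 1 (a @ \oo)).
  exists 0%N => // n _ /=; rewrite in_itv /= /a divr_ge0//=; last by have /andP[] := S01 n.+1 x1.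
  by rewrite ler_pdivrMr// mul1r; have /andP[] := S01 n.+1 x1.
apply: (@obstructed_by_value _ _ v) => _ [k _ <-] tol tol0 N.
pose N' := maxn N (Num.truncn (4 * k%:R / tol)).+1.
have tol2 : 0 < tol / 2 by rewrite divr_gt0.
have [|z [[n Nn <-] vz]] := cv [set a n | n in [set n | (N' <= n)%N]] _ _
    (nbhsx_ballx v _ tol2).
  by exists N' => // n /= Nn; exists n.
move: vz; rewrite -ball_normE /= => vz.
exists n.+1; first by move: Nn; rewrite /= /N' geq_max => /andP[+ _] => /leqW.
have n0 : 0 < n.+1%:R :> R by rewrite ltr0n.
have kn : 4 * k%:R <= n.+1%:R * tol.
  rewrite -ler_pdivrMr// (le_trans (ltW (truncnS_gt _)))// ler_nat.
  by move: Nn; rewrite /= /N' geq_max => /andP[_] /leqW.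
have shift : birkhoff_sum f g0 k x1 + birkhoff_sum f g0 n.+1 (iter k f x1) =
    birkhoff_sum f g0 n.+1 x1 + birkhoff_sum f g0 k (iter n.+1 f x1).
  by rewrite -!birkhoff_sumD addnC.
have /andP[s1 s2] := S01 k x1; have /andP[s3 s4] := S01 k (iter n.+1 f x1).
have : `|n.+1%:R * (v - a n)| <= n.+1%:R * (tol / 2).
  by rewrite normrM ger0_norm ?ler_wpM2l// ltW.
rewrite /a mulrBr mulrCA divff ?gt_eqF// mulr1 !ler_norml.
by move: shift kn; clear -s1 s2 s3 s4 ; lra.
Qed.

Lemma continuous_map (g : X -> R) : continuous g ->
  exists psi : continuousType X R, psi = g :> (X -> R).
Proof. by move=> cg; exists (Continuous.Pack (Continuous.Class (isContinuous.Build _ _ g cg))). Qed.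

Lemma increasing_seq_ge (u : nat -> nat) k : increasing_seq u -> (k <= u k)%N.
Proof.
move=> incu; elim: k => // k IH; apply: leq_ltn_trans IH _.
by rewrite ltnNge -leEnat incu ltnn.
Qed.

Lemma empirical_limit_average x mu (g : X -> R) (psi : continuousType X R) :
  psi = g :> (X -> R) -> empirical_limits f x mu ->
  forall tol, 0 < tol -> forall N, exists2 n, (N <= n)%N & (0 < n)%N /\
    `|birkhoff_sum f g n x - n%:R * integrate mu psi| <= n%:R * tol.
Proof.
move=> psiE [u incu /wstar_cvgP/(_ psi) cvg_psi] tol tol0 N.
have /cvgrPdist_lt/(_ _ tol0)[N1 _ HN1] := cvg_psi.
pose k := maxn (maxn N N1) 1; have ku := increasing_seq_ge k incu.
have u0 : (0 < u k)%N by rewrite (leq_trans _ ku)// /k leq_max orbT.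
exists (u k); first by rewrite (leq_trans _ ku)// /k !leq_max leqnn.
split => //; have n0 : 0 < (u k)%:R :> R by rewrite ltr0n.
have /HN1 /= : (N1 <= k)%N by rewrite /k !leq_max leqnn orbT.
rewrite integrate_empirical// psiE => /ltW H.
have -> : birkhoff_sum f g (u k) x - (u k)%:R * integrate mu psi =
    - ((u k)%:R * (integrate mu psi - (u k)%:R^-1 * birkhoff_sum f g (u k) x)).
  by field; rewrite gt_eqF.
by rewrite normrN normrM ger0_norm ?ler_wpM2l// ltW.
Qed.

Lemma obstructed_empirical t mu : continuous g0 ->
  obstructed t [set x | empirical_limits f x mu].
Proof.
move=> cg0.
have [psi psiE] := continuous_map cg0.
apply: (@obstructed_by_value _ _ (integrate mu psi)) => x xmu tol tol0 N.
have [n Nn [_ Hn]] := empirical_limit_average psiE xmu tol0 N.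
by exists n.
Qed.

Lemma obstructed_by_measure t Z nu (r : nat) (g : nat -> X -> R) : continuous f ->
  invariant_measures f nu ->
  (forall j, (j < r)%N -> [/\ continuous (g j), forall y, 0 <= g j y <= 1 &
    0 < \int[nu]_x g j x]) ->
  (forall x, Z x -> exists2 j, (j < r)%N & forall N, exists2 n, (N <= n)%N &
    (0 < n)%N /\ birkhoff_sum f (g j) n x < n%:R * (t * \int[nu]_x g j x)) ->
  obstructed t Z.
Proof.
move=> cf Inu gP HZ; exists 0, r, g, (fun j => \int[nu]_x g j x); split => //.
  move=> zeta zeta0; apply: empirical_list => // j /gP[cg g01 _]; by split.
by move=> x /HZ; right.
Qed.

(** Some invariant [nu] charges the complement of [Z], hence a closed set disjoint from [Z]. A
    Urysohn function that is 1 there and 0 on [Z] has zero Birkhoff sums along [Z]. *)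
Lemma obstructed_subsystem t Z : compact [set: X] -> continuous f -> 0 < t ->
  compact Z -> set_invariant f Z ->
  invariant_measures_on f Z <> invariant_measures f -> obstructed t Z.
Proof.
move=> cX cf t0 cZ fZ neq.
have clZ : closed Z by apply: compact_closed => //; exact: metric_hausdorff.
have mZ := closed_measurable_borel clZ.
have [nu [Inu nuZ]] : exists nu, invariant_measures f nu /\ nu Z <> 1%E.
  apply: contrapT => /forallNP H; apply: neq; apply/seteqP; split => nu; first by case.
  move=> Inu; split => //; apply: contrapT => nuZ; exact: (H nu).
have nuCZ : 0 < fine (nu (~` Z)).
  have nuT : nu setT = 1%E by exact: probability_setT.
  have := @fine_measureD _ _ nu Z setT mZ measurableT (@subsetT _ Z).
  rewrite setTD => ->.
  have fin : nu Z \is a fin_num by exact: fin_num_measure.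
  have le1 : (nu Z <= 1)%E by exact: probability_le1.
  rewrite [X in fine X - _]nuT /= subr_gt0 -lte_fin fineK// lt_neqAle le1 andbT.
  exact/eqP.
have e0 : 0 < fine (nu (~` Z)) / 2 by rewrite divr_gt0.
have [F [U [[cF oU FZ ZU] FU]]] := borel_approx nu (measurableC mZ) e0.
have ZF : Z `&` F = set0 by rewrite -subset0 => x [Zx /FZ].
have [g [cg g01 gZ gF]] := urysohn_closed cX clZ cF ZF.
have nuF := measure_le_Rintegral nu cg g01 cF gF.
have nuU := fine_measure_le nu (measurableC mZ) (open_measurable_borel oU) ZU.
have b0 : 0 < \int[nu]_x g x by lra.
apply: (@obstructed_by_measure t Z nu 1 (fun=> g)) => // x Zx; exists 0%N => // N.
exists N.+1 => //; split => //; rewrite /birkhoff_sum big1 ?mulr_gt0 ?ltr0n//.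
move=> k _; apply: gZ; elim: k => [//|k IH] /=.
by apply: fZ; exists (iter k f x).
Qed.

(** [weak_face_obstruction] gives each measure of [K] a test function, and the strict inequality is
    weak-* open. Compactness of [K] leaves finitely many functions, which one list of segments can
    realise together. *)
Lemma obstructed_weak_face t (K L : set (borel_probability X)) :
  compact [set: X] -> continuous f -> 0 < t < 1 ->
  proper_weak_face f L -> K `<=` L -> compact K ->
  obstructed t [set x | empirical_limits f x `&` K !=set0].
Proof.
move=> cX cf t01 [faceL neqL] KL cK; have /andP[t0 _] := t01.
have [LI _ _] := faceL.
have [nu [Inu nLnu]] : exists nu, invariant_measures f nu /\ ~ L nu.
  apply: contrapT => /forallNP H; apply: neqL; apply/seteqP; split => // nu Inu.
  by apply: contrapT => nLnu; exact: (H nu).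
pose good := [set g : X -> R | [/\ continuous g, forall y, 0 <= g y <= 1 &
  0 < \int[nu]_x g x]].
pose O (g : X -> R) := [set kappa : borel_probability X |
  \int[kappa]_x g x < t * \int[nu]_x g x].
have oO g : good g -> open (O g).
  move=> [cg _ _]; have [psi psiE] := continuous_map cg.
  have -> : O g = (fun kappa => integrate kappa psi) @^-1`
      [set x | x < t * \int[nu]_x g x].
    by rewrite /O /integrate psiE.
  apply: open_comp; last exact: open_lt.
  move=> kappa _; have /wstar_cvgP/(_ psi) := @cvg_id _ (nbhs kappa).
  by [].
have KO : K `<=` \bigcup_(g in good) O g.
  move=> kappa Kk.
  have [g [cg g01 gk]] := weak_face_obstruction cX cf faceL (KL _ Kk) Inu nLnu t01.
  exists g => //; split => //; rewrite -(pmulr_rgt0 _ t0).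
  apply: le_lt_trans gk; apply: Rintegral_ge0 => x _.
  by have /andP[] := g01 x.
have [s [_ sgood cov]] := @compact_seq_cover _ K _ good O cK oO KO.
pose gs j := nth (fun=> 0) s j.
apply: (@obstructed_by_measure t _ nu (size s) gs) => //.
  by move=> j js; exact: sgood (mem_nth _ js).
move=> x [kappa [xk Kk]]; have [g gs_ Og] := cov _ Kk.
have [cg g01 _] := sgood _ gs_; have [psi psiE] := continuous_map cg.
exists (index g s); first by rewrite index_mem.
rewrite /gs nth_index// => N.
have gap0 : 0 < (t * \int[nu]_x g x - \int[kappa]_x g x) / 2.
  by rewrite divr_gt0// subr_gt0.
have [n Nn [n0 Hn]] := empirical_limit_average psiE xk gap0 N.
exists n => //; split => //; have np : 0 < n%:R :> R by rewrite ltr0n.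
move: Hn; rewrite ler_norml => /andP[_].
have -> : integrate kappa psi = \int[kappa]_x g x by rewrite /integrate psiE.
have : 0 < n%:R * ((t * \int[nu]_x g x - \int[kappa]_x g x) / 2) by rewrite mulr_gt0.
lra.
Qed.

End Obstructions.

(** * Construction of the avoiding set *)

Section Superblocks.
Context {R : realType} {X : pointedMetricType R} (f : X -> X).

Lemma periodic_average (Q : nat) (u : nat -> R) : (0 < Q)%N ->
  (forall k, u (k + Q)%N = u k) ->
  exists c0, forall b,
    `|\sum_(0 <= k < b) u k - b%:R * ((\sum_(0 <= k < Q) u k) / Q%:R)| <= c0.
Proof.
move=> Q0 per; set v := _ / Q%:R; pose D b := \sum_(0 <= k < b) u k - b%:R * v.
have Qp : Q%:R != 0 :> R by rewrite pnatr_eq0 -lt0n.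
have DQ b : D (b + Q)%N = D b.
  rewrite /D (@big_cat_nat _ _ _ Q) ?leq_addl//= -{2}[Q]add0n big_addn addnK.
  under [X in _ + X - _]eq_bigr do rewrite per.
  by rewrite natrD mulrDl /v [Q%:R * _]mulrC divfK//; ring.
have Dmod b : D b = D (b %% Q)%N.
  rewrite {1}(divn_eq b Q); elim: (b %/ Q)%N => [|q IH]; first by rewrite mul0n add0n.
  by rewrite mulSn addnAC addnC addnA (addnC _ Q) -addnA addnC DQ addnC -IH addnC.
exists (\sum_(r < Q) `|D r|) => b; rewrite -/(D b) Dmod.
by rewrite (bigD1 (Ordinal (ltn_pmod b Q0)))//= lerDl sumr_ge0.
Qed.

Context (Fr : nat) (ys : seq X).

Let Q := (Fr + size ys)%N.

Definition slot_value (alpha : R) (h : X -> R) (k : nat) : R :=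
  if (k %% Q < Fr)%N then alpha else h (nth point ys (k %% Q - Fr)).

Lemma slot_value_sum alpha h :
  \sum_(0 <= k < Q) slot_value alpha h k = Fr%:R * alpha + \sum_(y <- ys) h y.
Proof.
rewrite (@big_cat_nat _ _ _ Fr) ?leq_addr//=; congr (_ + _).
  rewrite mulr_natl -[Fr in RHS]subn0 -sumr_const_nat; apply: eq_big_nat => k /andP[_ kF].
  by rewrite /slot_value modn_small ?kF// (leq_trans kF)// leq_addr.
rewrite -{1}[Fr]add0n big_addn /Q addKn [RHS](big_nth point).
apply: eq_big_nat => k /andP[_ ks]; rewrite /slot_value modn_small.
  by rewrite ltnNge leq_addl/= addnK.
by rewrite addnC ltn_add2l.
Qed.

Lemma slot_value_average alpha h : (0 < Q)%N -> exists c0, forall b,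
  `|\sum_(0 <= k < b) slot_value alpha h k -
    b%:R * ((Fr%:R * alpha + \sum_(y <- ys) h y) / Q%:R)| <= c0.
Proof.
move=> Q0; have [|c0 H] := @periodic_average Q (slot_value alpha h) Q0.
  by move=> k; rewrite /slot_value modnDr.
by exists c0 => b; rewrite -slot_value_sum.
Qed.

Lemma slot_average_norm alpha h (c : R) : (0 < Q)%N -> `|alpha| <= c ->
  (forall y, `|h y| <= c) ->
  `|(Fr%:R * alpha + \sum_(y <- ys) h y) / Q%:R| <= c.
Proof.
move=> Q0 ac hc; have Qp : 0 < Q%:R :> R by rewrite ltr0n.
rewrite normrM normfV [`|Q%:R|]ger0_norm// ler_pdivrMr//.
rewrite (le_trans (ler_normD _ _))// /Q natrD mulrDr lerD//.
  by rewrite normrM ger0_norm// mulrC ler_wpM2r.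
rewrite (le_trans (ler_norm_sum _ _ _))// mulrC -sumr_const_seq.
by apply: ler_sum.
Qed.

Definition orbit_closure (I : Type) (z : I -> X) : set X :=
  closure [set iter p.1 f (z p.2) | p in [set: nat * I]].

Lemma orbit_closure_invariant (I : Type) (z : I -> X) x : continuous f ->
  orbit_closure z x -> closure (forward_orbit f x) `<=` orbit_closure z.
Proof.
move=> cf zx.
have step y : orbit_closure z y -> orbit_closure z (f y).
  move=> zy B nB; have nfB : nbhs y (f @^-1` B) by exact: cf.
  by have [_ [[[m i] _ <-] Bm]] := zy _ nfB; exists (iter m.+1 f (z i)); split => //; exists (m.+1, i).
have sub : forward_orbit f x `<=` orbit_closure z.
  by move=> _ [k _ <-]; elim: k => //= k IH; exact: step.
apply: (subset_trans (closureS sub)).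
by rewrite -(closure_id _).1//; exact: closed_closure.
Qed.

(** For fixed [N] the bound is a closed condition. This is why averages are estimated from every
    starting time [m] with a common threshold on [N]. *)
Lemma orbit_closure_birkhoff (I : Type) (z : I -> X) (g : X -> R) (c : R) N y :
  continuous f -> continuous g ->
  (forall m i, c <= birkhoff_sum f g N (iter m f (z i))) ->
  orbit_closure z y -> c <= birkhoff_sum f g N y.
Proof.
move=> cf cg H.
pose B := birkhoff_sum f g N @^-1` [set x | c <= x].
have cl : closed B.
  apply: closed_comp; last exact: closed_ge.
  by move=> x _; exact: continuous_birkhoff_sum.
move=> zy; suff : B y by [].
rewrite (closure_id B).1//; apply: closureS zy.
by move=> _ [[m i] _ <-]; exact: H.
Qed.

End Superblocks.

Section Construction.
Context {R : realType} {X : pointedMetricType R} (f : X -> X).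
Context (cX : compact [set: X]) (cf : continuous f).
Context (Fr : nat) (ys : seq X) (L G : nat) (e d : R).
Context (A : finType) (pE : A -> X).
Context (z : (nat -> A) -> X) (s : (nat -> A) -> nat -> nat).

Let Q := (Fr + size ys)%N.

Definition slot_point (k : nat) (a : A) : X :=
  if (k %% Q < Fr)%N then pE a else nth point ys (k %% Q - Fr).

Context (Q0 : (0 < Q)%N) (L0 : (0 < L)%N) (GL : (G <= L)%N) (d0 : 0 <= d).
Context (tr : forall w, traces f L G e d (s w) (z w) (fun k => slot_point k (w k))).

(** One [xi] covers the tracing errors, the other the boundary terms, whose total is independent of
    [N] and of the word. *)
Lemma superblock_average (g : X -> R) (c eta alpha xi : R) :
  continuous g -> (forall y, `|g y| <= c) ->
  (forall x y, mdist x y <= e -> `|g x - g y| <= eta) -> 0 <= eta ->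
  (forall a, alpha <= birkhoff_sum f g L (pE a)) -> `|alpha| <= L%:R * c ->
  0 < xi -> 3 * tracing_error L G d c eta <= L%:R * xi ->
  exists N0 : nat, forall y N, orbit_closure f z y -> (N0 <= N)%N ->
    N%:R * ((Fr%:R * alpha + \sum_(y <- ys) birkhoff_sum f g L y) / Q%:R / L%:R -
      2 * xi) <= birkhoff_sum f g N y.
Proof.
move=> cg gc ge eta0 galpha alphac xi0 Exi.
set U := (_ / Q%:R).
have [c0 Hc0] := slot_value_average alpha (birkhoff_sum f g L) Q0.
have UC : `|U| <= L%:R * c.
  by apply: slot_average_norm => // y; exact: birkhoff_sum_norm.
have Lp : 0 < L%:R :> R by rewrite ltr0n.
pose K := 2 * (c0 + c * (L + G)%:R + (L%:R * c + tracing_error L G d c eta)).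
exists (Num.truncn (K / xi)).+1 => y N zy N0N.
apply: orbit_closure_birkhoff zy => // m w.
have := @traces_average _ _ f L G e d (s w) (z w) _ (tr w) g c eta gc ge eta0
  U c0 (slot_value Fr ys alpha (birkhoff_sum f g L)) m N L0 GL d0 _ Hc0 UC.
have uk k : slot_value Fr ys alpha (birkhoff_sum f g L) k <=
    birkhoff_sum f g L (slot_point k (w k)).
  by rewrite /slot_value /slot_point -/Q; case: ifP.
move=> /(_ uk); apply: le_trans.
have KN : K <= N%:R * xi.
  by rewrite -ler_pdivrMr// (le_trans (ltW (truncnS_gt _)))// ler_nat.
rewrite -/K.
have : (3 * tracing_error L G d c eta) / L%:R <= xi by rewrite ler_pdivrMr// (mulrC xi).
move=> /(ler_wpM2l (ler0n R N)).
by rewrite (mulrBl L%:R^-1); move: KN; lra.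
Qed.

Lemma superblock_pressure (phi : X -> R) (C eta a b B e' : R) (a0 : A) :
  (0 < G)%N -> (forall y, `|phi y| <= C) ->
  (forall x y, mdist x y <= e -> `|phi x - phi y| <= eta) -> 0 <= eta ->
  (forall a b, (mismatch f L (4 * e) (pE a) (fun j => iter j f (pE b)))%:R <=
    2 * d * L%:R -> a = b) ->
  expR a <= \sum_(l : A) expR (birkhoff_sum f phi L (pE l)) ->
  L%:R * b <= (Fr%:R * a + \sum_(y <- ys) birkhoff_sum f phi L y) / Q%:R ->
  `|b| <= B -> e' <= e ->
  ((b - pressure_loss L G d C eta B)%:E <=
    pressure_eps f phi (orbit_closure f z) e')%E.
Proof.
move=> G0 phiC osc eta0 inj mass avg bB e'e.
have [c0 Hc0] := slot_value_average a (birkhoff_sum f phi L) Q0.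
(* In a fixed slot only [a0] is allowed, which makes separation trivial there and reduces the mass
   to one term. *)
pose supp k l := (k %% Q < Fr)%N || (l == a0).
apply: (@pressure_eps_lower_bound _ _ f phi L G e d A a0 supp slot_point z s L0 G0 d0
  tr _ C eta phiC osc eta0 (slot_value Fr ys a (birkhoff_sum f phi L)) _ b B c0 bB).
- move=> k l l'; rewrite /supp /slot_point; case: ifP => _ /=; first by move=> _ _; exact: inj.
  by move=> /eqP -> /eqP ->.
- move=> k; rewrite /slot_value /supp /slot_point -/Q; case: ifP => _ /=.
    by rewrite big_mkcond in mass *.
  by rewrite big_pred1_eq.
- move=> k; have := Hc0 k; rewrite ler_norml => /andP[+ _].
  have : k%:R * (L%:R * b) <=
      k%:R * ((Fr%:R * a + \sum_(y <- ys) birkhoff_sum f phi L y) / Q%:R).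
    by rewrite ler_wpM2l.
  rewrite -/Q; lra.
- apply: (subclosed_compact _ cX) => //; exact: closed_closure.
- exact: cf.
- by move=> w; apply: subset_closure; exists (0%N, w).
- by [].
Qed.

End Construction.

(** * Choice of parameters and verification that Z is missed *)

Section Avoiding.
Context {R : realType} {X : pointedMetricType R} (f : X -> X).

Lemma uniform_bound (n : nat) (r : 'I_n -> nat) (P : 'I_n -> nat -> R -> Prop) :
  (forall i j, (j < r i)%N -> exists2 e : R, 0 < e & P i j e) ->
  (forall i j e e', e' <= e -> P i j e -> P i j e') ->
  exists2 e : R, 0 < e & forall i j, (j < r i)%N -> P i j e.
Proof.
move=> exP monoP.
have /choice[e He] : forall p : 'I_n * nat, exists e, 0 < e /\ ((p.2 < r p.1)%N -> P p.1 p.2 e).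
  move=> [i j] /=; have [ji|_] := ltnP j (r i); last by exists 1.
  by have [e e0 Pe] := exP i j ji; exists e.
have [p _|c c0 Hc] := @seq_lower_bound R _
    [seq (i, j) | i <- enum 'I_n, j <- iota 0 (\sum_i r i)] e; first by have [] := He p.
exists c => // i j ji; have [_ /(_ ji)] := He (i, j).
apply: monoP; apply: Hc; apply: allpairs_f; first by rewrite mem_enum.
by rewrite mem_iota add0n /= (leq_trans ji)// (bigD1 i)//= leq_addr.
Qed.

(* The values [V j] are [gap]-apart, so each [v i] is close to at most one of them. *)
Lemma far_value (n : nat) (v : 'I_n -> R) (V : nat -> R) (gap : R) : 0 < gap ->
  (forall j, V j + gap <= V j.+1) ->
  exists2 j, (j <= n)%N & forall i, gap / 2 <= `|V j - v i|.
Proof.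
move=> gap0 Vgap; apply: contrapT => H.
have /choice[c Hc] : forall j : 'I_n.+1, exists i, `|V j - v i| < gap / 2.
  move=> j; apply: contrapT => /forallNP Hj; apply: H; exists j; first by rewrite -ltnS.
  by move=> i; rewrite leNgt; apply/negP; exact: Hj.
have Vlt j k : (j < k)%N -> V j + gap <= V k.
  elim: k => // k IH; rewrite ltnS leq_eqVlt => /predU1P[->//|/IH].
  by have := Vgap k; lra.
have inj : injective c.
  have half (j k : 'I_n.+1) : c j = c k -> ~ (j < k)%N.
    move=> cjk /Vlt; have := Hc j; have := Hc k; rewrite cjk !ltr_norml; lra.
  move=> j k cjk; apply: val_inj => /=.
  by case: (ltngtP (j : nat) k) => // jk; [case: (half j k)|case: (half k j)].
by have := leq_card c inj; rewrite !card_ord ltnn.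
Qed.

Lemma ln_le_linear (eta : R) : 0 < eta ->
  exists N : nat, forall L G : nat, (N <= L)%N -> (0 < G <= L)%N -> ln G%:R <= eta * L%:R.
Proof.
move=> eta0; have [N HN] := quadratic_le_expR eta0.
exists N => L G /HN H /andP[G0 GL].
rewrite -[leRHS]expRK ler_ln ?posrE ?expR_gt0 ?ltr0n// (le_trans _ H)//.
have : G%:R <= L%:R :> R by rewrite ler_nat.
have : 0 <= L%:R :> R by [].
have : 0 <= (2 * L%:R + 1) ^+ 2 - (2 * L%:R + 1) :> R.
  by rewrite expr2 -{3}[2 * L%:R + 1]mulr1 -mulrBr mulr_ge0//; lra.
lra.
Qed.

Lemma avoiding_orbit_closure (I : Type) (z : I -> X) (n : nat) (Z_ : 'I_n -> set X) :
  continuous f -> (forall i y, orbit_closure f z y -> ~ Z_ i y) ->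
  orbit_closure f z `<=` avoiding f (\bigcup_(i in [set: 'I_n]) Z_ i).
Proof.
move=> cf H x zx; rewrite /avoiding /= -subset0 => y [xy [i _ Zy]].
by apply: (H i y) => //; exact: orbit_closure_invariant xy.
Qed.

Lemma pos_below3 (x y w : R) : 0 < x -> 0 < y -> 0 < w ->
  exists c : R, [/\ 0 < c, c <= x, c <= y & c <= w].
Proof.
move=> x0 y0 w0; exists (Num.min x (Num.min y w)).
by rewrite !lt_min x0 y0 w0 !ge_min !lexx !orbT.
Qed.

Lemma norm_between (N V S zeta zeta' xi : R) : 0 <= zeta -> 0 <= N -> zeta' <= zeta ->
  N * (V - 2 * xi) <= S -> N * (- V - zeta' - 2 * xi) <= - S ->
  `|S - N * V| <= N * (zeta + 2 * xi).
Proof.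
move=> zeta0 N0 zz; have := ler_wpM2l N0 zz; have : 0 <= N * zeta by rewrite mulr_ge0.
by rewrite ler_norml; lra.
Qed.

Lemma norm_close (N V v S x y : R) : 0 < N -> `|S - N * V| <= N * x ->
  `|S - N * v| <= N * y -> `|V - v| <= x + y.
Proof.
move=> N0 SV Sv; rewrite -(ler_pM2l N0) -[N in N * `|_|](ger0_norm (ltW N0)) -normrM.
by move: SV Sv; rewrite !ler_norml; lra.
Qed.

Lemma gap_contradiction (gap D zeta xi : R) : 0 < gap -> zeta <= gap / 16 ->
  xi <= gap / 16 -> gap / 2 <= D -> D <= zeta + 2 * xi + gap / 16 -> False.
Proof. lra. Qed.

(** The losses [t * zeta] and [2 * xi] are each at most a quarter of [t * c], so at least half of
    [t * b] survives. *)
Lemma mean_contradiction (N S t m b zeta xi c : R) : 0 < N -> 0 < t -> c <= b ->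
  zeta <= c / 4 -> xi <= t * c / 8 -> t * (b - zeta) <= m ->
  N * (m - 2 * xi) <= S -> S < N * (t / 2 * b) -> False.
Proof.
move=> N0 t0 cb zc xc tm NS SN.
have : t * zeta <= t * (c / 4) by rewrite ler_pM2l.
have : t * c <= t * b by rewrite ler_pM2l.
have : N * (m - 2 * xi) < N * (t / 2 * b) by exact: le_lt_trans SN.
by rewrite ltr_pM2l//; lra.
Qed.

Lemma average_pressure (F T L a C eta : R) : 0 <= F -> 0 <= L ->
  a + C <= eta * (T + 1) ->
  L * (a - eta) * (F * (T + 1)) <= T * F * (L * a) - F * (L * C).
Proof.
move=> F0 L0 aC; rewrite -subr_ge0.
have -> : T * F * (L * a) - F * (L * C) - L * (a - eta) * (F * (T + 1)) =
  F * L * (eta * (T + 1) - (a + C)) by ring.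
by rewrite !mulr_ge0// subr_ge0.
Qed.

Lemma tracing_error_small (L G : nat) (d gam xi : R) : 0 <= xi -> d <= xi / 48 ->
  G%:R <= gam * L%:R -> gam <= xi / 24 ->
  3 * tracing_error L G d 2 (xi / 12) <= L%:R * xi.
Proof.
move=> xi0 dxi GL gamxi; rewrite /tracing_error.
have : 0 <= L%:R * xi by rewrite mulr_ge0.
have : L%:R * d <= L%:R * (xi / 48) by rewrite ler_wpM2l.
have : gam * L%:R <= xi / 24 * L%:R by rewrite ler_wpM2r.
lra.
Qed.

Lemma pressure_loss_small (L G : nat) (d gam C B eta : R) : (0 < L)%N ->
  0 <= C -> 0 <= B -> 0 <= d ->
  d * (2 * C + B + 1) <= eta -> gam * (2 * C + B + 1) <= eta ->
  G%:R <= gam * L%:R -> ln G%:R <= eta * L%:R ->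
  pressure_loss L G d C eta B <= 4 * eta.
Proof.
move=> L0 C0 B0 d0 dW gamW GL lnG; have Lp : 0 < L%:R :> R by rewrite ltr0n.
rewrite /pressure_loss ler_pdivrMr// /tracing_error.
have : L%:R * (d * (2 * C + B + 1)) <= L%:R * eta by rewrite ler_wpM2l.
have : (gam * (2 * C + B + 1)) * L%:R <= eta * L%:R by rewrite ler_wpM2r.
have : G%:R * (2 * C + B + 1) <= gam * L%:R * (2 * C + B + 1).
  by rewrite ler_wpM2r//; lra.
have : 0 <= L%:R * d by rewrite mulr_ge0.
have : 0 <= L%:R * d * B by rewrite mulr_ge0// mulr_ge0.
have : 0 <= G%:R :> R by [].
lra.
Qed.

(** The ten [eta] are five from [separated_heavy_set], one for the fixed slots and four from
    [pressure_loss_small]. *)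
Lemma avoiding_pressure_ge (phi g0 : X -> R) (C eta e0 a gam0 : R) (n : nat)
    (Z_ : 'I_n -> set X) : compact [set: X] -> continuous f ->
  approximate_product_property f ->
  0 < eta -> 0 < e0 -> (forall y, `|phi y| <= C) ->
  (forall x y, mdist x y <= e0 -> `|phi x - phi y| <= eta) ->
  continuous g0 -> (forall y, 0 <= g0 y <= 1) -> 0 < gam0 ->
  (forall N, exists L x x', (N <= L)%N /\
    L%:R * gam0 <= birkhoff_sum f g0 L x' - birkhoff_sum f g0 L x) ->
  (forall i t, 0 < t < 1 -> obstructed f g0 t (Z_ i)) ->
  (a%:E < pressure_eps f phi setT e0)%E ->
  exists2 e1 : R, 0 < e1 & forall e' : R, e' <= e1 ->
    ((a - 10 * eta)%:E <=
      pressure_eps f phi (avoiding f (\bigcup_(i in [set: 'I_n]) Z_ i)) e')%E.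
Proof.
move=> cX cf app eta0 e00 phiC osc cg0 g01 gam00 freq obs aP.
have C0 : 0 <= C by rewrite (le_trans _ (phiC point)).
(* There are [T] free slots per fixed one. Fixed slots contribute at worst [- C] per unit of time,
   and [T] dilutes this to a loss of at most [eta]. *)
pose T := Num.truncn ((`|a| + 5 * eta + C) / eta).
have T1 : 0 < T.+1%:R :> R by rewrite ltr0n.
have n1 : 0 < n.+1%:R :> R by rewrite ltr0n.
have HT : `|a| + 5 * eta + C <= eta * T.+1%:R.
  by rewrite [leRHS]mulrC -ler_pdivrMr//; exact/ltW/truncnS_gt.
(* The share of slots given to each of n + 1 groups: one per [Z_ i] and one for adjusting the
   average of [g0]. Obstructions are used at [tau / 2] to leave room for errors. *)
pose tau : R := (n.+1%:R * T.+1%:R)^-1.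
have tau0 : 0 < tau by rewrite invr_gt0 mulr_gt0.
have tau1 : tau <= 1.
  by rewrite invf_le1 ?mulr_gt0// -natrM ler1n.
(* A lower bound for the change of the mean of [g0] when [m'] slots pass from the low segment [xl]
   to the high segment [xh]. *)
pose gap : R := gam0 * tau / n.+1%:R.
have gap0 : 0 < gap by rewrite !mulr_gt0// invr_gt0.
have t01 : 0 < tau / 2 < 1 by apply/andP; split; lra.
have /choice[v Hv] : forall i, exists v, exists (r : nat) (g : nat -> X -> R) (b : nat -> R),
  [/\ forall j, (j < r)%N -> [/\ continuous (g j), forall y, 0 <= g j y <= 1 & 0 < b j],
    forall zeta : R, 0 < zeta -> exists m0 : nat, forall m L, (m0 <= m)%N -> (0 < L)%N ->
      exists2 s : seq X, size s = m & forall j, (j < r)%N ->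
        m%:R * (L%:R * (b j - zeta)) <= \sum_(y <- s) birkhoff_sum f (g j) L y &
    forall x, Z_ i x ->
      (forall tol, 0 < tol -> forall N, exists2 n, (N <= n)%N &
        `|birkhoff_sum f g0 n x - n%:R * v| <= n%:R * tol) \/
      exists2 j, (j < r)%N & forall N, exists2 n, (N <= n)%N &
        (0 < n)%N /\ birkhoff_sum f (g j) n x < n%:R * (tau / 2 * b j)].
  by move=> i; exact: obs.
have {Hv}/choice[r Hr] := Hv; have {Hr}/choice[g Hg] := Hr.
have {Hg}/choice[b Hb] := Hg.
have [i j ji|i j c c' cc' /(le_trans cc')//|bmin bmin0 Hbmin] :=
    @uniform_bound n r (fun i j c => c <= b i j).
  by have [/(_ _ ji)[_ _ b0] _ _] := Hb i; exists (b i j).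
have gap16 : 0 < gap / 16 by rewrite divr_gt0.
have [zeta [zeta0 zeta1 zgap zb]] := pos_below3 ltr01 gap16 (divr_gt0 bmin0 (ltr0Sn R 3)).
have tb0 : 0 < tau * bmin / 8 by rewrite divr_gt0// mulr_gt0.
have [xi [xi0 xgap _ xb]] := pos_below3 gap16 ltr01 tb0.
have xi12 : 0 < xi / 12 by rewrite divr_gt0.
have [i j ji|i j e e' ee' He x y xy|eg eg0 Heg] := @uniform_bound n r
    (fun i j e => forall x y, mdist x y <= e -> `|g i j x - g i j y| <= xi / 12).
- by have [/(_ _ ji)[cg _ _] _ _] := Hb i; exact: compact_unif_continuous.
- by apply: He; exact: le_trans ee'.
have [eg' eg'0 Heg'] := compact_unif_continuous cX cg0 xi12.
have [e [e_gt0 e_e0 e_eg e_eg']] := pos_below3 (divr_gt0 e00 (ltr0Sn R 14)) eg0 eg'0.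
have ee0 : 15 * e <= e0 by lra.
have [d1 d10 sepE] := separated_heavy_set cX cf phiC osc g01 e_gt0 ee0 eta0 zeta0 aP.
pose B : R := `|a| + 6 * eta.
have a_ge0 := normr_ge0 a.
have B0 : 0 <= B by rewrite addr_ge0// mulr_ge0// ltW.
pose W : R := 2 * C + B + 1.
have W0 : 0 < W by rewrite ltr_wpDl// addr_ge0// mulr_ge0.
have etaW : 0 < eta / W by rewrite divr_gt0.
have [d [d_gt0 dd1 dW dxi]] := pos_below3 d10 etaW (divr_gt0 xi0 (ltr0Sn R 47)).
have [gam [gam_gt0 gam1 gamW gamxi]] :=
  pos_below3 ltr01 etaW (divr_gt0 xi0 (ltr0Sn R 23)).
rewrite ler_pdivlMr// in dW; rewrite ler_pdivlMr// in gamW.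
have [N1 HN1] := sepE d d_gt0 dd1.
have [N2 HN2] := app_traces app e_gt0 d_gt0 gam_gt0.
have [N3 HN3] := ln_le_linear eta0.
(* The averages are known to spread only at infinitely many lengths, so [L] is dictated here and the
   other estimates hold for all large lengths. *)
have [L [xl [xh [NL Hgap]]]] := freq (maxn N1 (maxn N2 N3)).
move: NL; rewrite !geq_max => /andP[N1L /andP[N2L N3L]].
have [G [L0 G0 GL trL]] := HN2 L N2L.
have Lp : 0 < L%:R :> R by rewrite ltr0n.
have GL' : (G <= L)%N.
  by rewrite -(ler_nat R) (le_trans GL)// -[leRHS]mul1r ler_wpM2r.
have [E [alpha [uE alpha01 sepL Eg0 massE]]] := HN1 L N1L.
case: E => [|x0 E'] in uE sepL Eg0 massE *.
  by move: massE; rewrite big_nil leNgt expR_gt0.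
set E := x0 :: E' in uE sepL Eg0 massE.
have /choice[m0 Hm0] : forall i, exists m0 : nat, forall m L, (m0 <= m)%N -> (0 < L)%N ->
      exists2 s : seq X, size s = m & forall j, (j < r i)%N ->
        m%:R * (L%:R * (b i j - zeta)) <= \sum_(y <- s) birkhoff_sum f (g i j) L y.
  by move=> i; have [_ + _] := Hb i; exact.
(* All lists have the same length [m], a multiple of n + 1, so that [j * m'] adjusting slots can be
   high for each [j <= n]. *)
pose m' := (\sum_i m0 i).+1; pose m := (m' * n.+1)%N.
have m'0 : 0 < m'%:R :> R by rewrite ltr0n.
have mE : m%:R = m'%:R * n.+1%:R :> R by rewrite /m natrM.
have m0m i : (m0 i <= m)%N.
  by rewrite /m (leq_trans _ (leq_pmulr _ _))// /m' ltnW// ltnS (bigD1 i)//= leq_addr.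
have /choice[ss Hss] : forall i, exists s : seq X, size s = m /\ forall j, (j < r i)%N ->
        m%:R * (L%:R * (b i j - zeta)) <= \sum_(y <- s) birkhoff_sum f (g i j) L y.
  by move=> i; have [s ? ?] := Hm0 i m L (m0m i) L0; exists s.
pose S h := \sum_i \sum_(y <- ss i) h y : R.
pose F := (m * n.+1)%N; pose Fr := (T * F)%N.
have F0 : (0 < F)%N by rewrite /F /m !muln_gt0.
have Fp : 0 < F%:R :> R by rewrite ltr0n.
pose Q := (F * T.+1)%N.
have QE : Q%:R = F%:R * T.+1%:R :> R by rewrite /Q natrM.
have Qp : 0 < Q%:R :> R by rewrite QE mulr_gt0.
have mQ : m%:R / Q%:R = tau.
  rewrite QE /F natrM /tau; field.
  by rewrite !gt_eqF// mE mulr_gt0.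
pose V (j : nat) : R := (Fr%:R * (L%:R * alpha) + (S (birkhoff_sum f g0 L) +
   (j%:R * m'%:R * birkhoff_sum f g0 L xh +
    (m%:R - j%:R * m'%:R) * birkhoff_sum f g0 L xl))) / Q%:R / L%:R.
have Vgap j : V j + gap <= V j.+1.
  have -> : V j.+1 = V j + m'%:R * (birkhoff_sum f g0 L xh - birkhoff_sum f g0 L xl) / Q%:R / L%:R.
    by rewrite /V -[j.+1%:R]natr1; field; rewrite !gt_eqF.
  rewrite lerD2l /gap -mQ mE ler_pdivlMr// ler_pdivlMr//.
  have -> : gam0 * (m'%:R * n.+1%:R / Q%:R) / n.+1%:R * L%:R * Q%:R = m'%:R * (L%:R * gam0).
    by field; rewrite !gt_eqF.
  by rewrite ler_wpM2l// ltW.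
have [j jn Hj] := far_value v gap0 Vgap.
have jm : (j * m' <= m)%N by rewrite /m mulnC leq_mul2l (leq_trans jn)// orbT.
pose ys := flatten [seq ss i | i <- enum 'I_n] ++
  (nseq (j * m') xh ++ nseq (m - j * m') xl).
have ys_sum (h : X -> R) : \sum_(y <- ys) h y =
    S h + (j%:R * m'%:R * h xh + (m%:R - j%:R * m'%:R) * h xl).
  rewrite /ys !big_cat big_flatten big_map big_enum/= !big_nseq !iter_addr_0.
  by rewrite -(mulr_natl (h xh)) -(mulr_natl (h xl)) natrB// natrM.
have size_ys : size ys = F.
  rewrite /ys !size_cat !size_nseq size_flatten /shape -map_comp sumnE big_map.
  rewrite (eq_bigr (fun=> m)); last by move=> i _; exact: (Hss i).1.
  by rewrite big_enum/= sum_nat_const card_ord subnKC// /F mulnS addnC mulnC.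
have QF : (Fr + size ys)%N = Q by rewrite size_ys /Fr /Q mulnS addnC mulnC.
pose pE (l : 'I_(size E)) : X := nth point E l.
have pE_mem l : pE l \in E by exact: mem_nth.
have /choice[s /choice[z tr]] : forall w : nat -> 'I_(size E), exists s z,
    traces f L G e d s z (fun k => slot_point Fr ys pE k (w k)).
  by move=> w; exact: trL.
have Q0 : (0 < Fr + size ys)%N by rewrite QF -(ltr0n R).
have d_ge0 : 0 <= d by exact: ltW.
have average (h : X -> R) (al : R) : continuous h -> (forall y, `|h y| <= 1) ->
    (forall x y, mdist x y <= e -> `|h x - h y| <= xi / 12) ->
    (forall l, al <= birkhoff_sum f h L (pE l)) -> `|al| <= L%:R * 2 ->
    exists N0 : nat, forall y N, orbit_closure f z y -> (N0 <= N)%N ->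
      N%:R * ((Fr%:R * al + \sum_(y <- ys) birkhoff_sum f h L y) / Q%:R / L%:R - 2 * xi) <=
      birkhoff_sum f h N y.
  move=> ch h1 hosc hal al2; rewrite -QF.
  apply: (@superblock_average _ _ f cf Fr ys L G e d _ pE z s Q0 L0 GL' d_ge0 tr
    h 2 (xi / 12) al xi) => //.
  - by move=> y; rewrite (le_trans (h1 y))// ler1n.
  - exact: ltW.
  - exact: tracing_error_small (ltW xi0) dxi GL gamxi.
have oscg0 x y : mdist x y <= e -> `|g0 x - g0 y| <= xi / 12.
  by move=> xy; apply: Heg'; exact: le_trans e_eg'.
have g0n y : `|g0 y| <= 1 by rewrite ger0_norm; have /andP[] := g01 y.
have /andP[al0 al1] := alpha01.
have [||N4 lower] := @average g0 (L%:R * alpha) cg0 g0n oscg0.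
- by move=> l; have /andP[] := Eg0 _ (pE_mem l).
- by rewrite normrM !ger0_norm// ler_wpM2l// (le_trans al1)// ler1n.
(* The upper bound comes from the lower one for [- g0]. Averages over free slots are known up to
   [zeta] only, which is the discrepancy in [values]. *)
have [|||||N5 upper] := @average (fun y => - g0 y) (- (L%:R * (alpha + zeta))).
- by move=> x; apply: cvgN; exact: cg0.
- by move=> y; rewrite normrN.
- by move=> x y xy; rewrite opprK addrC distrC; exact: oscg0.
- by move=> l; rewrite birkhoff_sumN lerN2; have /andP[] := Eg0 _ (pE_mem l).
- by rewrite normrN normrM !ger0_norm ?addr_ge0 ?(ltW zeta0)// ler_wpM2l// lerD.
have values y N : orbit_closure f z y -> (maxn N4 N5 <= N)%N ->
    `|birkhoff_sum f g0 N y - N%:R * V j| <= N%:R * (zeta + 2 * xi).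
  rewrite geq_max => zy /andP[N4N N5N].
  have lo := lower y N zy N4N; have up := upper y N zy N5N.
  rewrite ys_sum -/(V j) in lo.
  have VE : (Fr%:R * - (L%:R * (alpha + zeta)) +
      \sum_(y <- ys) birkhoff_sum f (fun y => - g0 y) L y) / Q%:R / L%:R =
      - V j - zeta * (Fr%:R / Q%:R).
    rewrite (eq_bigr (fun y => - birkhoff_sum f g0 L y)); last first.
      by move=> w _; exact: birkhoff_sumN.
    by rewrite sumrN ys_sum /V; field; rewrite !gt_eqF.
  rewrite VE birkhoff_sumN in up.
  have FQ : zeta * (Fr%:R / Q%:R) <= zeta.
    rewrite -[leRHS]mulr1 ler_wpM2l ?(ltW zeta0)// ler_pdivrMr// mul1r ler_nat.
    by rewrite -QF leq_addr.
  exact: norm_between (ltW zeta0) (ler0n R N) FQ lo up.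
have avoid : orbit_closure f z `<=` avoiding f (\bigcup_(i in [set: 'I_n]) Z_ i).
  apply: avoiding_orbit_closure => // i y zy Zy.
  have [gP _ /(_ _ Zy)] := Hb i.
  case=> [near_v|[k kr rare]].
    have [N] := near_v _ gap16 (maxn 1 (maxn N4 N5)).
    rewrite geq_max => /andP[N0 N45] close_v.
    have Np : 0 < N%:R :> R by rewrite ltr0n.
    have close_V := values y N zy N45.
    exact: gap_contradiction gap0 zgap xgap (Hj i) (norm_close Np close_V close_v).
  have [cg g01' b0] := gP k kr.
  have gn w : `|g i k w| <= 1 by rewrite ger0_norm; have /andP[] := g01' w.
  have S0 w : 0 <= birkhoff_sum f (g i k) L w.
    by rewrite -(mulr0 L%:R); apply: birkhoff_sum_ge => w'; have /andP[] := g01' w'.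
  (* As [g i k] is nonnegative, all slots except the list [ss i] may be counted as 0; that list
     alone gives the mean [tau * (b i k - zeta)]. *)
  have [|||N6 low] := @average (g i k) 0 cg gn.
  - by move=> x x' xx'; apply: Heg => //; exact: le_trans e_eg.
  - by move=> l; exact: S0.
  - by rewrite normr0 mulr_ge0.
  have [N N6N [N0 NS]] := rare N6; have {low} := low y N zy N6N.
  have Np : 0 < N%:R :> R by rewrite ltr0n.
  have mean : tau * (b i k - zeta) <= (Fr%:R * 0 +
      \sum_(y <- ys) birkhoff_sum f (g i k) L y) / Q%:R / L%:R.
    rewrite mulr0 add0r -mQ ler_pdivlMr// ler_pdivlMr//.
    have -> : m%:R / Q%:R * (b i k - zeta) * L%:R * Q%:R =
        m%:R * (L%:R * (b i k - zeta)) by field; rewrite gt_eqF.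
    apply: (le_trans ((Hss i).2 k kr)); rewrite ys_sum.
    apply: (@le_trans _ _ (S (birkhoff_sum f (g i k) L))).
      by rewrite /S (bigD1 i)//= lerDl sumr_ge0// => i' _; exact: sumr_ge0.
    rewrite lerDl addr_ge0// mulr_ge0// ?mulr_ge0// subr_ge0 -natrM ler_nat//.
  move=> low; exact: mean_contradiction Np tau0 (Hbmin i k kr) zb xb mean low NS.
exists e; first exact: e_gt0.
move=> e' e'e.
apply: le_trans (pressure_eps_sub _ _ _ avoid).
apply: le_trans (@superblock_pressure _ _ f cX cf Fr ys L G e d _ pE z s Q0 L0 d_ge0 tr
  phi C eta (L%:R * (a - 5 * eta)) (a - 6 * eta) B e' ord0 G0 phiC _ _ _ _ _ _ e'e).
- rewrite lee_fin (_ : a - 10 * eta = a - 6 * eta - 4 * eta); last by ring.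
  rewrite lerD2l lerN2.
  apply: pressure_loss_small dW gamW GL _ => //.
  exact: HN3 (introT andP (conj G0 GL')).
- by move=> x y xy; apply: osc; rewrite (le_trans xy)// (le_trans _ ee0)// ler_peMl ?ler1n// ltW.
- exact: ltW.
- move=> l l' ll'; apply: val_inj; apply/eqP.
  rewrite -(nth_uniq point (ltn_ord l) (ltn_ord l') uE); apply/eqP.
  exact: sepL (pE_mem l) (pE_mem l') ll'.
- rewrite mulrC (le_trans massE)// (big_nth point) big_mkord.
  by [].
- have tail : - (F%:R * (L%:R * C)) <= \sum_(y <- ys) birkhoff_sum f phi L y.
    rewrite -mulrN -size_ys -sumr_const_seq; apply: ler_sum => y _.
    exact: birkhoff_sum_ge_norm.
  rewrite QF ler_pdivlMr// (le_trans _ (lerD (lexx _) tail))// QE /Fr natrM -[T.+1%:R]natr1.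
  have -> : a - 6 * eta = a - 5 * eta - eta by ring.
  apply: average_pressure => //; rewrite natr1 (le_trans _ HT)//.
  have eta5 : 0 <= 5 * eta by rewrite mulr_ge0// ltW.
  by rewrite lerD2r lerD ?ler_norm// (le_trans _ eta5)// oppr_le0.
- by rewrite /B (le_trans (ler_normB _ _))// lerD2l ger0_norm// mulr_ge0// ltW.
Qed.

End Avoiding.

(** * Passage to the limit *)

Section Limits.
Context {R : realType}.

Lemma cvge_from_bounds (T : Type) (F : set_system T) (FF : Filter F) (u : T -> \bar R)
    (l : \bar R) :
  (forall a : R, (a%:E < l)%E -> \forall e \near F, (a%:E < u e)%E) ->
  (forall b : R, (l < b%:E)%E -> \forall e \near F, (u e < b%:E)%E) ->
  u e @[e --> F] --> l.
Proof.
case: l => [r| |] lo up.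
- move=> A nA.
  have /nbhs_ballP[dlt /= d0 HA] : nbhs r (fun x => A x%:E) by exact: nA.
  have l1 : ((r - dlt)%:E < r%:E)%E by rewrite lte_fin ltrBlDr ltrDl.
  have l2 : (r%:E < (r + dlt)%:E)%E by rewrite lte_fin ltrDl.
  apply: filterS2 (lo _ l1) (up _ l2) => e /=; rewrite /preimage/=; case: (u e) => [x| |]//.
  rewrite !lte_fin => rx xr; apply: (HA x).
  by rewrite /ball /= ltr_norml; lra.
- apply/cvgeyPgt => A; exact: lo (ltry A).
- apply/cvgeNyPlt => A; exact: up (ltNyr A).
Qed.

(* Neither [p] nor [P] is monotone, so existence of both limits has to be derived
   from the hypotheses, with common value [limsup P]. *)
Lemma lim_eq_of_bounds (p P : R -> \bar R) :
  (forall e, (p e <= P e)%E) ->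
  (forall eta, 0 < eta -> exists2 r, 0 < r & forall e a, 0 < e < r -> (a%:E < P e)%E ->
    exists2 e1, 0 < e1 & forall e', e' <= e1 -> ((a - eta)%:E <= p e')%E) ->
  lim (p e @[e --> (0 : R)^'+]) = lim (P e @[e --> (0 : R)^'+]).
Proof.
move=> pP H.
pose S r := ereal_sup [set P e | e in [set e | 0 < e < r]].
pose l := ereal_inf [set S r | r in [set r : R | 0 < r]].
have lower (a : R) : (a%:E < l)%E -> \forall e \near (0 : R)^'+, (a%:E < p e)%E.
  move=> al.
  have [a' [aa' a'l]] : exists a' : R, a < a' /\ (a'%:E < l)%E.
    move: al; move: (l : \bar R) => [x| |]//; last by exists (a + 1); rewrite ltrDl ltry.
    by rewrite lte_fin => ax; exists ((a + x) / 2); rewrite lte_fin; lra.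
  have eta0 : 0 < (a' - a) / 2 by rewrite divr_gt0// subr_gt0.
  have [r r0 Hr] := H _ eta0.
  have : (a'%:E < S r)%E by apply: (lt_le_trans a'l); apply: ereal_inf_lbound; exists r.
  move=> /ereal_sup_gt[_ [e0 /= e0r <-] a'P].
  have [e1 e10 He1] := Hr _ _ e0r a'P.
  near=> e; apply: lt_le_trans (He1 e _); first by rewrite lte_fin; lra.
  by near: e; exact: nbhs_right_le.
have upper (b : R) : (l < b%:E)%E -> \forall e \near (0 : R)^'+, (P e < b%:E)%E.
  move=> /ereal_inf_lt[_ [r /= r0 <-] Srb].
  near=> e; apply: le_lt_trans Srb; apply: ereal_sup_ubound; exists e => //=.
  apply/andP; split; near: e; [exact: nbhs_right_gt|exact: nbhs_right_lt].
have Pl : P e @[e --> (0 : R)^'+] --> l.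
  apply: cvge_from_bounds => a; last exact: upper.
  by move=> /lower; apply: filterS => e /lt_le_trans; apply.
have pl : p e @[e --> (0 : R)^'+] --> l.
  apply: cvge_from_bounds => a; first exact: lower.
  by move=> /upper; apply: filterS => e; apply: le_lt_trans.
by rewrite (cvg_lim _ Pl)// (cvg_lim _ pl).
Unshelve. all: by end_near. Qed.

End Limits.

Section Entropy.
Context {R : realType} {X : pointedMetricType R} (f : X -> X).

Lemma birkhoff_sum0 n x : birkhoff_sum f (cst (0 : R)) n x = 0.
Proof. by rewrite /birkhoff_sum big1. Qed.

(** For negative [s], any single ball of a cover already weighs at least 1. *)
Lemma pressure_eps0_ge0 (e : R) : (0 <= pressure_eps f (cst 0%R) setT e)%E.
Proof.
apply: pressure_eps_ge => s s0; exists 1 => // C [_ _ cov].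
have [q Cq Bq] := cov point I.
apply: le_trans (@cover_weight_ge_seq _ _ f (cst 0) s e C [:: q] isT _); last first.
  by move=> q'; rewrite inE => /eqP ->.
rewrite big_seq1; apply: le_trans (ball_weight_ge (cst 0) s Bq).
rewrite birkhoff_sum0 addr0 lee_fin -{1}expR0 ler_expR oppr_ge0.
by rewrite mulr_le0_ge0// ltW.
Qed.

Lemma positive_entropy_scale : (0 < entropy f [set: X])%E ->
  exists e0 h : R, [/\ 0 < e0, 0 < h & (h%:E < pressure_eps f (cst 0%R) setT e0)%E].
Proof.
move=> ent; apply: contrapT => H.
have P0 (e : R) : 0 < e -> pressure_eps f (cst (0 : R)) setT e = 0%E.
  move=> e0; apply/eqP; rewrite eq_le pressure_eps0_ge0 andbT leNgt; apply/negP => P0.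
  apply: H; move: P0; move Ep : (pressure_eps _ _ _ _) => [x| |]//.
    by rewrite lte_fin => x0; exists e, (x / 2); split => //; rewrite ?divr_gt0// Ep lte_fin; lra.
  by exists e, 1; split => //; rewrite Ep ltry.
move: ent; rewrite /entropy /pressure.
rewrite (_ : lim _ = 0%E) ?ltxx//; apply: cvg_lim => //.
apply: cvg_near_cst; near=> e; apply: P0.
by near: e; exact: nbhs_right_gt.
Unshelve. all: by end_near. Qed.

End Entropy.

Theorem theorem1p1 (R : realType) (X : pointedMetricType R) (f : X -> X)
    (phi : X -> R) (n : nat) (Z_ : 'I_n -> set X) :
  compact [set: X] ->
  continuous f ->
  approximate_product_property f ->
  (0 < entropy f [set: X])%E ->
  continuous phi ->
  (forall i : 'I_n,
    [\/ exists x : X, Z_ i = forward_orbit f x,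
        exists2 mu : borel_probability X, invariant_measures f mu &
          Z_ i = [set x | empirical_limits f x mu],
        [/\ compact (Z_ i), set_invariant f (Z_ i) &
            invariant_measures_on f (Z_ i) <> invariant_measures f] |
        exists K L : set (borel_probability X),
          [/\ proper_weak_face f L, K `<=` L, compact K &
              Z_ i = [set x | empirical_limits f x `&` K !=set0]]]) ->
  let Z := \bigcup_(i in [set: 'I_n]) Z_ i in
  pressure f phi (avoiding f Z) = pressure f phi [set: X] /\
  entropy f (avoiding f Z) = entropy f [set: X].
Proof.
move=> cX cf app ent cphi HZ Z.
(* Positive entropy serves to produce [g], which does not depend on the potential; the same [g]
   serves both for [phi] and for the zero potential of the entropy. *)
have [e0 [h [e00 h0 hP]]] := positive_entropy_scale ent.
have [g [cg g01 [gam gam0 freq]]] := nonuniform_averages cX cf app e00 h0 hP.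
have obs i t : 0 < t < 1 -> obstructed f g t (Z_ i).
  move=> t01; have /andP[t0 _] := t01.
  case: (HZ i) => [[x ->]|[mu _ ->]|[cZ fZ neq]|[K [L [faceL KL cK ->]]]].
  - exact: obstructed_orbit.
  - exact: obstructed_empirical.
  - exact: obstructed_subsystem.
  - exact: obstructed_weak_face faceL KL cK.
suff eqP (psi : X -> R) : continuous psi ->
    pressure f psi (avoiding f Z) = pressure f psi [set: X].
  by split; [exact: eqP|apply: eqP => x; exact: cvg_cst].
move=> cpsi; apply: lim_eq_of_bounds => [e|eta eta0].
  exact: pressure_eps_sub.
have [C _ psiC] := compact_bounded cX cpsi.
have [d d0 ->] : exists2 d : R, 0 < d & eta = 10 * d.
  by exists (eta / 10); [rewrite divr_gt0|rewrite mulrC divfK].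
have [r r0 osc] := compact_unif_continuous cX cpsi d0.
exists r => // e a /andP[e_gt0 er] aP.
have [||e1 e10 He1] := @avoiding_pressure_ge _ _ f psi g C d e a gam n Z_
  cX cf app d0 e_gt0 psiC _ cg g01 gam0 _ obs aP.
- by move=> x y xy; apply: osc; rewrite (le_trans xy)// ltW.
- exact: freq.
- by exists e1; [exact: e10|exact: He1].
Qed.
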